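(* Let $F$ be a Douglas Finsler metric on a $2$-dimensional manifold $M$, and let $\sigma: M\to\mathbb{R}$ be a function such that the conformally related metric $e^{\sigma(x)}F$ is also Douglas. Assume $d\sigma\neq 0$ at a point $p\in M$. Then, in a neighborhood of $p$, the metric $F$ is Randers, $F=\alpha+\beta$ with $\alpha(x,y)=\sqrt{g_{ij}(x)y^iy^j}$ for a Riemannian metric $g$ and $\beta$ a $1$-form; the $1$-form $\beta$ is the differential of a function $f$, i.e., $\beta=df$; and $\sigma$ is a function of $f$, i.e., $\sigma=\gamma(f)$ for some function $\gamma$ of one variable, so that $e^{\sigma}F=e^{\gamma(f(x))}\alpha+e^{\gamma(f(x))}\beta$.
   Context: All objects are assumed sufficiently smooth. A Finsler metric on $M$ is a function $F:TM\to[0,\infty)$, continuous on $TM$ and smooth and positive away from the zero section, positively $1$-homogeneous in the fibre variable ($F(x,\lambda y)=\lambda F(x,y)$ for $\lambda>0$; $F(x,-y)=F(x,y)$ is not required), and strictly convex in the sense that the matrix $\tfrac12 [F^2]_{y^iy^j}(x,y)$ is positive definite for all $y\neq 0$. Geodesics of $F$ (arc-length parameterised) are the solutions of $\ddot x^i+2G^i(x,\dot x)=0$, where $G^i=\tfrac14 h^{il}\left([F^2]_{x^ky^l}y^k-[F^2]_{x^l}\right)$ and $(h^{ij})$ is the inverse of the matrix $h_{ij}(x,y)=\tfrac12 [F^2]_{y^iy^j}(x,y)$. A Finsler metric $F$ is called Douglas if there exists a torsion-free affine connection $\Gamma=(\Gamma^i_{jk})$ on the manifold such that each geodesic of $F$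 is, after some re-parameterisation, a geodesic of $\Gamma$. The connections for $F$ and for $e^{\sigma}F$ are not required to be the same. A Randers metric is a Finsler metric of the form $F=\alpha+\beta$ with $\alpha(x,y)=\sqrt{g_{ij}(x)y^iy^j}$ for a Riemannian metric $g$ and $\beta=\beta_i(x)y^i$ a $1$-form.
   Formalization: The clause σ=γ(f), with the resulting formula for e^σF, is claimed only when β≠0 at p; in general only f=φ(σ) with φ smooth is claimed. As stated the clause fails, e.g. for the Euclidean norm F on R² and σ=x¹, where β=0 and f is locally constant. *)

(* Defs.v *)
From HB Require Import structures.
From mathcomp Require Import all_boot all_order all_algebra.
From mathcomp Require Import all_classical all_reals all_analysis.
Import Order.TTheory GRing.Theory Num.Theory.
Import numFieldNormedType.Exports.
Set Implicit Arguments.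
Unset Strict Implicit.
Unset Printing Implicit Defensive.
Local Open Scope classical_set_scope.
Local Open Scope ring_scope.

Section Smooth.
Context {R : realType} {V W : normedModType R}.

(* Directional derivatives in all directions; for finite-dimensional V (the
   only case used) and open U this is the usual class C^k on U. *)
Fixpoint Ck (k : nat) (U : set V) (f : V -> W) : Prop :=
  (forall x, U x -> {for x, continuous f}) /\
  match k with
  | 0 => True
  | k'.+1 => forall v : V,
      (forall x, U x -> derivable f x v) /\ Ck k' U (fun x => 'D_v f x)
  end.

Definition smooth_on (U : set V) (f : V -> W) : Prop := forall k, Ck k U f.

End Smooth.

Definition open_interval {R : realType} (I : set R) : Prop :=
  is_interval I /\ open I.

(* chart_inv is only meaningful on the open set
   [chart_map @` chart_dom] of R^n. *)
Record chart (R : realType) (n : nat) (M : topologicalType) := Chart {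
  chart_dom : set M;
  chart_map : M -> 'rV[R]_n;
  chart_inv : 'rV[R]_n -> M;
  chart_dom_open : open chart_dom;
  chart_im_open : open (chart_map @` chart_dom);
  chart_mapK : forall q, chart_dom q -> chart_inv (chart_map q) = q;
  chart_map_continuous :
    forall q, chart_dom q -> {for q, continuous chart_map};
  chart_inv_continuous :
    forall x, (chart_map @` chart_dom) x -> {for x, continuous chart_inv}
}.

Section Manifold.
Context {R : realType} {n : nat} {M : topologicalType}.
Implicit Types (A : set (chart R n M)) (c d : chart R n M).

Definition chart_im c : set 'rV[R]_n := chart_map c @` chart_dom c.

Definition overlap c d : set 'rV[R]_n :=
  chart_map c @` (chart_dom c `&` chart_dom d).

Definition transition c d : 'rV[R]_n -> 'rV[R]_n := chart_map d \o chart_inv c.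

Definition smooth_manifold A : Prop :=
  [/\ hausdorff_space M, @second_countable M,
      forall q : M, exists2 c, A c & chart_dom c q
    & forall c d, A c -> A d -> smooth_on (overlap c d) (transition c d)].

Definition smooth_function A (s : M -> R) : Prop :=
  forall c, A c -> smooth_on (chart_im c) (s \o chart_inv c).

End Manifold.

Section Coordinates.
Context {R : realType} {n : nat}.
Local Notation E := 'rV[R]_n.
Implicit Types (U : set E) (F : E -> E -> R) (x y : E).
Implicit Types (Gam : 'I_n -> 'I_n -> 'I_n -> E -> R).

Definition basis_vec (i : 'I_n) : E := delta_mx 0 i.

Definition quad_form (h : 'M[R]_n) y : R :=
  \sum_i \sum_j h i j * y 0 i * y 0 j.

Definition lin_form (b : E) y : R := \sum_i b 0 i * y 0 i.

Definition pos_def (h : 'M[R]_n) : Prop :=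
  forall y, y != 0 -> 0 < quad_form h y.

(* h_ij = 1/2 [F^2]_{y^i y^j} *)
Definition fund_tensor F x y : 'M[R]_n :=
  \matrix_(i, j) (2^-1 *
    'D_(basis_vec i) (fun y' => 'D_(basis_vec j) (fun y'' => F x y'' ^+ 2) y') y).

(* G^i = 1/4 h^{il} ([F^2]_{x^k y^l} y^k - [F^2]_{x^l}) *)
Definition spray F x y (i : 'I_n) : R :=
  4^-1 * \sum_l invmx (fund_tensor F x y) i l *
    ((\sum_k 'D_(basis_vec k)
        (fun x' => 'D_(basis_vec l) (fun y' => F x' y' ^+ 2) y) x * y 0 k)
     - 'D_(basis_vec l) (fun x' => F x' y ^+ 2) x).

Definition finsler_on U F : Prop :=
  [/\ forall x y, U x -> 0 <= F x y /\ (y != 0 -> 0 < F x y),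
      forall z : E * E, U z.1 ->
        {for z, continuous (fun z : E * E => F z.1 z.2)},
      smooth_on [set z : E * E | U z.1 /\ z.2 != 0]
        (fun z : E * E => F z.1 z.2),
      forall x y (l : R), U x -> 0 < l -> F x (l *: y) = l * F x y
    & forall x y, U x -> y != 0 -> pos_def (fund_tensor F x y)].

Definition finsler_geodesic U F (I : set R) (x : R -> E) : Prop :=
  forall t, I t ->
  [/\ U (x t), derivable x t 1, derivable (derive1 x) t 1,
      F (x t) (derive1 x t) = 1
    & forall i,
        derive1 (derive1 x) t 0 i + 2 * spray F (x t) (derive1 x t) i = 0].

Definition affine_geodesic U Gam (I : set R) (x : R -> E) : Prop :=
  forall t, I t ->
  [/\ U (x t), derivable x t 1, derivable (derive1 x) t 1
    & forall i, derive1 (derive1 x) t 0 i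
        + \sum_j \sum_k Gam i j k (x t) * derive1 x t 0 j * derive1 x t 0 k = 0].

Definition reparam (J I : set R) (r : R -> R) : Prop :=
  [/\ open_interval J, smooth_on J r, forall t, J t -> derive1 r t != 0
    & r @` J = I].

(* The geodesic equations are local, so it suffices to consider geodesics whose
   image lies in the domain U of one coordinate system. *)
Definition geodesics_reparam U F Gam : Prop :=
  forall (I : set R) (x : R -> E), open_interval I ->
    finsler_geodesic U F I x ->
    exists (J : set R) (r : R -> R),
      reparam J I r /\ affine_geodesic U Gam J (x \o r).

Definition riemannian_on U (g : E -> 'M[R]_n) : Prop :=
  [/\ forall i j, smooth_on U (fun x => g x i j),
      forall x, U x -> (g x)^T = g x
    & forall x, U x -> pos_def (g x)].

End Coordinates.

Section Global.
Context {R : realType} {n : nat} {M : topologicalType}.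
Local Notation E := 'rV[R]_n.
Implicit Types (A : set (chart R n M)).

(* A function on TM is given by its expressions F c x y in the charts c of the
   atlas, x being the coordinates of the base point and y the components of the
   tangent vector; on overlaps, y transforms by the differential of the
   transition map. *)
Definition finsler_metric A (F : chart R n M -> E -> E -> R) : Prop :=
  (forall c, A c -> finsler_on (chart_im c) (F c)) /\
  (forall c d, A c -> A d -> forall x y, overlap c d x ->
     F d (transition c d x) ('D_y (transition c d) x) = F c x y).

(* A torsion-free connection, given by its Christoffel symbols
   Gam c i j k = Gamma^i_{jk} in each chart; with t the transition map,
   d_i t^a Gamma^i_{jk} = d_j d_k t^a + Gamma'^a_{bm} d_j t^b d_k t^m. *)
Definition torsion_free_connection A
    (Gam : chart R n M -> 'I_n -> 'I_n -> 'I_n -> E -> R) : Prop :=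
  [/\ forall c, A c -> forall i j k, smooth_on (chart_im c) (Gam c i j k),
      forall c, A c -> forall i j k x, chart_im c x ->
        Gam c i j k x = Gam c i k j x
    & forall c d, A c -> A d -> forall x, overlap c d x -> forall a j k,
        let t := transition c d in
        let dt i := 'D_(basis_vec i) t in
        \sum_i dt i x 0 a * Gam c i j k x =
          'D_(basis_vec j) (dt k) x 0 a
          + \sum_b \sum_m Gam d a b m (t x) * dt j x 0 b * dt k x 0 m].

Definition douglas A (F : chart R n M -> E -> E -> R) : Prop :=
  exists2 Gam, torsion_free_connection A Gam &
    forall c, A c -> geodesics_reparam (chart_im c) (F c) (Gam c).

Definition conformal (s : M -> R) (F : chart R n M -> E -> E -> R) :
    chart R n M -> E -> E -> R :=
  fun c x y => expR (s (chart_inv c x)) * F c x y.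

End Global.

(* Main.v *)
From HB Require Import structures.
Require Import Defs.
From mathcomp Require Import all_boot all_order all_algebra.
From mathcomp Require Import all_classical all_reals all_analysis.
From mathcomp Require Import ring lra.
Import Order.TTheory GRing.Theory Num.Theory.
Import numFieldNormedType.Exports.
Set Implicit Arguments.
Unset Strict Implicit.
Unset Printing Implicit Defensive.
Local Open Scope classical_set_scope.
Local Open Scope ring_scope.

(** Work in one chart, at a point x where the differential ds of the conformal exponent
    does not vanish.

    A reparametrization of a curve changes the acceleration by a multiple of the velocity
    only.  So if the geodesics of F are those of a connection, up to parametrization, then
    the area form of the spray and the velocity y is a cubic form in y.  In dimension two
    this area form is omega F / hess F up to a factor, with omega F = F_{x^2 y^1} - F_{x^1 y^2}
    and hess F the only independent entry of the fibre Hessian of F (spray_relations).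
    Since every unit vector is the velocity of a geodesic (geodesic_exists, by Picard
    iteration), a Douglas metric satisfies omega F = C hess F with C cubic in y
    (omega_cubic).  Writing this for F and for e^s F and subtracting, one gets, for w
    spanning ker ds, dF(w) = P hess F with P cubic in y (conformal_relation).

    On the affine line u + t w of the fibre, p(t) = F(u + t w) satisfies p' = P p''.  With
    the origin at the zero of p' this is p' = t q p'' with q = 1 + e t + n t^2, and
    N = q^3 p''^2 has derivative - e (q p'')^2.  The opposite line - (u + t w) satisfies the
    same equation, and N takes the end values n F(w)^2 and n F(- w)^2 on one line and the
    same values in the opposite order on the other.  By monotonicity e = 0 and N is
    constant (profile_pair); the equation is then integrated by hand (profile_solve), and
    F(y) = sqrt (Q(y)) + c ds(y) on the whole fibre for a quadratic form Q
    (fibre_randers).  Thus F is Randers with beta = c ds, and polarization of the even part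
    of F and the odd part of F show that g and beta are smooth.

    For such F, hess F takes the same value at u and - u for a suitable u, while C is odd;
    hence omega F(u) + omega F(- u) = 0.  The left-hand side is twice the exterior derivative
    of beta, so that beta = mu ds is closed (randers_form_closed).  Then dmu is proportional
    to ds, mu is constant along the flow of a field tangent to the level curves of s, hence
    mu = m(s) near x (function_of_level).  With Phi' = m, the function f = Phi(s) has
    differential beta, and s is a function of f where beta does not vanish
    (local_randers). *)

(** * Directional derivatives and the classes C^k *)

Section Directional.
Context {R : realType} {V V' W : normedModType R}.

(** Along an affine map the difference quotients agree term by term, so this needs
    no differentiability. *)
Lemma derive_affine (f : V' -> W) (io : V -> V') (x v : V) (w : V') :
  (forall h : R, io (h *: v + x) = h *: w + io x) ->
  'D_v (f \o io) x = 'D_w f (io x).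
Proof.
move=> H; rewrite /derive.
suff -> : (fun h : R => h^-1 *: (((f \o io) \o shift x) (h *: v) - (f \o io) x))
  = (fun h : R => h^-1 *: ((f \o shift (io x)) (h *: w) - f (io x))) by [].
by apply/funext => h /=; rewrite H.
Qed.

Lemma derivable_affine (f : V' -> W) (io : V -> V') (x v : V) (w : V') :
  (forall h : R, io (h *: v + x) = h *: w + io x) ->
  derivable f (io x) w -> derivable (f \o io) x v.
Proof.
move=> H; rewrite /derivable.
suff -> : (fun h : R => h^-1 *: (((f \o io) \o shift x) (h *: v) - (f \o io) x))
  = (fun h : R => h^-1 *: ((f \o shift (io x)) (h *: w) - f (io x))) by [].
by apply/funext => h /=; rewrite H.
Qed.

Lemma is_derive_affine (f : V' -> W) (io : V -> V') (x v : V) (w : V') df :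
  (forall h : R, io (h *: v + x) = h *: w + io x) ->
  is_derive (io x) w f df -> is_derive x v (f \o io) df.
Proof.
move=> H [d1 d2]; apply: DeriveDef; first exact: derivable_affine d1.
by rewrite (derive_affine _ H).
Qed.

End Directional.

Section DirectionalScalar.
Context {R : realType} {V W : normedModType R}.

Lemma is_derive_line (f : V -> W) (x v : V) (t : R) df :
  is_derive (x + t *: v) v f df ->
  is_derive t 1 (fun h : R => f (x + h *: v)) df.
Proof.
move=> H; apply: (@is_derive_affine _ _ _ _ f (fun h : R => x + h *: v)) H.
by move=> h; rewrite scalerDl addrCA /= [h *: 1]mulr1.
Qed.

End DirectionalScalar.

Section DirectionalChain.
Context {R : realType} {V : normedModType R}.

Lemma is_derive_comp1 (g : R -> R) (f : V -> R) (x v : V) (a b : R) :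
  is_derive (f x) 1 g a -> is_derive x v f b ->
  is_derive x v (g \o f) (a * b).
Proof.
move=> Hg Hf.
have Hl : is_derive (0 : R) 1 (fun h : R => f (x + h *: v)) b.
  by apply: is_derive_line; rewrite scale0r addr0.
have H0 : x + (0 : R) *: v = x by rewrite scale0r addr0.
have Hg' : is_derive (f (x + (0 : R) *: v)) 1 g a by rewrite H0.
have Ef : g \o (fun h : R => f (x + h *: v)) = (fun h : R => (g \o f) (h *: v + x)).
  by apply/funext => h /=; rewrite addrC.
have D := is_derive1_comp Hg' Hl; rewrite {}Ef in D.
have E (h : R) : (0 : R) + h *: 1 = h by rewrite add0r [h *: 1]mulr1.
apply: DeriveDef; first by apply/derivable1P; exact: ex_derive.
rewrite -(@derive_val _ _ _ _ _ _ _ D).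
rewrite (@derive_affine _ _ _ _ (g \o f) (fun h : R => h *: v + x) 0 1 v).
  by rewrite scale0r add0r.
by move=> h; rewrite scalerDl addrA [h *: 1]mulr1.
Qed.

End DirectionalChain.

Section CkAlgebra.
Context {R : realType} {V W : normedModType R}.
Implicit Types (U : set V) (f g : V -> W).

Lemma CkS k U f : Ck k.+1 U f -> Ck k U f.
Proof.
elim: k f => [|k IH] f; first by case.
case=> cf H; split=> // v; split; first by have [] := H v.
by apply: IH; have [] := H v.
Qed.

Lemma Ck_ext k U f g : open U -> (forall x, U x -> f x = g x) ->
  Ck k U f -> Ck k U g.
Proof.
move=> oU; elim: k f g => [|k IH] f g fg [cf H]; split.
- move=> x Ux; have nfg : \near x, f x = g x.
    by apply: filterS (open_nbhs_nbhs (conj oU Ux)) => y; exact: fg.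
  rewrite /prop_for /continuous_at -fg //; apply: cvg_trans (cf _ Ux).
  by apply: near_eq_cvg; apply: filterS nfg => y ->.
- by [].
- move=> x Ux; have nfg : \near x, f x = g x.
    by apply: filterS (open_nbhs_nbhs (conj oU Ux)) => y; exact: fg.
  rewrite /prop_for /continuous_at -fg //; apply: cvg_trans (cf _ Ux).
  by apply: near_eq_cvg; apply: filterS nfg => y ->.
- move=> v; have [d1 d2] := H v.
  have nfg x : U x -> \near x, f x = g x.
    by move=> Ux; apply: filterS (open_nbhs_nbhs (conj oU Ux)) => y; exact: fg.
  split=> [x Ux|]; first by apply: near_eq_derivable (d1 _ Ux); exact: nfg.
  by apply: IH d2 => x Ux; apply: near_eq_derive; exact: nfg.
Qed.

Lemma Ck_sub k U U' f : U' `<=` U -> Ck k U f -> Ck k U' f.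
Proof.
move=> sU; elim: k f => [|k IH] f [cf H]; split=> //.
- by move=> x /sU; exact: cf.
- by move=> x /sU; exact: cf.
- by move=> v; have [d1 d2] := H v; split=> [x /sU|]; [exact: d1|exact: IH].
Qed.

Lemma smooth_ext U f g : open U -> (forall x, U x -> f x = g x) ->
  smooth_on U f -> smooth_on U g.
Proof. by move=> oU fg H k; apply: Ck_ext (H k). Qed.

Lemma smooth_sub U U' f : U' `<=` U -> smooth_on U f -> smooth_on U' f.
Proof. by move=> sU H k; apply: Ck_sub (H k). Qed.

Lemma smooth_cont U f : smooth_on U f -> forall x, U x -> {for x, continuous f}.
Proof. by move=> /(_ 0)[]. Qed.

Lemma smooth_derivable U f : smooth_on U f -> forall x v, U x -> derivable f x v.
Proof. by move=> /(_ 1)[_ H] x v; have [d _] := H v; exact: d. Qed.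

Lemma smooth_derive U f : smooth_on U f -> forall v, smooth_on U ('D_v f).
Proof. by move=> H v k; have [_ /(_ v)[]] := H k.+1. Qed.

Lemma Ck_cst k U (a : W) : Ck k U (fun=> a).
Proof.
elim: k a => [|k IH] a; split => //.
- by move=> x _; exact: cst_continuous.
- by move=> x _; exact: cst_continuous.
- move=> v; split=> [x _|]; first exact: derivable_cst.
  suff -> : 'D_v (fun=> a) = (fun=> 0) :> (V -> W) by exact: IH.
  by apply/funext => x; rewrite derive_cst.
Qed.

Lemma CkD k U f g : open U -> Ck k U f -> Ck k U g -> Ck k U (fun x => f x + g x).
Proof.
move=> oU; elim: k f g => [|k IH] f g [cf Hf] [cg Hg]; split => //.
- by move=> x Ux; apply: continuousD; [exact: cf|exact: cg].
- by move=> x Ux; apply: continuousD; [exact: cf|exact: cg].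
- move=> v; have [f1 f2] := Hf v; have [g1 g2] := Hg v.
  split=> [x Ux|]; first by apply: derivableD; [exact: f1|exact: g1].
  apply: (Ck_ext oU _ (IH _ _ f2 g2)) => x Ux.
  by rewrite -deriveD //; [exact: f1|exact: g1].
Qed.

Lemma CkZ k U (f : V -> R) (a : W) : open U -> Ck k U f -> Ck k U (fun x => f x *: a).
Proof.
move=> oU; elim: k f => [|k IH] f [cf Hf]; split => //.
- by move=> x Ux; apply: cvgZr_tmp; exact: cf.
- by move=> x Ux; apply: cvgZr_tmp; exact: cf.
- move=> v; have [f1 f2] := Hf v.
  have D x : U x -> is_derive x v (fun x => f x *: a) ('D_v f x *: a).
    move=> Ux; have df := f1 _ Ux.
    have C : h^-1 *: (((fun x => f x *: a) \o shift x) (h *: v) - f x *: a) @[h --> 0^']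
      --> 'D_v f x *: a.
      rewrite (_ : (fun h => _) = fun h : R => (h^-1 *: ((f \o shift x) (h *: v) - f x)) *: a).
        by apply: cvgZr_tmp; exact: df.
      by apply/funext => h /=; rewrite -scalerBl scalerA.
    by apply: DeriveDef; [apply/cvg_ex; eexists; exact: C|exact: cvg_lim C].
  split=> [x Ux|]; first by have [] := D _ Ux.
  by apply: (Ck_ext oU _ (IH _ f2)) => x Ux; have [_ ->] := D _ Ux.
Qed.

End CkAlgebra.

Section CkScalar.
Context {R : realType} {V : normedModType R}.
Implicit Types (U : set V) (f g : V -> R).

Lemma CkM k U f g : open U -> Ck k U f -> Ck k U g -> Ck k U (fun x => f x * g x).
Proof.
move=> oU; elim: k f g => [|k IH] f g Hf' Hg'; have [cf Hf] := Hf'; have [cg Hg] := Hg';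
    split => //.
- by move=> x Ux; apply: continuousM; [exact: cf|exact: cg].
- by move=> x Ux; apply: continuousM; [exact: cf|exact: cg].
- move=> v; have [f1 f2] := Hf v; have [g1 g2] := Hg v.
  split=> [x Ux|]; first by apply: derivableM; [exact: f1|exact: g1].
  have Hs := CkD oU (IH _ _ (CkS Hf') g2) (IH _ _ (CkS Hg') f2).
  apply: (Ck_ext oU _ Hs) => x Ux.
  by rewrite [RHS](@deriveM _ _ f g) //; [exact: f1|exact: g1].
Qed.

Lemma smoothD U f g : open U -> smooth_on U f -> smooth_on U g ->
  smooth_on U (fun x => f x + g x).
Proof. by move=> oU Hf Hg k; apply: CkD. Qed.

Lemma smoothM U f g : open U -> smooth_on U f -> smooth_on U g ->
  smooth_on U (fun x => f x * g x).
Proof. by move=> oU Hf Hg k; apply: CkM. Qed.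

Lemma smooth_cst U (a : R) : smooth_on U (fun=> a).
Proof. by move=> k; exact: Ck_cst. Qed.

Lemma smoothMl U (a : R) f : open U -> smooth_on U f -> smooth_on U (fun x => a * f x).
Proof. by move=> oU Hf; apply: smoothM => //; exact: smooth_cst. Qed.

Lemma smoothN U f : open U -> smooth_on U f -> smooth_on U (fun x => - f x).
Proof.
move=> oU Hf; have H := smoothMl (-1) oU Hf.
by apply: smooth_ext H => // x _; rewrite mulN1r.
Qed.

Lemma smoothB U f g : open U -> smooth_on U f -> smooth_on U g ->
  smooth_on U (fun x => f x - g x).
Proof. by move=> oU Hf Hg; apply: smoothD => //; exact: smoothN. Qed.

Lemma smoothX U f n : open U -> smooth_on U f -> smooth_on U (fun x => f x ^+ n).
Proof.
move=> oU Hf; elim: n => [|n IH].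
  by apply: smooth_ext (smooth_cst U 1) => // x _; rewrite expr0.
by apply: smooth_ext (smoothM oU Hf IH) => // x _; rewrite exprS.
Qed.

(** The derivative of 1/f is again a product of 1/f and smooth functions, so
    the order of differentiability climbs by induction. *)
Lemma smoothV U f : open U -> smooth_on U f -> (forall x, U x -> f x != 0) ->
  smooth_on U (fun x => (f x)^-1).
Proof.
move=> oU Hf f0 k; elim: k => [|k IH]; split => //.
- by move=> x Ux; apply: cvgV (smooth_cont Hf Ux); exact: f0.
- by move=> x Ux; apply: cvgV (smooth_cont Hf Ux); exact: f0.
- move=> v; have D x : U x -> is_derive x v (fun x => (f x)^-1) (- (f x)^-1 * (f x)^-1 * 'D_v f x).
    move=> Ux; have df := derivableP (smooth_derivable (v:=v) Hf Ux).
    split; first exact: derivableV (f0 _ Ux) _.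
    rewrite (deriveV (f0 _ Ux)) // /GRing.scale /= -exprVn expr2; ring.
  split=> [x Ux|]; first by have [] := D _ Ux.
  have H := CkM oU (CkM oU (CkM oU IH (@smooth_cst U (-1) k)) IH) (smooth_derive Hf v k).
  apply: (Ck_ext oU _ H) => x Ux; have [_ ->] := D _ Ux; ring.
Qed.

Lemma Ck_comp1 k U (I : set R) (g : R -> R) f : open U -> (forall x, U x -> I (f x)) ->
  Ck k I g -> Ck k U f -> Ck k U (g \o f).
Proof.
move=> oU UI; elim: k g f UI => [|k IH] g f UI Hg' Hf'; have [cf Hf] := Hf';
    have [cg Hg] := Hg'; split => //.
- by move=> x Ux; apply: continuous_comp; [exact: cf|apply: cg; exact: UI].
- by move=> x Ux; apply: continuous_comp; [exact: cf|apply: cg; exact: UI].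
- move=> v; have [f1 f2] := Hf v; have [g1 g2] := Hg 1.
  have D x : U x -> is_derive x v (g \o f) ('D_1 g (f x) * 'D_v f x).
    by move=> Ux; apply: is_derive_comp1; apply: derivableP; [apply: g1; exact: UI|exact: f1].
  split=> [x Ux|]; first by have [] := D _ Ux.
  have H := CkM oU (IH _ _ UI g2 (CkS Hf')) f2.
  by apply: (Ck_ext oU _ H) => x Ux; have [_ ->] := D _ Ux.
Qed.

Lemma smooth_comp1 U (I : set R) (g : R -> R) f : open U -> (forall x, U x -> I (f x)) ->
  smooth_on I g -> smooth_on U f -> smooth_on U (g \o f).
Proof. by move=> oU UI Hg Hf k; apply: (Ck_comp1 oU UI). Qed.

End CkScalar.

Section CkAffine.
Context {R : realType} {V V' W : normedModType R}.

(** Affine maps carry directional derivatives to directional derivatives; restrictions to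
    lines and fibres and pull-backs by projections are all instances. *)
Lemma Ck_affine k (U : set V) (U' : set V') (f : V' -> W) (io : V -> V') :
  open U -> (forall x, {for x, continuous io}) -> (forall x, U x -> U' (io x)) ->
  (forall v, exists w, forall x (h : R), io (h *: v + x) = h *: w + io x) ->
  Ck k U' f -> Ck k U (f \o io).
Proof.
move=> oU cio UU' aio; elim: k f => [|k IH] f [cf H]; split => //.
- by move=> x Ux; apply: continuous_comp; [exact: cio|apply: cf; exact: UU'].
- by move=> x Ux; apply: continuous_comp; [exact: cio|apply: cf; exact: UU'].
- move=> v; have [w Hw] := aio v; have [d1 d2] := H w.
  split=> [x Ux|].
    by apply: (derivable_affine (Hw x)); apply: d1; exact: UU'.
  by apply: (Ck_ext oU _ (IH _ d2)) => x Ux; rewrite (derive_affine f (Hw x)).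
Qed.

Lemma smooth_affine (U : set V) (U' : set V') (f : V' -> W) (io : V -> V') :
  open U -> (forall x, {for x, continuous io}) -> (forall x, U x -> U' (io x)) ->
  (forall v, exists w, forall x (h : R), io (h *: v + x) = h *: w + io x) ->
  smooth_on U' f -> smooth_on U (f \o io).
Proof. by move=> oU c1 c2 c3 Hf k; apply: (Ck_affine oU c1 c2 c3). Qed.

End CkAffine.

Section SmoothLine.
Context {R : realType}.

(** On the line the derivative in direction v is v times the derivative in direction 1. *)
Lemma Ck_primitive k (I : set R) (f m : R -> R) : open I ->
  (forall t : R, I t -> is_derive t 1 f (m t)) -> Ck k I m -> Ck k.+1 I f.
Proof.
move=> oI D Hm; split => //.
- by move=> t It; apply/differentiable_continuous/derivable1_diffP; case: (D t It).
- move=> v.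
  have Dv t : I t -> is_derive t v f (m t * v).
    move=> It; have df : differentiable f t by apply/derivable1_diffP; case: (D t It).
    split; first exact: diff_derivable.
    rewrite deriveE // -(mulr1 v) -[v * 1]/(v *: 1) linearZ /= -deriveE //.
    by have [_ ->] := D t It; rewrite [_ *: 1]mulr1 /GRing.scale /= mulrC.
  split=> [t It|]; first by case: (Dv t It).
  apply: (Ck_ext oI _ (CkM oI Hm (@smooth_cst _ _ I v k))) => t It.
  by case: (Dv t It) => _ ->.
Qed.

Lemma smooth_primitive (I : set R) (f m : R -> R) : open I ->
  (forall t : R, I t -> is_derive t 1 f (m t)) -> smooth_on I m -> smooth_on I f.
Proof. by move=> oI D Hm k; apply: CkS; apply: (Ck_primitive oI D). Qed.

Lemma smooth_expR (I : set R) : open I -> smooth_on I expR.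
Proof.
move=> oI; elim=> [|k IH]; last by apply: (Ck_primitive oI _ IH) => t _; exact: is_derive_expR.
by split => // x _; exact: continuous_expR.
Qed.

End SmoothLine.

(** * Mean values and Frechet differentiability *)

Section MeanValue.
Context {R : realType}.

Lemma MVT_sym (g dg : R -> R) (c : R) :
  (forall t : R, `|t| <= `|c| -> is_derive t 1 g (dg t)) ->
  exists2 th, `|th| <= `|c| & g c - g 0 = dg th * c.
Proof.
move=> D.
have [c0|c0] := leP 0 c.
- have [|||th] := @MVT_segment R g dg 0 c => //.
  + move=> x; rewrite in_itv /= => /andP[x0 xc]; apply: D.
    by rewrite !ger0_norm ?(ltW x0) // ltW.
  + apply: derivable_within_continuous => x; rewrite in_itv /= => /andP[x0 xc].
    by apply: (@ex_derive _ _ _ _ _ _ (dg x)); apply: D; rewrite !ger0_norm.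
  rewrite in_itv /= => /andP[x0 xc]; rewrite subr0 => E; exists th => //.
  by rewrite !ger0_norm.
- have [|||th] := @MVT_segment R g dg c 0 => //.
  + exact: ltW.
  + move=> x; rewrite in_itv /= => /andP[cx x0]; apply: D.
    by rewrite !ler0_norm ?ltW // ltrN2.
  + apply: derivable_within_continuous => x; rewrite in_itv /= => /andP[cx x0].
    apply: (@ex_derive _ _ _ _ _ _ (dg x)); apply: D.
    by rewrite !ler0_norm ?lerN2 // ltW.
  rewrite in_itv /= => /andP[cx x0]; rewrite sub0r mulrN => E; exists th.
    by rewrite !ler0_norm ?lerN2 // ltW.
  by rewrite -[LHS]opprB E opprK.
Qed.

Lemma MVT_line {V : normedModType R} (f : V -> R) (y v : V) (c : R) :
  (forall t, `|t| <= `|c| -> derivable f (y + t *: v) v) ->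
  exists2 th, `|th| <= `|c| & f (y + c *: v) - f y = c * 'D_v f (y + th *: v).
Proof.
move=> D.
have [|th Hth E] := @MVT_sym (fun h : R => f (y + h *: v)) (fun h => 'D_v f (y + h *: v)) c.
  by move=> t /D/derivableP; exact: is_derive_line.
by exists th => //; rewrite mulrC -E scale0r addr0.
Qed.

End MeanValue.

Section Frames.
Context {R : realType}.

(** A finite family of vectors with linear coordinates dominated by the norm.
    Differentiability criteria need no more than this about a
    finite-dimensional space, and such families exist for row vectors and for
    products. *)
Definition frame (V : normedModType R) (I : finType) (e : I -> V)
    (c : I -> V -> R) : Prop :=
  [/\ forall v, v = \sum_i c i v *: e i,
      forall i v, `|c i v| <= `|v|
    & forall i (a : R) u v, c i (a *: u + v) = a * c i u + c i v].

Lemma frame_rV n : @frame 'rV[R]_n 'I_n (fun i => delta_mx 0 i) (fun i v => v 0 i).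
Proof.
split=> [v|i v|i a u v]; last by rewrite !mxE.
  exact: row_sum_delta.
by rewrite [leRHS]/Num.Def.normr/= mx_normrE; exact: (le_bigmax _ _ (0, i)).
Qed.

Lemma frame_prod (V1 V2 : normedModType R) (I1 I2 : finType) e1 c1 e2 c2 :
  @frame V1 I1 e1 c1 -> @frame V2 I2 e2 c2 ->
  @frame (V1 * V2)%type (I1 + I2)%type
    (fun i => match i with inl j => (e1 j, 0) | inr j => (0, e2 j) end)
    (fun i v => match i with inl j => c1 j v.1 | inr j => c2 j v.2 end).
Proof.
move=> [s1 n1 l1] [s2 n2 l2]; split.
- move=> [v1 v2]; rewrite big_sumType /=.
  have E1 : \sum_i c1 i v1 *: (e1 i, 0 : V2) = (v1, 0).
    rewrite {2}(s1 v1); apply: (big_ind2 (fun x y => x = (y, 0 : V2))) => //.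
      by move=> _ y1 _ y2 -> ->; congr pair; rewrite addr0.
    by move=> i _; congr pair; rewrite scaler0.
  have E2 : \sum_i c2 i v2 *: (0 : V1, e2 i) = (0, v2).
    rewrite {2}(s2 v2); apply: (big_ind2 (fun x y => x = (0 : V1, y))) => //.
      by move=> _ y1 _ y2 -> ->; congr pair; rewrite addr0.
    by move=> i _; congr pair; rewrite scaler0.
  by rewrite E1 E2; congr pair; rewrite ?addr0 ?add0r.
- move=> [i|i] [v1 v2] /=; [apply: le_trans (n1 i v1) _|apply: le_trans (n2 i v2) _];
    by rewrite prod_normE /= le_max lexx ?orbT.
- by move=> [i|i] a [u1 u2] [v1 v2] /=.
Qed.

End Frames.

Section C1Differentiable.
Context {R : realType} {V : normedModType R}.

(** The displacement is made along one vector of the family at a time, and the mean value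
    theorem controls each step. *)
Lemma taylor_path (I : Type) (s : seq I) (e : I -> V) (c d : I -> R)
    (f : V -> R) (x0 : V) (delta eps : R) :
  (forall i x, `|x - x0| < delta ->
     derivable f x (e i) /\ `|'D_(e i) f x - d i| <= eps) ->
  forall y, `|y - x0| + \sum_(i <- s) `|c i| * `|e i| < delta ->
  `|f (y + \sum_(i <- s) c i *: e i) - f y - \sum_(i <- s) c i * d i|
    <= eps * \sum_(i <- s) `|c i|.
Proof.
move=> H; elim: s => [|i s IH] y; first by rewrite !big_nil; move=> _;
    rewrite addr0 subr0 subrr normr0 mulr0.
rewrite !big_cons => Hy.
set S1 := \sum_(j <- s) c j *: e j; set S2 := \sum_(j <- s) c j * d j.
set S3 := \sum_(j <- s) `|c j|.
have S0 : 0 <= \sum_(j <- s) `|c j| * `|e j| by apply: sumr_ge0 => j _; rewrite mulr_ge0.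
have near_y t : `|t| <= `|c i| -> `|y + t *: e i - x0| <= `|y - x0| + `|c i| * `|e i|.
  move=> tc; rewrite addrAC; apply: le_trans (ler_normD _ _) _.
  by rewrite lerD2l normrZ ler_wpM2r.
have near_y' t : `|t| <= `|c i| -> `|y + t *: e i - x0| < delta.
  move=> tc; apply: le_lt_trans (near_y _ tc) _; apply: le_lt_trans Hy.
  by rewrite addrA lerDl.
have [|th Hth E] := @MVT_line R V f y (e i) (c i).
  by move=> t /near_y' /(H i)[].
have B1 : `|f (y + c i *: e i) - f y - c i * d i| <= eps * `|c i|.
  rewrite E -mulrBr normrM mulrC ler_wpM2r //.
  by have [] := H i _ (near_y' _ Hth).
have B2 := IH (y + c i *: e i).
rewrite [y + (_ + _)]addrA.
have -> : f (y + c i *: e i + S1) - f y - (c i * d i + S2) =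
  (f (y + c i *: e i) - f y - c i * d i) + (f (y + c i *: e i + S1) - f (y + c i *: e i) - S2).
  by ring.
rewrite mulrDr; apply: le_trans (ler_normD _ _) _; apply: lerD => //; apply: B2.
apply: le_lt_trans Hy; rewrite addrA lerD2r; exact: near_y.
Qed.

(** Continuity of the partial derivatives makes the remainder of taylor_path small. *)
Lemma C1_differentiable (I : finType) e c (f : V -> R) (x0 : V) :
  @frame R V I e c ->
  (forall i, \near x0, derivable f x0 (e i)) ->
  (forall i, {for x0, continuous ('D_(e i) f)}) -> differentiable f x0.
Proof.
move=> [sp nc lc] Hd Hc.
pose df (v : V) : R := \sum_i c i v * 'D_(e i) f x0.
have dflin : linear df.
  move=> a u v; rewrite /df /GRing.scale /= mulr_sumr -big_split /=.
  by apply: eq_bigr => i _; rewrite lc mulrDl mulrA.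
pose dfM := GRing.isLinear.Build _ _ _ _ _ dflin.
pose dfL : {linear V -> R} := HB.pack df dfM.
have dfc : continuous df.
  rewrite -[df]/(dfL : V -> R); apply: bounded_linear_continuous.
  apply/linear_boundedP; exists (\sum_i `|'D_(e i) f x0|).
  split=> [|M /ltW HM x /=]; first exact: num_real.
  rewrite /df; apply: le_trans (ler_norm_sum _ _ _) _.
  apply: (@le_trans _ _ ((\sum_i `|'D_(e i) f x0|) * `|x|)).
    by rewrite mulr_suml; apply: ler_sum => i _; rewrite normrM mulrC ler_wpM2l.
  exact: ler_wpM2r.
suff E : f \o shift x0 = cst (f x0) + df +o_ 0 id.
  by apply/diff_locallyP; rewrite (@diff_unique _ _ _ f dfL).
apply/eqaddoP => _/posnumP[eps].
pose N : R := #|I|%:R + 1.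
have N0 : 0 < N by rewrite ltr_wpDl.
have e0 : 0 < eps%:num / N by rewrite divr_gt0.
have [d0 d00 Hd0] : exists2 delta : R, 0 < delta & forall i x, `|x - x0| < delta ->
     derivable f x (e i) /\ `|'D_(e i) f x - 'D_(e i) f x0| <= eps%:num / N.
  have : \forall x \near x0, forall i, derivable f x (e i) /\ `|'D_(e i) f x - 'D_(e i) f x0| <=
      eps%:num / N.
    apply: filter_forall => i; apply: filterS2 (Hd i) _; first by move=> x d1 d2; split;
        [exact: d1|exact: d2].
    by have /cvgr_distC_le := Hc i; apply.
  move=> /nbhs_normP[d d0 Hd0]; exists d => // i x xd; apply: Hd0 => /=.
  by rewrite distrC.
pose Ne : R := \sum_i `|e i| + 1.
have Ne0 : 0 < Ne by rewrite ltr_wpDl // sumr_ge0.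
near=> h.
have hd : `|h| * Ne < d0.
  rewrite -ltr_pdivlMr //; near: h; apply/nbhs_norm0P; exists (d0 / Ne) => //=.
  by rewrite divr_gt0.
have := @taylor_path I (index_enum I) e (c^~ h) (fun i => 'D_(e i) f x0) f x0 d0 _ Hd0 x0.
rewrite -sp subrr normr0 add0r /= => H.
rewrite (_ : (f \o shift x0 - (cst (f x0) + df)) h = f (x0 + h) - f x0 - df h); last first.
  by rewrite -addrA -opprD [x0 + h]addrC.
apply: le_trans (H _) _.
  apply: le_lt_trans hd; apply: (@le_trans _ _ (`|h| * \sum_i `|e i|)).
    by rewrite mulr_sumr; apply: ler_sum => i _; rewrite ler_wpM2r.
  by rewrite ler_wpM2l // lerDl.
rewrite -mulrA ler_wpM2l // ler_pdivrMl // mulrC.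
apply: (@le_trans _ _ (\sum_(i : I) `|h|)); first by apply: ler_sum => i _.
by rewrite sumr_const -mulr_natr ler_wpM2l // lerDl.
Unshelve. all: by end_near. Qed.

End C1Differentiable.

Section Smooth.
Context {R : realType} {V : normedModType R}.

Lemma smooth_differentiable (I : finType) e c (U : set V) (f : V -> R) (x : V) :
  @frame R V I e c -> open U -> smooth_on U f -> U x -> differentiable f x.
Proof.
move=> fr oU Hf Ux; apply: (C1_differentiable fr) => i.
  by apply: filterS (open_nbhs_nbhs (conj oU Ux)) => y; exact: smooth_derivable.
exact: smooth_cont (smooth_derive Hf (e i)) _ Ux.
Qed.

Lemma derive_comb (f : V -> R) (x u v : V) (a : R) : differentiable f x ->
  'D_(a *: u + v) f x = a * 'D_u f x + 'D_v f x.
Proof. by move=> df; rewrite !deriveE // linearP. Qed.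

Lemma deriveZ_dir (f : V -> R) (x u : V) (a : R) : differentiable f x ->
  'D_(a *: u) f x = a * 'D_u f x.
Proof. by move=> df; rewrite !deriveE // linearZ. Qed.

Lemma is_derive_curve (f : V -> R) (g : R -> V) (t : R) (v : V) :
  differentiable f (g t) -> is_derive t 1 g v ->
  is_derive t 1 (f \o g) ('D_v f (g t)).
Proof.
move=> df Hg; have dg : differentiable g t by apply/derivable1_diffP; case: Hg.
have dfg : differentiable (f \o g) t by exact: differentiable_comp.
split; first exact: diff_derivable.
by have [_ <-] := Hg; rewrite !deriveE // diff_comp.
Qed.

Lemma dist_le2 (a b p q eps : R) : p = q -> `|p - b| <= eps -> `|q - a| <= eps ->
  `|a - b| <= eps + eps.
Proof.
move=> -> B1 B2; rewrite -(subrKA q) (le_trans (ler_normD _ _)) // lerD //.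
by rewrite distrC.
Qed.

(** Both mixed derivatives are limits of the same second difference, divided by
    the square of the step. *)
Lemma derive_comm (U : set V) (f : V -> R) (x u v : V) :
  open U -> smooth_on U f -> U x -> 'D_u ('D_v f) x = 'D_v ('D_u f) x.
Proof.
move=> oU Hf Ux.
suff key (eps : R) : 0 < eps -> `|'D_u ('D_v f) x - 'D_v ('D_u f) x| <= eps + eps.
  apply/eqP; rewrite -subr_eq0 -normr_le0; apply/ler_addgt0Pr => eps e0.
  by rewrite add0r [leRHS]splitr; apply: key; rewrite divr_gt0.
move=> e0.
have c1 := smooth_cont (smooth_derive (smooth_derive Hf v) u) Ux.
have c2 := smooth_cont (smooth_derive (smooth_derive Hf u) v) Ux.
have : \forall y \near x, [/\ U y, `|'D_u ('D_v f) y - 'D_u ('D_v f) x| <= eps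
   & `|'D_v ('D_u f) y - 'D_v ('D_u f) x| <= eps].
  have n0 := open_nbhs_nbhs (conj oU Ux).
  have /cvgr_distC_le/(_ _ e0) n1 := c1; have /cvgr_distC_le/(_ _ e0) n2 := c2.
  by apply: filterS3 n0 n1 n2 => y h0 h1 h2; exact: And3 h0 h1 h2.
move=> /nbhs_normP[d d0 Hd].
pose N := `|u| + `|v| + 1.
have N0 : 0 < N by rewrite ltr_wpDl // addr_ge0.
pose s := d / N / 2.
have s0 : 0 < s by rewrite !divr_gt0.
have near_x (a b : R) : `|a| <= `|s| -> `|b| <= `|s| -> ball_ Num.norm x d (x + a *: u + b *: v).
  move=> Ha Hb /=; rewrite distrC -(addrA x) (addrC x) addrK.
  apply: le_lt_trans (ler_normD _ _) _; rewrite !normrZ.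
  apply: (@le_lt_trans _ _ (s * (`|u| + `|v|))).
    by rewrite (gtr0_norm s0) in Ha Hb; rewrite mulrDr lerD // ler_wpM2r.
  apply: (@lt_le_trans _ _ (s * N)); first by rewrite ltr_pM2l // ltrDl.
  rewrite /s mulrAC divfK ?gt_eqF // ler_pdivrMr // ler_pMr //; lra.
have swap (a b : R) : x + a *: u + b *: v = x + b *: v + a *: u by rewrite addrAC.
have half (u' v' : V) : (forall a b : R, `|a| <= `|s| -> `|b| <= `|s| -> U (x + a *: u' + b *:
    v')) ->
  exists a b : R, [/\ `|a| <= `|s|, `|b| <= `|s| &
    f (x + s *: u' + s *: v') - f (x + s *: v') - (f (x + s *: u') - f x)
     = s * s * 'D_v' ('D_u' f) (x + a *: u' + b *: v')].
  move=> HU; pose g y := f (y + s *: v') - f y.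
  have dg y : U y -> U (y + s *: v') -> is_derive y u' g ('D_u' f (y + s *: v') - 'D_u' f y).
    move=> Uy Uy'; apply: is_deriveB; last exact: derivableP (smooth_derivable (v:=u') Hf Uy).
    apply: (@is_derive_affine _ _ _ _ f (fun y => y + s *: v') _ _ u') => [h|].
      by rewrite addrA.
    exact: derivableP (smooth_derivable (v:=u') Hf Uy').
  have z0 : `|0 : R| <= `|s| by rewrite normr0.
  have HU0 a : `|a| <= `|s| -> U (x + a *: u').
    by move=> Ha; have := HU a 0 Ha z0; rewrite scale0r addr0.
  have [|a Ha Ea] := @MVT_line R V g x u' s.
    move=> t Ht; have [] := dg (x + t *: u') (HU0 _ Ht) (HU _ _ Ht (lexx _)); done.
  have [_ Eg] := dg (x + a *: u') (HU0 _ Ha) (HU _ _ Ha (lexx _)).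
  have [|b Hb Eb] := @MVT_line R V ('D_u' f) (x + a *: u') v' s.
    by move=> t Ht; exact: (smooth_derivable (v:=v') (smooth_derive Hf u') (HU _ _ Ha Ht)).
  exists a, b; split => //; rewrite -mulrA -Eb -Eg -Ea /g; ring.
have [a1 [b1 [Ha1 Hb1 E1]]] : exists a b : R, [/\ `|a| <= `|s|, `|b| <= `|s| &
    f (x + s *: u + s *: v) - f (x + s *: v) - (f (x + s *: u) - f x)
     = s * s * 'D_v ('D_u f) (x + a *: u + b *: v)].
  by apply: half => a b Ha Hb; have [] := Hd _ (near_x _ _ Ha Hb).
have [b2 [a2 [Hb2 Ha2 E2]]] : exists b a : R, [/\ `|b| <= `|s|, `|a| <= `|s| &
    f (x + s *: v + s *: u) - f (x + s *: u) - (f (x + s *: v) - f x)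
     = s * s * 'D_u ('D_v f) (x + b *: v + a *: u)].
  by apply: half => a b Ha Hb; rewrite -swap; have [] := Hd _ (near_x _ _ Hb Ha).
have E : 'D_v ('D_u f) (x + a1 *: u + b1 *: v) = 'D_u ('D_v f) (x + a2 *: u + b2 *: v).
  apply: (@mulfI _ (s * s)); first by rewrite mulf_neq0 // gt_eqF.
  by rewrite (swap a2 b2) -E1 -E2 (swap s s); ring.
have [_ _ B1] := Hd _ (near_x _ _ Ha1 Hb1).
have [_ B2 _] := Hd _ (near_x _ _ Ha2 Hb2).
exact: dist_le2 E B1 B2.
Qed.

End Smooth.

(** * Primitives and ordinary differential equations *)

Section EpsDelta.
Context {R : realType} {V W : normedModType R}.

Lemma cont_epsdelta (f : V -> W) (x : V) :
  {for x, continuous f} <-> forall e : R, 0 < e -> exists2 d : R, 0 < d &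
    forall y, `|y - x| < d -> `|f y - f x| <= e.
Proof.
split=> [cf e e0|H].
  have /(_ _ _ e0)/nbhs_normP[d d0 Hd] := (@cvgrPdist_le _ _ _ (nbhs x) _ f (f x)).1 cf.
  by exists d => // y xy; rewrite distrC; apply: Hd => /=; rewrite distrC.
apply/(@cvgrPdist_le _ _ _ (nbhs x)) => e e0; have [d d0 Hd] := H e e0.
by apply/nbhs_normP; exists d => // y /= xy; rewrite distrC; apply: Hd; rewrite distrC.
Qed.

Lemma open_normball (x : V) (d : R) : open [set y | `|y - x| < d].
Proof.
rewrite (_ : [set y | _] = ball x d); first exact: ball_open.
by apply/seteqP; split => t; rewrite -ball_normE /= distrC.
Qed.

Lemma open_ballP (U : set V) : open U <-> forall x, U x ->
  exists2 d : R, 0 < d & forall y, `|y - x| < d -> U y.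
Proof.
split=> [oU x Ux|H].
  have /nbhs_normP[d d0 Hd] := open_nbhs_nbhs (conj oU Ux).
  by exists d => // y xy; apply: Hd; rewrite /= distrC.
rewrite openE => x Ux; have [d d0 Hd] := H x Ux.
by apply/nbhs_normP; exists d => // y /= xy; apply: Hd; rewrite distrC.
Qed.

Lemma cont_ball (I : finType) (U : set V) (f : I -> V -> W) (x : V) (e : R) :
  open U -> U x -> (forall i, {for x, continuous (f i)}) -> 0 < e ->
  exists2 d : R, 0 < d & forall y, `|y - x| < d -> U y /\ forall i, `|f i y - f i x| <= e.
Proof.
move=> oU Ux cf e0.
have : \forall y \near x, U y /\ forall i, `|f i y - f i x| <= e.
  have n0 := open_nbhs_nbhs (conj oU Ux).
  have n1 : \forall y \near x, forall i, `|f i y - f i x| <= e.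
    apply: filter_forall => i.
    have /(_ _ e0) [dl dl0 Hdl] := (cont_epsdelta _ _).1 (cf i).
    by apply/nbhs_normP; exists dl => // y /= yd; apply: Hdl; rewrite distrC.
  by apply: filterS2 n0 n1 => y h1 h2; exact: conj h1 h2.
move=> /nbhs_normP[dl dl0 Hdl]; exists dl => // y yd; apply: Hdl => /=.
by rewrite distrC.
Qed.

End EpsDelta.

Section Primitive.
Context {R : realType}.

Lemma primitive (f : R -> R) (a b : R) : a < b ->
  (forall t, a <= t <= b -> {for t, continuous f}) ->
  exists G : R -> R, forall t : R, a < t < b -> is_derive t 1 G (f t).
Proof.
move=> ab cf; pose mu := @lebesgue_measure R.
have fi : mu.-integrable `[a, b] (EFin \o f).
  apply: continuous_compact_integrable; first exact: segment_compact.
  apply: continuous_in_subspaceT => t; rewrite inE /= in_itv /= => tab.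
  exact: cf.
exists (fun x => \int[mu]_(t in `[a, x]) f t)%R => t /andP[at_ tb].
have [|d1 d2] := @continuous_FTC1_closed R f a t b tb fi at_.
  by apply: cf; rewrite !ltW.
by split => //; rewrite -derive1E.
Qed.

Lemma primitive_rV n (f : R -> 'rV[R]_n) (T : R) : 0 < T ->
  continuous f ->
  exists G : R -> 'rV[R]_n, G 0 = 0 /\
    forall t : R, `|t| < T -> is_derive t 1 G (f t).
Proof.
move=> T0 cf.
have H (j : 'I_n) : exists G : R -> R, forall t : R, - T < t < T -> is_derive t 1 G (f t 0 j).
  apply: (@primitive (fun t => f t 0 j) (- T) T); first by rewrite gtrN.
  move=> t _; apply: (@continuous_comp _ _ _ f (fun v : 'rV[R]_n => v 0 j)); first exact: cf.
  exact: coord_continuous.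
have [G HG] := choice H.
exists (fun t => \row_j (G j t - G j 0)); split.
  by apply/rowP => j; rewrite !mxE subrr.
move=> t; rewrite ltr_norml => tT.
have D i j : is_derive t 1 (fun t => (\row_j (G j t - G j 0)) i j) (f t 0 j).
  rewrite (_ : (fun t => _) = G j - cst (G j 0)); last by apply/funext => u; rewrite mxE.
  by apply: is_derive_eq (is_deriveB (HG j t tT) (is_derive_cst _ _ _)) _; rewrite subr0.
have dG : derivable (fun t => \row_j (G j t - G j 0)) t 1.
  by apply/derivable_mxP => i j; case: (D i j).
split => //; rewrite derive_mx //; apply/rowP => j; rewrite mxE.
by case: (D 0 j).
Qed.

Lemma is_derive_coord n (G : R -> 'rV[R]_n) (t : R) v j :
  is_derive t 1 G v -> is_derive t 1 (fun s => G s 0 j) (v 0 j).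
Proof.
move=> [d <-]; split; first exact: (derivable_mxP G t 1).1 d 0 j.
by rewrite derive_mx // mxE.
Qed.

Lemma rV_norm_le n (v : 'rV[R]_n) (M : R) : 0 <= M -> (forall j, `|v 0 j| <= M) -> `|v| <= M.
Proof.
move=> M0 H; rewrite [leLHS]/Num.Def.normr/= mx_normrE (bigmax_le _ M0)//= => -[i j] _ /=.
by rewrite (ord1 i).
Qed.

Lemma rV_coord_le n (v : 'rV[R]_n) j : `|v 0 j| <= `|v|.
Proof. by have [_ H _] := @frame_rV R n; exact: H. Qed.

Lemma MVT_bound n (G dG : R -> 'rV[R]_n) (t M : R) : 0 <= M ->
  (forall s : R, `|s| <= `|t| -> is_derive s 1 G (dG s)) ->
  (forall s : R, `|s| <= `|t| -> `|dG s| <= M) -> `|G t - G 0| <= M * `|t|.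
Proof.
move=> M0 D B; apply: rV_norm_le; first by rewrite mulr_ge0.
move=> j; rewrite !mxE.
have [|th Hth ->] := @MVT_sym R (fun s => G s 0 j) (fun s => dG s 0 j) t.
  by move=> s /D; exact: is_derive_coord.
by rewrite normrM ler_wpM2r // (le_trans (rV_coord_le _ _)) // B.
Qed.

End Primitive.

Section Clamp.
Context {R : realType}.

Definition clamp (T t : R) : R := Num.max (- T) (Num.min T t).

Lemma clamp_le (T t : R) : 0 <= T -> `|clamp T t| <= T.
Proof.
move=> T0; rewrite ler_norml /clamp le_max lexx ge_max ge_min lexx /= andbT.
lra.
Qed.

Lemma clamp_id (T t : R) : `|t| <= T -> clamp T t = t.
Proof.
by rewrite ler_norml /clamp => /andP[tT Tt]; rewrite (min_idPr Tt) (max_idPr tT).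
Qed.

Lemma clamp_continuous (T : R) : continuous (clamp T).
Proof.
move=> t; apply: (@continuous_max _ _ (fun=> - T) (fun t => Num.min T t)).
  exact: cst_continuous.
apply: (@continuous_min _ _ (fun=> T) id); first exact: cst_continuous.
by move=> ?.
Qed.

Lemma clamp_lip (T s t : R) : `|clamp T s - clamp T t| <= `|s - t|.
Proof.
rewrite /clamp.
have A : s - t <= `|s - t| := ler_norm _.
have B : t - s <= `|s - t| by rewrite distrC ler_norm.
rewrite ler_norml; case: (leP T s) => h1; case: (leP T t) => h2.
- by case: (leP (- T) T) => h3; apply/andP; split; lra.
- by case: (leP (- T) T) => h3; case: (leP (- T) t) => h4; apply/andP; split; lra.
- by case: (leP (- T) s) => h3; case: (leP (- T) T) => h4; apply/andP; split; lra.
- by case: (leP (- T) s) => h3; case: (leP (- T) t) => h4; apply/andP; split; lra.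
Qed.

End Clamp.

Section Picard.
Context {R : realType} {n : nat}.
Local Notation E := 'rV[R]_n.

Lemma cauchy_geometric (u : nat -> R) (C : R) :
  (forall k, `|u k.+1 - u k| <= C * 2^-1 ^+ k) ->
  exists l, forall k, `|l - u k| <= 2 * C * 2^-1 ^+ k.
Proof.
move=> H.
have tail m k : `|u (k + m)%N - u k| <= 2 * C * 2^-1 ^+ k - 2 * C * 2^-1 ^+ (k + m).
  elim: m => [|m IH]; first by rewrite addn0 !subrr normr0.
  rewrite addnS -(subrKA (u (k + m)%N)); apply: le_trans (ler_normD _ _) _.
  apply: le_trans (lerD (H _) IH) _.
  by rewrite exprS; lra.
have C0 : 0 <= C by have := le_trans (normr_ge0 _) (H 0%N); rewrite expr0 mulr1.
have tail' m k : (k <= m)%N -> `|u m - u k| <= 2 * C * 2^-1 ^+ k.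
  move=> km; rewrite -(subnKC km); apply: le_trans (tail _ _) _.
  by rewrite gerBl !mulr_ge0 // exprn_ge0.
have cu : cvgn u.
  apply/cauchy_cvgP/cauchy_exP => e e0.
  have : 2 * C * 2^-1 ^+ k @[k --> \oo] --> (0 : R).
    rewrite -[X in _ --> X](mulr0 (2 * C)); apply: cvgMr.
    by apply: cvg_expr; rewrite gtr0_norm // invf_lt1 // ltr1n.
  move=> /cvgr0_norm_lt /(_ _ e0) [k _ Hk].
  exists (u k); exists k => // m /= km.
  rewrite /ball /= distrC; apply: le_lt_trans (tail' _ _ km) _.
  by apply: le_lt_trans (ler_norm _) _; apply: Hk => /=.
exists (limn u) => k.
have : `|limn u - u k| <= 2 * C * 2^-1 ^+ k.
  have cn : `|u m - u k| @[m --> \oo] --> `|limn u - u k|.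
    by apply: cvg_norm; apply: cvgB; [exact: cu|exact: cvg_cst].
  rewrite -(cvg_lim _ cn) //; apply: limr_le; first by apply/cvg_ex; eexists; exact: cn.
  by exists k => // m /=; exact: tail'.
by [].
Qed.

Lemma cauchy_geometric_rV (u : nat -> E) (C : R) :
  (forall k, `|u k.+1 - u k| <= C * 2^-1 ^+ k) ->
  exists l, forall k, `|l - u k| <= 2 * C * 2^-1 ^+ k.
Proof.
move=> H; have H' j : exists l : R, forall k, `|l - u k 0 j| <= 2 * C * 2^-1 ^+ k.
  apply: cauchy_geometric => k; apply: le_trans (H k).
  by apply: le_trans (rV_coord_le _ j); rewrite !mxE.
have [l Hl] := choice H'; exists (\row_j l j) => k.
have C0 : 0 <= C by have := le_trans (normr_ge0 _) (H 0%N); rewrite expr0 mulr1.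
apply: rV_norm_le; first by rewrite !mulr_ge0 // exprn_ge0.
by move=> j; rewrite !mxE.
Qed.

(** For a globally Lipschitz bounded field the Picard iteration contracts by
    one half on any interval of half-width T with K * T <= 1/2, whatever the
    initial point.  Reparametrizing time by the clamp keeps every iterate
    continuous on the whole line. *)
Lemma picard_global (X : E -> E) (K B T : R) : 0 < T -> 0 <= K -> K * T <= 2^-1 ->
  (forall z z', `|X z - X z'| <= K * `|z - z'|) -> (forall z, `|X z| <= B) ->
  forall z0, exists g : R -> E, [/\ g 0 = z0,
    forall t : R, `|t| < T -> is_derive t 1 g (X (g t)) &
    forall t, `|t| < T -> `|g t - z0| <= B * T].
Proof.
move=> T0 K0 KT lipX bX z0.
have B0 : 0 <= B := le_trans (normr_ge0 _) (bX 0).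
have cX : continuous X.
  move=> z; apply/cont_epsdelta => e e0; exists (e / (K + 1)).
    by rewrite divr_gt0 // ltr_wpDl.
  move=> z'; rewrite ltr_pdivlMr ?ltr_wpDl // => h; apply: le_trans (lipX _ _) _.
  by apply: le_trans _ (ltW h); rewrite mulrC ler_wpM2l // lerDl.
have S (g : R -> E) : exists G : R -> E, continuous g ->
    G 0 = z0 /\ forall t : R, `|t| < 2 * T -> is_derive t 1 G (X (g t)).
  have [cg|ncg] := pselect (continuous g); last by exists g.
  have [||G [G0 HG]] := @primitive_rV R n (X \o g) (2 * T).
  - by rewrite mulr_gt0.
  - by move=> t; apply: continuous_comp; [exact: cg|exact: cX].
  exists (cst z0 + G) => _; split; first by rewrite /= -[RHS]addr0 -G0.
  move=> t /HG D; rewrite -[X (g t)]add0r; exact: is_deriveD.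
have {S} [S HS] := choice S.
pose step (g : R -> E) := S g \o clamp T.
have T2 (t : R) : `|t| <= T -> `|t| < 2 * T.
  by move=> h; apply: le_lt_trans h _; rewrite mulrDl mul1r ltrDl.
have cstep g : continuous g -> continuous (step g).
  move=> cg t; apply: continuous_comp; first exact: clamp_continuous.
  have [_ H] := HS _ cg; apply/differentiable_continuous/derivable1_diffP.
  by case: (H (clamp T t)) => //; apply/T2/clamp_le/ltW.
have contr g g' M : continuous g -> continuous g' -> 0 <= M -> (forall t, `|g t - g' t| <= M) ->
    forall t, `|step g t - step g' t| <= 2^-1 * M.
  move=> cg cg' M0 gg' t; have [s0 Hs] := HS _ cg; have [s0' Hs'] := HS _ cg'.
  have ct := clamp_le t (ltW T0).
  have := @MVT_bound R n (S g - S g') (fun s => X (g s) - X (g' s)) (clamp T t) (K * M).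
  have E0 : (S g - S g') 0 = 0 by rewrite -[LHS]/(S g 0 - S g' 0) s0 s0' subrr.
  rewrite E0 subr0 => H; apply: le_trans (H _ _ _) _.
  - by rewrite mulr_ge0.
  - by move=> s sc; apply: is_deriveB; [apply: Hs|apply: Hs']; apply: T2; exact: le_trans ct.
  - by move=> s sc; apply: le_trans (lipX _ _) _; rewrite ler_wpM2l.
  - rewrite mulrAC ler_wpM2r //; apply: le_trans KT; rewrite ler_wpM2l //.
have bound g : continuous g -> forall t, `|step g t - z0| <= B * T.
  move=> cg t; have [s0 Hs] := HS _ cg.
  have ct := clamp_le t (ltW T0).
  rewrite -s0 /step /=; apply: le_trans (@MVT_bound R n (S g) (X \o g) _ B _ _ _) _ => //.
  - by move=> s sc; apply: Hs; apply: T2; exact: le_trans ct.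
  - by move=> s _; exact: bX.
  - by rewrite ler_wpM2l.
pose u k := iter k step (cst z0).
have cu k : continuous (u k).
  by elim: k => [|k IH]; [move=> t; exact: cst_continuous|exact: cstep].
have BT0 : 0 <= B * T by rewrite mulr_ge0 // ltW.
have hp k : 0 <= B * T * 2^-1 ^+ k by rewrite mulr_ge0 // exprn_ge0.
have du k t : `|u k.+1 t - u k t| <= B * T * 2^-1 ^+ k.
  elim: k t => [|k IH] t; first by rewrite expr0 mulr1; exact: (bound _ (cu 0%N) t).
  apply: le_trans (contr (u k.+1) (u k) _ (cu _) (cu _) (hp k) IH t) _.
  by rewrite exprS; lra.
have [g Hg] : exists g : R -> E, forall t k, `|g t - u k t| <= 2 * (B * T) * 2^-1 ^+ k.
  have Hl t : exists l : E, forall k, `|l - u k t| <= 2 * (B * T) * 2^-1 ^+ k.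
    exact: (@cauchy_geometric_rV (fun k => u k t)).
  by have [g Hg] := choice Hl; exists g.
have small (x C : R) : (forall k, x <= C * 2^-1 ^+ k) -> x <= 0.
  move=> H; have c0 : C * 2^-1 ^+ k @[k --> \oo] --> (0 : R).
    rewrite -[X in _ --> X](mulr0 C); apply: cvgMr.
    by apply: cvg_expr; rewrite gtr0_norm // invf_lt1 // ltr1n.
  rewrite -(cvg_lim _ c0) //; apply: limr_ge; first by apply/cvg_ex; eexists; exact: c0.
  by near=> k; exact: H.
have hp2 k : 0 <= 2 * (B * T) * 2^-1 ^+ k by rewrite -mulrA mulr_ge0.
have cg : continuous g.
  move=> t; apply/cont_epsdelta => e e0.
  have c0 : 2 * (B * T) * 2^-1 ^+ k @[k --> \oo] --> (0 : R).
    rewrite -[X in _ --> X](mulr0 (2 * (B * T))); apply: cvgMr.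
    by apply: cvg_expr; rewrite gtr0_norm // invf_lt1 // ltr1n.
  have e3 : 0 < e / 3 by rewrite divr_gt0.
  have /cvgr0_norm_le /(_ _ e3) [k _ /(_ k (leqnn k)) Hk] := c0.
  rewrite (ger0_norm (hp2 k)) in Hk.
  have [d d0 Hd] := (cont_epsdelta _ _).1 (cu k t) _ e3.
  exists d => // s /Hd H.
  have A1 := le_trans (Hg t k) Hk; have A2 := le_trans (Hg s k) Hk.
  rewrite distrC in A1.
  have -> : g s - g t = (g s - u k s) + ((u k s - u k t) + (u k t - g t)) by rewrite !subrKA.
  apply: le_trans (ler_normD _ _) _; apply: le_trans (lerD A2 (ler_normD _ _)) _.
  by move: (lerD A2 (lerD H A1)); lra.
have fix_g t : step g t = g t.
  apply/eqP; rewrite -subr_eq0 -normr_le0; apply: (small _ (2 * (B * T))) => k.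
  rewrite -(subrKA (u k.+1 t)); apply: le_trans (ler_normD _ _) _.
  have A := contr _ _ _ cg (cu k) (hp2 k) (Hg^~ k) t.
  have A2 := Hg t k.+1; rewrite distrC exprS in A2.
  by apply: le_trans (lerD A A2) _; lra.
have [s0 Hs] := HS _ cg.
exists g; split.
- by rewrite -fix_g /step /= clamp_id ?normr0 ?ltW.
- move=> t tT; have := Hs t (T2 _ (ltW tT)).
  apply: near_eq_is_derive; apply/nbhs_normP; exists (T - `|t|); first by rewrite /= subr_gt0.
  move=> s /= ts; rewrite -fix_g /step /= clamp_id //.
  rewrite -[s](subrK t) (le_trans (ler_normD _ _)) // -lerBrDr distrC ltW //.
- by move=> t tT; rewrite -fix_g; exact: bound.
Unshelve. all: by end_near. Qed.

End Picard.

(** * Local flows, inverse functions and level sets *)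

Section LocalFlow.
Context {R : realType} {n : nat}.
Local Notation E := 'rV[R]_n.

Lemma local_lipschitz (U : set E) (f : E -> R) (x0 : E) :
  open U -> U x0 -> smooth_on U f ->
  exists r K : R, [/\ 0 < r, 0 <= K,
    forall z, `|z - x0| <= r -> U z &
    forall z z', `|z - x0| <= r -> `|z' - x0| <= r -> `|f z - f z'| <= K * `|z - z'|].
Proof.
move=> oU Ux0 Hf.
pose e i : E := delta_mx 0 i.
pose d i := 'D_(e i) f x0.
have [sp nc lc] := @frame_rV R n.
have [d0 d00 Hd0] : exists2 delta : R, 0 < delta & forall x, `|x - x0| < delta ->
    U x /\ forall i, `|'D_(e i) f x - d i| <= 1.
  apply: (@cont_ball R E R 'I_n U (fun i => 'D_(e i) f)) => // i.
  by have H := smooth_cont (smooth_derive Hf (e i)) Ux0; exact: H.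
pose M := \sum_i `|e i|.
have M0 : 0 <= M by apply: sumr_ge0.
pose r := d0 / (1 + 2 * M) / 2.
have N0 : 0 < 1 + 2 * M by rewrite ltr_wpDr // mulr_ge0.
have r0 : 0 < r by rewrite !divr_gt0.
have rM : r * (1 + 2 * M) < d0.
  by rewrite /r mulrAC divfK ?gt_eqF //; lra.
have rd : r < d0.
  by apply: le_lt_trans rM; rewrite ler_peMr ?(ltW r0) // lerDl mulr_ge0.
exists r, (\sum_i (1 + `|d i|)); split => //.
- by apply: sumr_ge0 => i _; rewrite addr_ge0.
- by move=> z zr; have [] := Hd0 z (le_lt_trans zr rd).
move=> z' z z'r zr.
have H := @taylor_path R E 'I_n (index_enum 'I_n) e (fun i => (z' - z) 0 i) d f x0 d0 1 _ z.
have E1 : z + \sum_(i <- index_enum 'I_n) (z' - z) 0 i *: e i = z'.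
  by rewrite -(sp (z' - z)) subrKC.
rewrite E1 in H.
have zz : `|z' - z| <= 2 * r.
  rewrite -(subrKA x0) (le_trans (ler_normD _ _)) // (distrC x0).
  by apply: le_trans (lerD z'r zr) _; rewrite mulrDl mul1r.
have {}H : `|f z' - f z - \sum_i (z' - z) 0 i * d i| <= 1 * \sum_i `|(z' - z) 0 i|.
  apply: H => [i x xd|].
    have [h1 h2] := Hd0 _ xd; split; last exact: h2.
    exact: (smooth_derivable (v := e i) Hf h1).
  apply: le_lt_trans rM; rewrite mulrDr mulr1 lerD // mulrA (mulrC r) mulr_sumr.
  by apply: ler_sum => i _; rewrite ler_wpM2r // (le_trans (nc i _)).
rewrite -(subrK (\sum_i (z' - z) 0 i * d i) (f z' - f z)).
apply: le_trans (ler_normD _ _) _; apply: le_trans (lerD H (ler_norm_sum _ _ _)) _.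
rewrite mul1r -big_split mulr_suml /=; apply: ler_sum => i _.
by rewrite normrM mulrDl mul1r; apply: lerD; [exact: nc|rewrite mulrC ler_wpM2l].
Qed.

(** Composing the field with the retraction onto a box around x0 makes it globally Lipschitz.
    Since the field is bounded on the box, solutions starting near x0 do not leave the box
    before a time that is the same for all of them. *)
Lemma flow_exists (U : set E) (X : E -> E) (x0 : E) (eps : R) :
  open U -> U x0 -> 0 < eps -> (forall j, smooth_on U (fun z => X z 0 j)) ->
  exists r T : R, [/\ 0 < r, 0 < T &
    forall z0, `|z0 - x0| <= r -> exists g : R -> E, g 0 = z0 /\
      forall t : R, `|t| < T ->
        [/\ U (g t), `|g t - x0| <= eps & is_derive t 1 g (X (g t))]].
Proof.
move=> oU Ux0 eps0 sX.
have H0 j : exists rK : R * R, [/\ 0 < rK.1, 0 <= rK.2,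
    forall z, `|z - x0| <= rK.1 -> U z &
    forall z z', `|z - x0| <= rK.1 -> `|z' - x0| <= rK.1 ->
      `|X z 0 j - X z' 0 j| <= rK.2 * `|z - z'|].
  by have [r [K H]] := local_lipschitz oU Ux0 (sX j); exists (r, K).
have {H0} [rK HrK] := choice H0.
have [rho [rho0 rhoe Urho lipj]] : exists rho : R, [/\ 0 < rho, rho <= eps,
    forall z, `|z - x0| <= rho -> U z & forall j z z', `|z - x0| <= rho -> `|z' - x0| <= rho ->
      `|X z 0 j - X z' 0 j| <= (rK j).2 * `|z - z'|].
  have [r1 r10 Ur1] : exists2 r1 : R, 0 < r1 & forall z, `|z - x0| <= r1 -> U z.
    have /nbhs_normP[r1 r10 Hr1] := open_nbhs_nbhs (conj oU Ux0).
    exists (r1 / 2); first by rewrite divr_gt0.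
    move=> z zr; apply: Hr1 => /=; rewrite distrC (le_lt_trans zr) //.
    by rewrite ltr_pdivrMr // ltr_pMr // ltr1n.
  pose rho := \big[Num.min/Num.min eps r1]_j (rK j).1.
  have rho_j j : rho <= (rK j).1 by exact: bigmin_le.
  have rho_e : rho <= Num.min eps r1 by exact: bigmin_le_id.
  exists rho; split.
  - rewrite /rho; apply: lt_bigmin; first by rewrite lt_min eps0.
    by move=> j _; have [] := HrK j.
  - by apply: le_trans rho_e _; rewrite ge_min lexx.
  - by move=> z zr; apply: Ur1; apply: le_trans zr (le_trans rho_e _); rewrite ge_min lexx orbT.
  - move=> j z z' zr zr'; have [_ _ _ H] := HrK j.
    by apply: H; [apply: le_trans zr _|apply: le_trans zr' _]; exact: rho_j.
pose K := \sum_j (rK j).2.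
have Kj j : 0 <= (rK j).2 by have [] := HrK j.
have K0 : 0 <= K by apply: sumr_ge0.
have lip z z' : `|z - x0| <= rho -> `|z' - x0| <= rho -> `|X z - X z'| <= K * `|z - z'|.
  move=> zr zr'; apply: rV_norm_le; first by rewrite mulr_ge0.
  move=> j; rewrite !mxE; apply: le_trans (lipj j _ _ zr zr') _.
  by rewrite ler_wpM2r // /K (bigD1 j) //= lerDl sumr_ge0.
pose P (z : E) : E := x0 + \row_j clamp rho ((z - x0) 0 j).
have Prho z : `|P z - x0| <= rho.
  rewrite /P addrAC subrr add0r; apply: rV_norm_le; first exact: ltW.
  by move=> j; rewrite mxE clamp_le // ltW.
have Pid z : `|z - x0| <= rho -> P z = z.
  move=> zr; rewrite /P -[RHS](subrKC x0); congr (_ + _); apply/rowP => j.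
  by rewrite mxE clamp_id // (le_trans (rV_coord_le _ _)).
have Plip z z' : `|P z - P z'| <= `|z - z'|.
  rewrite /P opprD addrACA subrr add0r; apply: rV_norm_le => // j.
  rewrite mxE [X in _ + X]mxE ![(\row__ _) _ _]mxE; apply: le_trans (clamp_lip _ _ _) _.
  have -> : (z - x0) 0 j - (z' - x0) 0 j = (z - z') 0 j by rewrite !mxE; ring.
  exact: rV_coord_le.
pose B := `|X x0| + K * rho.
have B0 : 0 <= B by rewrite addr_ge0 // mulr_ge0 // ltW.
pose T := Num.min (2^-1 / (K + 1)) (rho / 2 / (B + 1)).
have T0 : 0 < T by rewrite lt_min !divr_gt0 // ltr_wpDl.
have KT : K * T <= 2^-1.
  have h : T <= 2^-1 / (K + 1) by rewrite ge_min lexx.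
  apply: le_trans (ler_wpM2l K0 h) _; rewrite mulrA ler_pdivrMr ?ltr_wpDl //.
  by rewrite mulrC ler_wpM2l // lerDl.
have BT : B * T <= rho / 2.
  have h : T <= rho / 2 / (B + 1) by rewrite ge_min lexx orbT.
  apply: le_trans (ler_wpM2l B0 h) _; rewrite mulrA ler_pdivrMr ?ltr_wpDl //.
  by rewrite mulrC ler_wpM2l ?lerDl // divr_ge0 // ltW.
exists (rho / 2), T; split => //; first by rewrite divr_gt0.
move=> z0 z0r.
have [|z|g [g0 Dg Bg]] := @picard_global R n (X \o P) K B T T0 K0 KT _ _ z0.
- by move=> z z' /=; apply: le_trans (lip _ _ (Prho _) (Prho _)) _; rewrite ler_wpM2l.
- rewrite /= -[X (P z)](subrKC (X x0)); apply: le_trans (ler_normD _ _) _.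
  rewrite lerD2l; apply: le_trans (lip _ _ (Prho _) _) _; first by rewrite subrr normr0 ltW.
  by rewrite ler_wpM2l.
exists g; split => // t tT.
have gr : `|g t - x0| <= rho.
  rewrite -(subrKA z0); apply: le_trans (ler_normD _ _) _.
  by rewrite [leRHS]splitr; apply: lerD => //; apply: le_trans (Bg t tT) BT.
split; [exact: Urho|exact: le_trans rhoe|].
by have := Dg t tT; rewrite /= Pid.
Qed.

End LocalFlow.

Section Inverse.
Context {R : realType}.

(** The inverse g is smooth because g' = 1 / (f' o g) is as regular as g, so that each class
    C^k bootstraps to the next. *)
Lemma inverse_function (f : R -> R) (I : set R) (a : R) :
  open I -> I a -> smooth_on I f -> 'D_1 f a != 0 ->
  exists (d : R) (g : R -> R) (J : set R),
    [/\ 0 < d, open_interval J, smooth_on J g,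
      forall t, `|t - a| < d -> [/\ I t, J (f t) & g (f t) = t] &
      forall y, J y -> `|g y - a| < d /\ f (g y) = y].
Proof.
move=> oI Ia Hf fa.
have Hf' := smooth_derive Hf 1.
have [d d0 Hd] : exists2 d : R, 0 < d & forall t, `|t - a| < d -> I t /\ 'D_1 f t != 0.
  have fa2 : 0 < `|'D_1 f a| / 2 by rewrite divr_gt0 // normr_gt0.
  have [d1 d10 H1] := (cont_epsdelta _ _).1 (smooth_cont Hf' Ia) _ fa2.
  have /nbhs_normP[d2 d20 H2] := open_nbhs_nbhs (conj oI Ia).
  exists (Num.min d1 d2); first by rewrite lt_min d10.
  move=> t; rewrite lt_min => /andP[t1 t2]; split.
    by apply: H2; rewrite /= distrC.
  apply/eqP => h; have := H1 _ t1; rewrite h sub0r normrN; move: fa2; lra.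
pose D := [set t : R | `|t - a| < d].
have oD : open D by exact: (@open_normball R R a d).
have Dconv t1 t2 t : D t1 -> D t2 -> t1 <= t <= t2 -> D t.
  by rewrite /D /= !ltr_norml => /andP[? ?] /andP[? ?] /andP[? ?]; apply/andP; split; lra.
have Dder (t : R) : D t -> is_derive t 1 f ('D_1 f t).
  by move=> /Hd [It _]; exact: derivableP (smooth_derivable (v := 1) Hf It).
have Dcont t : D t -> {for t, continuous f}.
  by move=> /Hd [It _]; exact (smooth_cont Hf It).
have cseg t1 t2 : D t1 -> D t2 -> {within `[t1, t2], continuous f}.
  move=> D1 D2; apply: continuous_in_subspaceT => t; rewrite inE /= in_itv /= => tt.
  by apply: Dcont; exact: Dconv D1 D2 tt.
have inj t1 t2 : D t1 -> D t2 -> f t1 = f t2 -> t1 = t2.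
  wlog lt12 : t1 t2 / t1 < t2 => [H D1 D2 E|D1 D2 E].
    by have [h|h|//] := ltgtP t1 t2; [exact: H|symmetry; exact: H].
  have [|t tt] := @MVT R f ('D_1 f) t1 t2 lt12 _ (cseg _ _ D1 D2).
    move=> t; rewrite in_itv /= => /andP[h1 h2]; apply: Dder.
    by apply: Dconv D1 D2 _; rewrite !ltW.
  rewrite E subrr => /esym/eqP; rewrite mulf_eq0 subr_eq0 (gt_eqF lt12) orbF => /eqP h.
  have [|_] := Hd t; last by rewrite h eqxx.
  by move: tt; rewrite in_itv /= => /andP[h1 h2]; apply: Dconv D1 D2 _; rewrite !ltW.
have Hg y : exists t, (exists2 t, D t & f t = y) -> D t /\ f t = y.
  have [[t Dt ft]|N] := pselect (exists2 t, D t & f t = y); first by exists t.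
  by exists a.
have {Hg} [g Hg] := choice Hg.
pose J := f @` D.
have gK t : D t -> g (f t) = t.
  move=> Dt; have [|D1 E1] := Hg (f t); first by exists t.
  exact: inj.
have nearD t : D t -> \forall s \near t, D s by move=> Dt; exact: open_nbhs_nbhs.
have nK t : D t -> {near t, cancel f g} by move=> Dt; apply: filterS (nearD _ Dt) => s /gK.
have nC t : D t -> {near t, continuous f} by move=> Dt; apply: filterS (nearD _ Dt) => s /Dcont.
have dg t : D t -> is_derive (f t) 1 g ('D_1 f t)^-1.
  move=> Dt; apply: is_derive_inverse (nK _ Dt) (nC _ Dt) (Dder _ Dt) _.
  by have [] := Hd t Dt.
have cg t : D t -> {for f t, continuous g}.
  move=> Dt; apply/differentiable_continuous/derivable1_diffP.
  by have [] := dg t Dt.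
have oJ : open J.
  rewrite openE => y [t Dt <-]; rewrite /interior.
  have [_ Hc] := near_can_continuousAcan_sym (nK _ Dt) (nC _ Dt).
  have Hn : \forall y \near f t, D (g y).
    have /cg := Dt; apply; rewrite gK //; exact: nearD.
  by apply: filterS2 Hc Hn => z E Dz; exists (g z).
have iJ : is_interval J.
  have key t1 t2 z : t1 <= t2 -> D t1 -> D t2 ->
      Num.min (f t1) (f t2) <= z <= Num.max (f t1) (f t2) -> J z.
    move=> t12 D1 D2 zz; have [t] := IVT t12 (cseg _ _ D1 D2) zz.
    by rewrite in_itv /= => tt ft; exists t => //; exact: Dconv D1 D2 tt.
  move=> _ _ [t1 D1 <-] [t2 D2 <-] z /andP[z1 z2].
  have zz : Num.min (f t1) (f t2) <= z <= Num.max (f t1) (f t2).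
    by rewrite ge_min z1 le_max z2 orbT.
  have [h|h] := leP t1 t2; first exact: key h D1 D2 zz.
  by apply: (key _ _ _ (ltW h)) => //; rewrite minC maxC.
have sV := smoothV oD (smooth_sub (fun t Dt => (Hd t Dt).1) Hf') (fun t Dt => (Hd t Dt).2).
have gD y : J y -> D (g y) by move=> [t Dt <-]; rewrite gK.
exists d, g, J; split => //.
- elim=> [|k IH]; first by split => // y [t Dt <-]; exact: cg.
  apply: (Ck_primitive oJ _ (Ck_comp1 oJ gD (sV k) IH)) => y [t Dt <-] /=.
  by rewrite gK //; exact: dg.
- by move=> t Dt; split; [have [] := Hd t Dt|exists t|exact: gK].
Qed.

End Inverse.

Section LevelSets.
Context {R : realType}.
Local Notation E := 'rV[R]_2.
Local Notation e := (delta_mx 0 : 'I_2 -> E).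

Lemma two_indices (j : 'I_2) : exists i : 'I_2, i != j /\ forall k, k = i \/ k = j.
Proof.
have H k : k = 0 \/ k = 1 :> 'I_2.
  by case: k => [[|[|//]] hk]; [left|right]; apply/val_inj.
by case: (H j) => ->; [exists 1|exists 0]; split => // k; case: (H k); auto.
Qed.

(** Where s has nonzero differential, a function whose differential is
    proportional to ds is constant along the flow of a field X with ds(X) = 0
    and constant speed 1 in a direction transverse to a fixed line L; every
    point near x0 is carried to L, and on L the function s is invertible. *)
Lemma function_of_level (U : set E) (s mu : E -> R) (x0 : E) (j i : 'I_2) :
  open U -> U x0 -> smooth_on U s -> smooth_on U mu -> i != j ->
  (forall k, k = i \/ k = j) ->
  'D_(e j) s x0 != 0 ->
  (forall x, U x -> 'D_(e i) mu x * 'D_(e j) s x = 'D_(e j) mu x * 'D_(e i) s x) ->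
  exists (d : R) (I : set R) (m : R -> R),
    [/\ 0 < d, open_interval I, smooth_on I m &
     forall x, `|x - x0| < d -> [/\ U x, I (s x) & mu x = m (s x)]].
Proof.
move=> oU Ux0 Hs Hmu ij ijP sj0 wedge.
have fr := @frame_rV R 2.
have sE (x : E) : x = x 0 i *: e i + x 0 j *: e j.
  apply/rowP => k; rewrite !mxE eqxx /=; case: (ijP k) => ->.
    by rewrite eqxx (negPf ij) mulr1 mulr0 addr0.
  by rewrite eqxx eq_sym (negPf ij) mulr1 mulr0 add0r.
have Hsj := smooth_derive Hs (e j); have Hsi := smooth_derive Hs (e i).
have [d1 d10 H1] : exists2 d1 : R, 0 < d1 & forall x, `|x - x0| < d1 -> U x /\ 'D_(e j) s x != 0.
  have h2 : 0 < `|'D_(e j) s x0| / 2 by rewrite divr_gt0 // normr_gt0.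
  have [|d1 d10 Hd1] := @cont_ball R E R unit U (fun=> 'D_(e j) s) x0 _ oU Ux0 _ h2.
    by move=> _; have H := smooth_cont Hsj Ux0; exact: H.
  exists d1 => // x /Hd1 [Ux /(_ tt) H]; split => //.
  by apply/eqP => h; move: H; rewrite h sub0r normrN; move: h2; lra.
pose W := [set x : E | `|x - x0| < d1].
have oW : open W := @open_normball R E x0 d1.
have Wx0 : W x0 by rewrite /W /= subrr normr0.
have WU x : W x -> U x by move=> /H1[].
have Wj x : W x -> 'D_(e j) s x != 0 by move=> /H1[].
pose q x := 'D_(e i) s x / 'D_(e j) s x.
have sq : smooth_on W q.
  by apply: smoothM => //; [exact: smooth_sub Hsi|apply: smoothV => //; exact: smooth_sub Hsj].
pose X x : E := e i - q x *: e j.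
have sX k : smooth_on W (fun x => X x 0 k).
  have H := smoothB oW (smooth_cst W (e i 0 k)) (smoothM oW sq (smooth_cst W (e j 0 k))).
  by apply: smooth_ext H => // x _; rewrite !mxE.
have dif (f : E -> R) x : smooth_on U f -> W x -> differentiable f x.
  by move=> Hf Wx; exact (smooth_differentiable fr oU Hf (WU _ Wx)).
have Xder (f : E -> R) x : smooth_on U f -> W x ->
    'D_(X x) f x = 'D_(e i) f x - q x * 'D_(e j) f x.
  move=> Hf Wx; rewrite /X addrC -scaleNr derive_comb; last exact: dif.
  by rewrite mulNr addrC.
have Xs x : W x -> 'D_(X x) s x = 0.
  by move=> Wx; rewrite Xder // /q divfK ?subrr //; exact: Wj.
have Xmu x : W x -> 'D_(X x) mu x = 0.
  move=> Wx; rewrite Xder // /q; move: (wedge _ (WU _ Wx)) (Wj _ Wx).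
  move: ('D_(e i) mu x) ('D_(e j) mu x) ('D_(e i) s x) ('D_(e j) s x) => a b a' b' ab b'0.
  by apply: (mulIf b'0); rewrite mul0r mulrBl ab; field.
pose L (t : R) : E := x0 + t *: e j.
pose IL := [set t : R | W (L t)].
have cL : continuous L.
  move=> t; apply/cont_epsdelta => eps eps0; exists (eps / (`|e j| + 1)).
    by rewrite divr_gt0 // ltr_wpDl.
  move=> u; rewrite ltr_pdivlMr ?ltr_wpDl // /L opprD addrACA subrr add0r -scalerBl normrZ => h.
  by apply: le_trans (ltW h); rewrite ler_wpM2l // lerDl.
have oIL : open IL by apply: open_comp => // t _; exact: cL.
have aL v : exists w, forall (x h : R), L (h *: v + x) = h *: w + L x.
  exists (v *: e j) => x h; rewrite /L scalerDl scalerA addrCA //.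
have L0 : L 0 = x0 by rewrite /L scale0r addr0.
have sL (f : E -> R) : smooth_on U f -> smooth_on IL (f \o L).
  by move=> Hf; apply: (smooth_affine oIL _ _ aL Hf) => [t|t /WU //]; exact: cL.
have h0 : 'D_1 (s \o L) 0 != 0.
  have aL1 (h : R) : L (h *: 1 + 0) = h *: e j + L 0.
    by rewrite /L scalerDl addrCA [h *: 1]mulr1.
  by rewrite (derive_affine s aL1) L0.
have IL0 : IL 0 by rewrite /IL /= L0.
have [d [g [J [d0 iJ sg gl gr]]]] := inverse_function oIL IL0 (sL _ Hs) h0.
have [|r [T [r0 T0 Hflow]]] := @flow_exists R 2 W X x0 (d / 2) oW Wx0 _ sX.
  by rewrite divr_gt0.
exists (Num.min r T), J, ((mu \o L) \o g); split => //.
- by rewrite lt_min r0.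
- have [_ oJ] := iJ; apply: (smooth_comp1 oJ _ (sL _ Hmu) sg) => y /gr[yd _].
  by have [] := gl _ yd.
move=> x; rewrite lt_min => /andP[xr xT].
have [c [c0 Hc]] := Hflow x (ltW xr).
have Tz : `|0 : R| < T by rewrite normr0.
have Wx : W x by rewrite -c0; have [] := Hc _ Tz.
pose t := (x0 - x) 0 i.
have tT : `|t| < T.
  by apply: le_lt_trans xT; rewrite distrC; exact: rV_coord_le.
have inT u : `|u| <= `|t| -> `|u| < T by move=> h; exact: le_lt_trans tT.
have consts (f : E -> R) : smooth_on U f -> (forall x, W x -> 'D_(X x) f x = 0) -> f (c t) = f x.
  move=> Hf fX; have [|th _] := @MVT_sym R (f \o c) (fun=> 0) t.
    move=> u /inT uT; have [Wu _ du] := Hc _ uT.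
    rewrite -(fX _ Wu); apply: is_derive_curve => //; exact: dif.
  by rewrite mul0r /= c0 => /eqP; rewrite subr_eq0 => /eqP.
have [Wt Bt _] := Hc _ tT.
have cti : c t 0 i = x0 0 i.
  have [|th _] := @MVT_sym R (fun u => c u 0 i) (fun=> 1) t.
    move=> u /inT uT; have [Wu _ du] := Hc _ uT.
    have := is_derive_coord i du; rewrite /X !mxE !eqxx (negPf ij) /=.
    by rewrite mulr0 subr0.
  by rewrite mul1r c0 /t !mxE => /(canRL (subrK _)) ->; ring.
pose tau := (c t - x0) 0 j.
have ctL : c t = L tau.
  rewrite /L (sE (c t)) {1}(sE x0) cti -addrA -scalerDl /tau !mxE; congr (_ + _ *: _).
  by ring.
have taud : `|tau - 0| < d.
  rewrite subr0; apply: le_lt_trans (rV_coord_le _ _) _; apply: le_lt_trans Bt _.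
  by rewrite ltr_pdivrMr // ltr_pMr // ltr1n.
have [_ Jt gt] := gl _ taud.
rewrite /= -ctL consts // in Jt gt.
split => //; first exact: WU.
by rewrite /= gt -ctL consts.
Qed.

End LevelSets.

(** * Homogeneous functions on the slit tangent bundle *)

Section Square.
Context {R : realType} {V : normedModType R}.

Lemma derive_near (U : set V) (f g : V -> R) (x v : V) : open U -> U x ->
  (forall y, U y -> f y = g y) -> 'D_v f x = 'D_v g x.
Proof.
move=> oU Ux fg; apply: near_eq_derive.
by apply: filterS (open_nbhs_nbhs (conj oU Ux)) => y; exact: fg.
Qed.

Lemma smooth_is_derive (U : set V) (f : V -> R) (x v : V) : smooth_on U f -> U x ->
  is_derive x v f ('D_v f x).
Proof. by move=> Hf Ux; exact: derivableP (smooth_derivable (v := v) Hf Ux). Qed.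

Lemma derive_mul (U : set V) (f g : V -> R) (x v : V) : smooth_on U f -> smooth_on U g ->
  U x -> 'D_v (fun y => f y * g y) x = f x * 'D_v g x + g x * 'D_v f x.
Proof.
move=> Hf Hg Ux; have D1 := smooth_is_derive v Hf Ux; have D2 := smooth_is_derive v Hg Ux.
by have [_ ->] := is_deriveM D1 D2.
Qed.

Lemma derive_scale (U : set V) (c : R) (f : V -> R) (x v : V) : smooth_on U f ->
  U x -> 'D_v (fun y => c * f y) x = c * 'D_v f x.
Proof.
move=> Hf Ux; rewrite (derive_mul v (smooth_cst U c) Hf Ux) derive_cst.
by rewrite mulr0 addr0.
Qed.

Lemma derive_sqr (U : set V) (f : V -> R) (x v : V) : smooth_on U f -> U x ->
  'D_v (fun y => f y ^+ 2) x = 2 * f x * 'D_v f x.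
Proof.
move=> Hf Ux; rewrite (_ : (fun y => _) = (fun y => f y * f y)).
  by rewrite (derive_mul v Hf Hf Ux); ring.
by apply/funext => y; rewrite expr2.
Qed.

Lemma derive_sqr2 (U : set V) (f : V -> R) (x u v : V) : open U -> smooth_on U f -> U x ->
  'D_u ('D_v (fun y => f y ^+ 2)) x =
  2 * ('D_u f x * 'D_v f x + f x * 'D_u ('D_v f) x).
Proof.
move=> oU Hf Ux.
rewrite (@derive_near U _ (fun y => (2 * f y) * 'D_v f y) x u oU Ux); last first.
  by move=> y Uy; rewrite (derive_sqr v Hf Uy).
have H2 := smoothMl 2 oU Hf.
rewrite (derive_mul u H2 (smooth_derive Hf v) Ux).
rewrite (derive_mul u (smooth_cst U 2) Hf Ux) derive_cst; ring.
Qed.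

End Square.

Section Tangent.
Context {R : realType}.
Local Notation E := 'rV[R]_2.
Local Notation e := (@basis_vec R 2).

Definition slit (U : set E) : set (E * E) := [set z : E * E | U z.1 /\ z.2 != 0].

Definition dirx (k : 'I_2) : E * E := (e k, 0).
Definition diry (k : 'I_2) : E * E := (0, e k).

Lemma slit_open U : open U -> open (slit U).
Proof.
move=> oU; apply: openI.
  by apply: open_comp => // z _; exact: cvg_fst.
apply: (@open_comp _ _ (fun z : E * E => z.2) [set y | y != 0]).
  by move=> z _; exact: cvg_snd.
rewrite (_ : [set y : E | y != 0] = ~` [set 0]).
  by apply: closed_openC; apply: accessible_closed_set1; apply: hausdorff_accessible;
      exact: norm_hausdorff.
by apply/seteqP; split => y /= /eqP.
Qed.

Lemma frame_tangent : exists (I : finType) (b : I -> E * E) c, frame b c.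
Proof. by do 3 eexists; exact: (frame_prod (@frame_rV R 2) (@frame_rV R 2)). Qed.

Lemma slit_differentiable U (G : E * E -> R) z : open U -> smooth_on (slit U) G ->
  slit U z -> differentiable G z.
Proof.
move=> oU HG Uz; have [I [b [c fr]]] := frame_tangent.
exact (smooth_differentiable fr (slit_open oU) HG Uz).
Qed.

Lemma vec2 (v : E) : v = v 0 0 *: e 0 + v 0 1 *: e 1.
Proof.
rewrite {1}(row_sum_delta v) big_ord_recl big_ord1.
by have -> : lift ord0 ord0 = 1 :> 'I_2 by exact/val_inj.
Qed.

Lemma derive_tangent U (G : E * E -> R) z (v w : E) : open U -> smooth_on (slit U) G ->
  slit U z -> 'D_(v, w) G z =
    v 0 0 * 'D_(dirx 0) G z + v 0 1 * 'D_(dirx 1) G z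
    + (w 0 0 * 'D_(diry 0) G z + w 0 1 * 'D_(diry 1) G z).
Proof.
move=> oU HG Uz; have dG := slit_differentiable oU HG Uz.
have -> : (v, w) = v 0 0 *: dirx 0 + (v 0 1 *: dirx 1 + (w 0 0 *: diry 0 + w 0 1 *: diry 1)).
  congr pair; rewrite /= ?scaler0 ?add0r ?addr0; exact: vec2.
by rewrite !(derive_comb, deriveZ_dir) // !addrA.
Qed.

(** Euler's relation: differentiate the homogeneity relation along t |-> (1 + t) y. *)
Lemma euler U (G : E * E -> R) (k : nat) z : open U -> smooth_on (slit U) G ->
  (forall x y (l : R), slit U (x, y) -> 0 < l -> G (x, l *: y) = l ^+ k * G (x, y)) ->
  slit U z ->
  z.2 0 0 * 'D_(diry 0) G z + z.2 0 1 * 'D_(diry 1) G z = k%:R * G z.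
Proof.
move=> oU HG hG Uz; case: z Uz => x y Uz.
have := @derive_tangent U G (x, y) 0 y oU HG Uz.
rewrite !mxE !mul0r !add0r /= => <-.
have D : is_derive (0 : R) 1 (fun t : R => G ((x, y) + t *: (0, y))) ('D_(0, y) G (x, y)).
  apply: is_derive_line; rewrite scale0r addr0.
  exact: smooth_is_derive HG Uz.
have D' : is_derive (0 : R) 1 (fun t : R => G ((x, y) + t *: (0, y))) (k%:R * G (x, y)).
  pose H (t : R) := (1 + t) ^+ k * G (x, y).
  have DH : is_derive (0 : R) 1 H (k%:R * G (x, y)).
    have D1 := @is_deriveD _ _ _ _ _ (0 : R) 1 _ _ (is_derive_cst (1 : R) (0 : R) 1)
        (is_derive_id (0 : R) 1).
    have D2 := @is_deriveX _ _ _ k _ _ _ D1.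
    have D3 := @is_deriveM _ _ _ _ _ _ _ _ D2 (is_derive_cst (G (x, y)) (0 : R) 1).
    rewrite (_ : H = ((cst 1 + id) ^+ k : R -> R) * cst (G (x, y))); last first.
      by apply/funext => t; rewrite /H exprfctE.
    have [d3 e3] := D3; split; first exact: d3.
    rewrite e3.
    rewrite !exprfctE /GRing.scale /= -?[(cst 1 + id) 0]/(1 + 0 : R) ?addr0 ?expr1n.
    by ring.
  apply: near_eq_is_derive DH; apply/nbhs_normP; exists 1 => //= t.
  rewrite /= sub0r normrN ltr_norml => /andP[t1 t2].
  rewrite /H -hG //; last by lra.
  congr (G _); congr pair; rewrite /= ?scaler0 ?addr0 //.
  by rewrite scalerDl scale1r.
by have [_ <-] := D; have [_ <-] := D'.
Qed.

Lemma homog_derive U (G : E * E -> R) (c l : R) x y (v w : E) : open U -> smooth_on (slit U) G ->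
  (forall x y, slit U (x, y) -> G (x, l *: y) = c * G (x, y)) -> l != 0 -> slit U (x, y) ->
  'D_(v, l *: w) G (x, l *: y) = c * 'D_(v, w) G (x, y).
Proof.
move=> oU HG hG l0 Uz; have oS := slit_open oU.
rewrite -(@derive_affine _ _ _ _ G (fun z : E * E => (z.1, l *: z.2)) (x, y) (v, w)); last first.
  by move=> h; congr pair; rewrite /= scalerDr !scalerA mulrC.
rewrite (@derive_near _ _ (slit U) _ (fun z => c * G z) _ _ oS Uz); last first.
  by move=> [x' y'] Uz'; exact: hG.
by rewrite (derive_mul _ (smooth_cst _ c) HG Uz) derive_cst; ring.
Qed.

End Tangent.

(** * The fundamental tensor and the spray in dimension two *)

Section Partials.
Context {R : realType}.
Local Notation E := 'rV[R]_2.
Local Notation e := (@basis_vec R 2).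

Lemma partial_y (G : E * E -> R) x y (l : 'I_2) :
  'D_(e l) (fun y' => G (x, y')) y = 'D_(diry l) G (x, y).
Proof.
apply: (@derive_affine _ _ _ _ G (fun y' : E => (x, y'))) => h.
by congr pair; rewrite /= scaler0 add0r.
Qed.

Lemma partial_x (G : E * E -> R) x y (k : 'I_2) :
  'D_(e k) (fun x' => G (x', y)) x = 'D_(dirx k) G (x, y).
Proof.
apply: (@derive_affine _ _ _ _ G (fun x' : E => (x', y))) => h.
by congr pair; rewrite /= scaler0 add0r.
Qed.

Lemma homog_dery U (G : E * E -> R) (c l : R) x y (i : 'I_2) : open U -> smooth_on (slit U) G ->
  (forall x y, slit U (x, y) -> G (x, l *: y) = c * G (x, y)) -> l != 0 -> slit U (x, y) ->
  l * 'D_(diry i) G (x, l *: y) = c * 'D_(diry i) G (x, y).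
Proof.
move=> oU HG hG l0 Uz; rewrite -(homog_derive 0 (e i) oU HG hG l0 Uz).
have Uz' : slit U (x, l *: y).
  by case: Uz => Ux y0; split => //=; rewrite scaler_eq0 negb_or l0.
rewrite -(deriveZ_dir _ _ (slit_differentiable oU HG Uz')).
suff -> : l *: diry i = (0, l *: e i) :> E * E by [].
by congr pair; rewrite /= scaler0.
Qed.

Lemma homog_derx U (G : E * E -> R) (c l : R) x y (k : 'I_2) : open U -> smooth_on (slit U) G ->
  (forall x y, slit U (x, y) -> G (x, l *: y) = c * G (x, y)) -> l != 0 -> slit U (x, y) ->
  'D_(dirx k) G (x, l *: y) = c * 'D_(dirx k) G (x, y).
Proof.
move=> oU HG hG l0 Uz; rewrite -(homog_derive (e k) 0 oU HG hG l0 Uz).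
by rewrite scaler0.
Qed.

Lemma sum2 (f : 'I_2 -> R) : \sum_i f i = f 0 + f 1.
Proof.
rewrite big_ord_recl big_ord1.
by have -> : lift ord0 ord0 = 1 :> 'I_2 by exact/val_inj.
Qed.

Lemma ord2P (k : 'I_2) : k = 0 \/ k = 1.
Proof. by case: k => [[|[|//]] hk]; [left|right]; apply/val_inj. Qed.

Lemma pos_def_det (h : 'M[R]_2) : pos_def h -> h 1 0 = h 0 1 ->
  0 < h 0 0 * h 1 1 - h 0 1 ^+ 2.
Proof.
move=> pd hs.
have h00 : 0 < h 0 0.
  have := pd (e 0); rewrite /quad_form !sum2 !mxE /=.
  have -> : (e 0 != 0) by apply/eqP => /rowP /(_ 0) /eqP; rewrite !mxE oner_eq0.
  by move=> /(_ isT); rewrite !mulr0 !mulr1 !addr0.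
pose v : E := - h 0 1 *: e 0 + h 0 0 *: e 1.
have v0 : v 0 0 = - h 0 1 by rewrite !mxE /= mulr1 mulr0 addr0.
have v1 : v 0 1 = h 0 0 by rewrite !mxE /= mulr1 mulr0 add0r.
have := pd v; rewrite /quad_form !sum2 v0 v1 hs => H.
rewrite -(pmulr_rgt0 _ h00); apply: lt_le_trans (H _) _.
  by apply/eqP => /rowP /(_ 1) /eqP; rewrite v1 mxE gt_eqF.
by rewrite le_eqVlt; apply/orP; left; apply/eqP; ring.
Qed.

Lemma mulmxV2 (h : 'M[R]_2) : h 0 0 * h 1 1 - h 0 1 * h 1 0 != 0 ->
  forall j k, h j 0 * invmx h 0 k + h j 1 * invmx h 1 k = (j == k)%:R.
Proof.
move=> d0 j k; have hu : h \in unitmx.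
  rewrite unitmxE unitfE (expand_det_row _ 0) sum2 /cofactor !det_mx11 !mxE /=.
  have -> : lift 0 0 = 1 :> 'I_2 by exact/val_inj.
  have -> : lift 1 0 = 0 :> 'I_2 by exact/val_inj.
  move: d0; congr (_ != 0); ring.
by have := congr1 (fun A : 'M[R]_2 => A j k) (mulmxV hu); rewrite !mxE sum2.
Qed.

Lemma invmx2_solve (h : 'M[R]_2) (c : R) (l : 'I_2 -> R) j :
  h 0 0 * h 1 1 - h 0 1 * h 1 0 != 0 ->
  h j 0 * (c * (invmx h 0 0 * l 0 + invmx h 0 1 * l 1))
  + h j 1 * (c * (invmx h 1 0 * l 0 + invmx h 1 1 * l 1)) = c * l j.
Proof.
move=> d0; have I := mulmxV2 d0 j.
transitivity (c * ((h j 0 * invmx h 0 0 + h j 1 * invmx h 1 0) * l 0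
  + (h j 0 * invmx h 0 1 + h j 1 * invmx h 1 1) * l 1)); first by ring.
by rewrite !I; case: (ord2P j) => ->; rewrite /= ?mul1r ?mul0r ?addr0 ?add0r.
Qed.

End Partials.

Section Finsler.
Context {R : realType}.
Local Notation E := 'rV[R]_2.
Local Notation e := (@basis_vec R 2).
Implicit Types (U : set E) (F : E -> E -> R).

(** The conditions on a Finsler metric away from the zero section, where the geodesic
    equation lives. *)
Definition slit_finsler U F : Prop :=
  [/\ forall x y, U x -> y != 0 -> 0 < F x y,
      smooth_on (slit U) (fun z : E * E => F z.1 z.2),
      forall x y (l : R), U x -> 0 < l -> F x (l *: y) = l * F x y
    & forall x y, U x -> y != 0 -> pos_def (fund_tensor F x y)].

Definition tot F : E * E -> R := fun z => F z.1 z.2.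
Definition Fx F k : E * E -> R := 'D_(dirx k) (tot F).
Definition Fy F l : E * E -> R := 'D_(diry l) (tot F).
Definition Fxy F k l : E * E -> R := 'D_(dirx k) (Fy F l).
Definition Fyy F i j : E * E -> R := 'D_(diry i) (Fy F j).

Lemma fund_tensor_smooth U F x y i j : open U -> smooth_on (slit U) (tot F) -> slit U (x, y) ->
  fund_tensor F x y i j = Fy F i (x, y) * Fy F j (x, y) + tot F (x, y) * Fyy F i j (x, y).
Proof.
move=> oU sF Uz; rewrite mxE.
have -> : (fun y' : E => 'D_(e j) (fun y'' : E => F x y'' ^+ 2) y') =
   (fun y' : E => 'D_(diry j) (fun z => tot F z ^+ 2) (x, y')).
  by apply/funext => y'; rewrite -(partial_y (fun z => tot F z ^+ 2)).
rewrite (partial_y ('D_(diry j) (fun z => tot F z ^+ 2))).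
rewrite (derive_sqr2 _ _ (slit_open oU) sF Uz) mulrA mulVf ?pnatr_eq0 // mul1r.
by [].
Qed.

Context (U : set E) (F : E -> E -> R) (oU : open U) (hF : slit_finsler U F).

Lemma tot_smooth : smooth_on (slit U) (tot F).
Proof. by case: hF. Qed.

Lemma Fy_smooth l : smooth_on (slit U) (Fy F l).
Proof. exact: smooth_derive tot_smooth (diry l). Qed.

Lemma Fx_smooth k : smooth_on (slit U) (Fx F k).
Proof. exact: smooth_derive tot_smooth (dirx k). Qed.

Lemma Fyy_smooth i l : smooth_on (slit U) (Fyy F i l).
Proof. exact: smooth_derive (Fy_smooth l) (diry i). Qed.

Lemma Fxy_smooth k l : smooth_on (slit U) (Fxy F k l).
Proof. exact: smooth_derive (Fy_smooth l) (dirx k). Qed.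

Lemma tot_homog x y (l : R) : U x -> 0 < l -> tot F (x, l *: y) = l * tot F (x, y).
Proof. by case: hF => _ _ h _; exact: h. Qed.

Lemma slitZ x y (l : R) : 0 < l -> slit U (x, y) -> slit U (x, l *: y).
Proof. by move=> l0 [Ux y0]; split => //=; rewrite scaler_eq0 negb_or gt_eqF. Qed.

Lemma tot_gt0 z : slit U z -> 0 < tot F z.
Proof. by case: hF => h _ _ _; case: z => x y [Ux y0]; exact: h. Qed.

Lemma Fy_homog x y l (r : R) : 0 < r -> slit U (x, y) -> Fy F l (x, r *: y) = Fy F l (x, y).
Proof.
move=> r0 Uz; apply: (@mulfI _ r); first by rewrite gt_eqF.
apply: (homog_dery _ oU tot_smooth _ _ Uz); last by rewrite gt_eqF.
by move=> x' y' [Ux' _]; exact: tot_homog.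
Qed.

Lemma Fx_homog x y k (r : R) : 0 < r -> slit U (x, y) -> Fx F k (x, r *: y) = r * Fx F k (x, y).
Proof.
move=> r0 Uz; apply: (homog_derx _ oU tot_smooth _ _ Uz); last by rewrite gt_eqF.
by move=> x' y' [Ux' _]; exact: tot_homog.
Qed.

Lemma Fxy_homog x y k l (r : R) : 0 < r -> slit U (x, y) -> Fxy F k l (x, r *: y) = Fxy F k l
    (x, y).
Proof.
move=> r0 Uz; rewrite -[RHS]mul1r.
apply: (homog_derx _ oU (Fy_smooth l) _ _ Uz); last by rewrite gt_eqF.
by move=> x' y' Uz'; rewrite mul1r; exact: Fy_homog.
Qed.

Lemma Fyy_homog x y i l (r : R) : 0 < r -> slit U (x, y) -> r * Fyy F i l (x, r *: y) = Fyy F i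
    l (x, y).
Proof.
move=> r0 Uz; rewrite -[RHS]mul1r.
apply: (homog_dery _ oU (Fy_smooth l) _ _ Uz); last by rewrite gt_eqF.
by move=> x' y' Uz'; rewrite mul1r; exact: Fy_homog.
Qed.

Lemma euler_F z : slit U z -> z.2 0 0 * Fy F 0 z + z.2 0 1 * Fy F 1 z = tot F z.
Proof.
move=> Uz; rewrite -[RHS]mul1r; apply: (euler (k := 1) oU tot_smooth _ Uz) => x y l [Ux _] l0.
by rewrite expr1; exact: tot_homog.
Qed.

Lemma euler_Fy l z : slit U z -> z.2 0 0 * Fyy F 0 l z + z.2 0 1 * Fyy F 1 l z = 0.
Proof.
move=> Uz; rewrite -[RHS](mul0r (Fy F l z)).
apply: (euler (k := 0) oU (Fy_smooth l) _ Uz) => x y r Uz' r0.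
by rewrite expr0 mul1r; exact: Fy_homog.
Qed.

Lemma Fxy_comm k l z : slit U z -> Fxy F k l z = 'D_(diry l) (Fx F k) z.
Proof. by move=> Uz; exact: (derive_comm _ _ (slit_open oU) tot_smooth Uz). Qed.

Lemma euler_Fx k z : slit U z -> z.2 0 0 * Fxy F k 0 z + z.2 0 1 * Fxy F k 1 z = Fx F k z.
Proof.
move=> Uz; rewrite -[RHS]mul1r.
rewrite (Fxy_comm k 0 Uz) (Fxy_comm k 1 Uz).
apply: (euler (k := 1) oU (Fx_smooth k) _ Uz) => x y r Uz' r0.
by rewrite expr1; exact: Fx_homog.
Qed.

Lemma Fyy_sym z : slit U z -> Fyy F 1 0 z = Fyy F 0 1 z.
Proof. by move=> Uz; exact: (derive_comm _ _ (slit_open oU) tot_smooth Uz). Qed.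

(** The fibre Hessian annihilates y, so its entries are proportional to (y1^2, - y0 y1, y0^2);
    the trace gives the factor. *)
Definition hess F (z : E * E) : R := (Fyy F 0 0 z + Fyy F 1 1 z) / (z.2 0 0 ^+ 2 + z.2 0 1 ^+ 2).

Lemma sqnorm_gt0 (y : E) : y != 0 -> 0 < y 0 0 ^+ 2 + y 0 1 ^+ 2.
Proof.
move=> y0; rewrite lt_def addr_ge0 ?sqr_ge0 // andbT; apply: contra y0.
rewrite paddr_eq0 ?sqr_ge0 // !sqrf_eq0 => /andP[/eqP a /eqP b].
by rewrite (vec2 y) a b !scale0r addr0.
Qed.

Lemma hess_entries z : slit U z ->
  [/\ Fyy F 0 0 z = hess F z * z.2 0 1 ^+ 2,
      Fyy F 0 1 z = - (hess F z * z.2 0 0 * z.2 0 1),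
      Fyy F 1 0 z = - (hess F z * z.2 0 0 * z.2 0 1) &
      Fyy F 1 1 z = hess F z * z.2 0 0 ^+ 2].
Proof.
move=> Uz; have N := sqnorm_gt0 Uz.2; have e0 := euler_Fy 0 Uz; have e1 := euler_Fy 1 Uz.
rewrite (Fyy_sym Uz) in e0 *; rewrite /hess.
move: (z.2 0 0) (z.2 0 1) (Fyy F 0 0 z) (Fyy F 0 1 z) (Fyy F 1 1 z) N e0 e1 => a b p q r N e0 e1.
have N0 : a ^+ 2 + b ^+ 2 != 0 by rewrite gt_eqF.
have E1 : a ^+ 2 * p = b ^+ 2 * r.
  have -> : a ^+ 2 * p = a * (a * p + b * q) - b * (a * q + b * r) + b ^+ 2 * r by ring.
  by rewrite e0 e1; ring.
have E2 : (a ^+ 2 + b ^+ 2) * q = - (a * b * (p + r)).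
  have -> : (a ^+ 2 + b ^+ 2) * q = b * (a * p + b * q) + a * (a * q + b * r) - a * b * (p + r)
      by ring.
  by rewrite e0 e1; ring.
have F1 : p = (p + r) / (a ^+ 2 + b ^+ 2) * b ^+ 2.
  by rewrite mulrAC; apply: (canRL (mulfK N0)); rewrite mulrDr mulrDl (mulrC p) (mulrC p) E1; ring.
have F2 : q = - ((p + r) / (a ^+ 2 + b ^+ 2) * a * b).
  by rewrite -mulrA mulrAC -mulNr; apply: (canRL (mulfK N0)); rewrite mulrC E2; ring.
have F3 : r = (p + r) / (a ^+ 2 + b ^+ 2) * a ^+ 2.
  by rewrite mulrAC; apply: (canRL (mulfK N0)); rewrite mulrDr mulrDl (mulrC p) (mulrC r (b ^+
      2)) E1; ring.
by split.
Qed.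

Lemma fund_tensorE x y i j : slit U (x, y) ->
  fund_tensor F x y i j = Fy F i (x, y) * Fy F j (x, y) + tot F (x, y) * Fyy F i j (x, y).
Proof. exact: fund_tensor_smooth oU tot_smooth. Qed.

Lemma fund_sym x y : slit U (x, y) -> fund_tensor F x y 1 0 = fund_tensor F x y 0 1.
Proof.
move=> Uz; rewrite (fund_tensorE 1 0 Uz) (fund_tensorE 0 1 Uz) (Fyy_sym Uz).
by rewrite [X in X + _ = _]mulrC.
Qed.

Lemma det_fund x y : slit U (x, y) ->
  fund_tensor F x y 0 0 * fund_tensor F x y 1 1 - fund_tensor F x y 0 1 ^+ 2
    = tot F (x, y) ^+ 3 * hess F (x, y).
Proof.
move=> Uz; rewrite (fund_tensorE 0 0 Uz) (fund_tensorE 0 1 Uz) (fund_tensorE 1 1 Uz).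
have [-> -> _ ->] := hess_entries Uz.
have := euler_F Uz => /= <-; ring.
Qed.

Lemma hess_gt0 z : slit U z -> 0 < hess F z.
Proof.
case: z => x y Uz; case: (hF) => _ _ _ pd.
have := pos_def_det (pd _ _ Uz.1 Uz.2) (fund_sym Uz).
rewrite (det_fund Uz) pmulr_rgt0 // exprn_gt0 //; exact: tot_gt0.
Qed.

(** The covector [F^2]_{x^k y^l} y^k - [F^2]_{x^l} of the geodesic equation, expanded in the
    derivatives of F. *)
Definition lagr F (z : E * E) (l : 'I_2) : R :=
  2 * ((Fx F 0 z * Fy F l z + tot F z * Fxy F 0 l z) * z.2 0 0
     + (Fx F 1 z * Fy F l z + tot F z * Fxy F 1 l z) * z.2 0 1
     - tot F z * Fx F l z).

Lemma sprayE x y i : slit U (x, y) ->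
  spray F x y i = 4^-1 * (invmx (fund_tensor F x y) i 0 * lagr F (x, y) 0
                        + invmx (fund_tensor F x y) i 1 * lagr F (x, y) 1).
Proof.
move=> Uz; rewrite /spray sum2.
have M l : (\sum_k 'D_(e k) (fun x' : E => 'D_(e l) (fun y' : E => F x' y' ^+ 2) y) x * y 0 k)
     - 'D_(e l) (fun x' : E => F x' y ^+ 2) x = lagr F (x, y) l.
  have -> : (fun x' : E => 'D_(e l) (fun y' : E => F x' y' ^+ 2) y) =
     (fun x' : E => 'D_(diry l) (fun z => tot F z ^+ 2) (x', y)).
    by apply/funext => x'; rewrite -(partial_y (fun z => tot F z ^+ 2)).
  have d2 k : 'D_(e k) (fun x' : E => 'D_(diry l) (fun z => tot F z ^+ 2) (x', y)) x =
      2 * (Fx F k (x, y) * Fy F l (x, y) + tot F (x, y) * Fxy F k l (x, y)).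
    rewrite (partial_x ('D_(diry l) (fun z => tot F z ^+ 2))).
    exact: derive_sqr2 (slit_open oU) tot_smooth Uz.
  have d1 : 'D_(e l) (fun x' : E => F x' y ^+ 2) x = 2 * tot F (x, y) * Fx F l (x, y).
    rewrite (partial_x (fun z => tot F z ^+ 2)).
    exact: derive_sqr tot_smooth Uz.
  rewrite sum2 (d2 0) (d2 1) d1 /lagr.
  have key (f0 f1 fl g h0 h1 t p q : R) :
      2 * (f0 * g + t * h0) * p + 2 * (f1 * g + t * h1) * q - 2 * t * fl
      = 2 * ((f0 * g + t * h0) * p + (f1 * g + t * h1) * q - t * fl) by ring.
  exact: key.
by congr (_ * (_ * _ + _ * _)); [exact: (M 0)|exact: (M 1)].
Qed.

(** The linear system that defines the spray, free of the inverse matrix. *)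
Lemma spray_solves x y j : slit U (x, y) ->
  fund_tensor F x y j 0 * spray F x y 0 + fund_tensor F x y j 1 * spray F x y 1
  = 4^-1 * lagr F (x, y) j.
Proof.
move=> Uz; rewrite !(sprayE _ Uz).
have d0 : fund_tensor F x y 0 0 * fund_tensor F x y 1 1 - fund_tensor F x y 0 1 * fund_tensor F
    x y 1 0 != 0.
  rewrite (fund_sym Uz) -expr2 (det_fund Uz).
  by rewrite gt_eqF // mulr_gt0 ?hess_gt0 // exprn_gt0 // tot_gt0.
exact: (invmx2_solve 4^-1 (lagr F (x, y)) j d0).
Qed.

(** Hamel's obstruction: in dimension two it vanishes exactly when straight lines are
    geodesics.  In general omega F = hess F times the area form of twice the spray and y. *)
Definition omega F (z : E * E) : R := Fxy F 1 0 z - Fxy F 0 1 z.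

End Finsler.

(** * Geodesics *)

Section Curves.
Context {R : realType}.

Lemma is_derive_rV n (G : R -> 'rV[R]_n) (t : R) (v : 'rV[R]_n) :
  (forall j, is_derive t 1 (fun s => G s 0 j) (v 0 j)) -> is_derive t 1 G v.
Proof.
move=> H; have dG : derivable G t 1.
  by apply/derivable_mxP => i j; rewrite (ord1 i); case: (H j).
split => //; rewrite derive_mx //; apply/rowP => j; rewrite mxE.
by case: (H j).
Qed.

Lemma smooth_linear (V : normedModType R) (U : set V) (f : V -> R) : open U ->
  continuous f -> (forall (a : R) u v, f (a *: u + v) = a * f u + f v) -> smooth_on U f.
Proof.
move=> oU cf lf.
have sid : smooth_on [set: R] id.
  have D (t : R) : [set: R] t -> is_derive t 1 id (1 : R) by move=> _; exact: is_derive_id.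
  exact (smooth_primitive openT D (@smooth_cst R R setT 1)).
by apply: (smooth_affine oU (io := f) (U' := setT) _ _ _ sid) => // v; exists (f v).
Qed.

End Curves.

Section Spray.
Context {R : realType}.
Local Notation E := 'rV[R]_2.
Local Notation e := (@basis_vec R 2).
Context (U : set E) (F : E -> E -> R) (oU : open U) (hF : slit_finsler U F).

(** With h = dF dF + F Hess F and h y = F dF, the area form of (G, y) times
    det h = F^3 hess is that of (h G, h y), and h G is given by the
    Euler-Lagrange equations.  Contracting h G with y instead gives the
    conservation of F. *)
Lemma spray_algebra (t f0 f1 a b h G0 G1 x0 x1 x00 x01 x10 x11 : R) : t != 0 ->
  t = a * f0 + b * f1 -> x0 = a * x00 + b * x01 -> x1 = a * x10 + b * x11 ->
  (f0 * f0 + t * (h * b ^+ 2)) * G0 + (f0 * f1 + t * - (h * a * b)) * G1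
    = 4^-1 * (2 * ((x0 * f0 + t * x00) * a + (x1 * f0 + t * x10) * b - t * x0)) ->
  (f1 * f0 + t * - (h * a * b)) * G0 + (f1 * f1 + t * (h * a ^+ 2)) * G1
    = 4^-1 * (2 * ((x0 * f1 + t * x01) * a + (x1 * f1 + t * x11) * b - t * x1)) ->
  2 * (G0 * b - G1 * a) * h = x10 - x01 /\ a * x0 + b * x1 = 2 * (f0 * G0 + f1 * G1).
Proof.
move=> t0 Et -> -> /eqP; rewrite -subr_eq0; set A := _ - _ => /eqP A0.
move=> /eqP; rewrite -subr_eq0; set B := _ - _ => /eqP B0.
split; apply/eqP; rewrite -subr_eq0; apply/eqP.
- apply: (mulfI (expf_neq0 3 t0)); rewrite mulr0.
  transitivity (2 * (t * f1 * A - t * f0 * B)); last by rewrite A0 B0; ring.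
  by rewrite /A /B {A A0 B B0 t0}Et; field.
- apply: (mulfI t0); rewrite mulr0.
  transitivity (- 2 * (a * A + b * B)); last by rewrite A0 B0; ring.
  by rewrite /A /B {A A0 B B0 t0}Et; field.
Qed.

Lemma spray_relations x y : slit U (x, y) ->
  2 * (spray F x y 0 * y 0 1 - spray F x y 1 * y 0 0) * hess F (x, y) = omega F (x, y) /\
  y 0 0 * Fx F 0 (x, y) + y 0 1 * Fx F 1 (x, y)
    = 2 * (Fy F 0 (x, y) * spray F x y 0 + Fy F 1 (x, y) * spray F x y 1).
Proof.
move=> Uz.
have S0 := spray_solves oU hF 0 Uz; have S1 := spray_solves oU hF 1 Uz.
rewrite (fund_tensorE oU hF 0 0 Uz) (fund_tensorE oU hF 0 1 Uz) in S0.
rewrite (fund_tensorE oU hF 1 0 Uz) (fund_tensorE oU hF 1 1 Uz) in S1.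
have [h1 h2 h3 h4] := hess_entries oU hF Uz.
rewrite h1 h2 in S0; rewrite h3 h4 in S1.
have t0 : tot F (x, y) != 0 by rewrite gt_eqF // (tot_gt0 hF Uz).
have Et := esym (euler_F oU hF Uz).
have E0 := esym (euler_Fx oU hF 0 Uz); have E1 := esym (euler_Fx oU hF 1 Uz).
exact: (spray_algebra t0 Et E0 E1 S0 S1).
Qed.

Lemma coord_smooth (W : set (E * E)) i : open W -> smooth_on W (fun z : E * E => z.2 0 i).
Proof.
move=> oW; apply: smooth_linear => // [z|a u v]; last by rewrite /= !mxE.
by apply: (@continuous_comp _ _ _ snd (fun v : E => v 0 i));
    [exact: cvg_snd|exact: coord_continuous].
Qed.

Lemma hess_smooth : smooth_on (slit U) (hess F).
Proof.
have oS := slit_open oU.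
apply: smoothM => //.
  by apply: smoothD => //; exact: Fyy_smooth.
apply: smoothV => //.
  by apply: smoothD => //; apply: smoothX => //; exact: coord_smooth.
by move=> z [_ /sqnorm_gt0]; move=> h; rewrite gt_eqF.
Qed.

Lemma lagr_smooth l : smooth_on (slit U) (fun z => lagr F z l).
Proof.
have oS := slit_open oU.
have s1 := Fx_smooth hF; have s2 := Fy_smooth hF; have s3 := Fxy_smooth hF.
have s4 := tot_smooth hF; have s5 i := coord_smooth i oS.
apply: smoothMl => //; apply: smoothB => //; last by apply: smoothM.
by apply: smoothD => //; apply: smoothM => //; apply: smoothD => //; apply: smoothM.
Qed.

Lemma cramer2 (h00 h01 h11 g0 g1 m0 m1 d : R) : d != 0 -> d = h00 * h11 - h01 * h01 ->
  h00 * g0 + h01 * g1 = m0 -> h01 * g0 + h11 * g1 = m1 ->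
  g0 = (h11 * m0 - h01 * m1) * d^-1 /\ g1 = (h00 * m1 - h01 * m0) * d^-1.
Proof.
by move=> d0 ed <- <-; split; apply: (canRL (mulfK d0)); rewrite ed; ring.
Qed.

Lemma spray_smooth i : smooth_on (slit U) (fun z : E * E => spray F z.1 z.2 i).
Proof.
have oS := slit_open oU.
pose h k l z := Fy F k z * Fy F l z + tot F z * Fyy F k l z.
pose d z := tot F z ^+ 3 * hess F z.
have s1 k : smooth_on (slit U) (fun z => 4^-1 * lagr F z k) by apply: smoothMl => //;
    exact: lagr_smooth.
have s2 k l : smooth_on (slit U) (h k l).
  have s1' := Fy_smooth hF; have s2' := tot_smooth hF; have s3' := Fyy_smooth hF.
  by apply: smoothD => //; apply: smoothM.
have sd : smooth_on (slit U) (fun z => (d z)^-1).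
  apply: smoothV => //; first by apply: smoothM => //; [apply: smoothX => //;
      exact: tot_smooth|exact: hess_smooth].
  by move=> z Uz; rewrite gt_eqF // mulr_gt0 ?(hess_gt0 oU hF Uz) // exprn_gt0 // (tot_gt0 hF Uz).
have sol (x y : E) : slit U (x, y) ->
  let z := (x, y) in
  spray F x y 0 = (h 1 1 z * (4^-1 * lagr F z 0) - h 0 1 z * (4^-1 * lagr F z 1)) * (d z)^-1 /\
  spray F x y 1 = (h 0 0 z * (4^-1 * lagr F z 1) - h 0 1 z * (4^-1 * lagr F z 0)) * (d z)^-1.
  move=> Uz z; have S0 := spray_solves oU hF 0 Uz; have S1 := spray_solves oU hF 1 Uz.
  have dz := det_fund oU hF Uz.
  rewrite (fund_sym oU hF Uz) in S1.
  rewrite (fund_tensorE oU hF 0 0 Uz) (fund_tensorE oU hF 0 1 Uz) in S0 dz.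
  rewrite (fund_tensorE oU hF 0 1 Uz) (fund_tensorE oU hF 1 1 Uz) in S1.
  rewrite (fund_tensorE oU hF 1 1 Uz) expr2 in dz.
  apply: (cramer2 _ (esym dz) S0 S1).
  by rewrite gt_eqF // mulr_gt0 ?(hess_gt0 oU hF Uz) // exprn_gt0 // (tot_gt0 hF Uz).
case: (ord2P i) => ->.
- have H := smoothM oS (smoothB oS (smoothM oS (s2 1 1) (s1 0)) (smoothM oS (s2 0 1) (s1 1))) sd.
  by apply: smooth_ext H => // -[x y] /sol[-> _].
- have H := smoothM oS (smoothB oS (smoothM oS (s2 0 0) (s1 1)) (smoothM oS (s2 0 1) (s1 0))) sd.
  by apply: smooth_ext H => // -[x y] /sol[_ ->].
Qed.

End Spray.

Section Geodesics.
Context {R : realType}.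
Local Notation E := 'rV[R]_2.
Local Notation e := (@basis_vec R 2).
Context (U : set E) (F : E -> E -> R) (oU : open U) (hF : slit_finsler U F).

Definition unpair (z : 'rV[R]_(2 + 2)) : E * E := (lsubmx z, rsubmx z).

Lemma unpair_affine v : exists w, forall z (h : R), unpair (h *: v + z) = h *: w + unpair z.
Proof. by exists (unpair v) => z h; congr pair; rewrite /= linearP. Qed.

Lemma unpair_continuous : continuous unpair.
Proof.
move=> z; apply/cont_epsdelta => eps eps0; exists eps => // z' zz'.
apply: le_trans (ltW zz'); rewrite prod_normE /= ge_max; apply/andP; split.
  by apply: rV_norm_le => // j; have := rV_coord_le (z' - z) (lshift 2 j); rewrite !mxE.
by apply: rV_norm_le => // j; have := rV_coord_le (z' - z) (rshift 2 j); rewrite !mxE.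
Qed.

Definition geodesic_field (z : 'rV[R]_(2 + 2)) : 'rV[R]_(2 + 2) :=
  row_mx (rsubmx z) (\row_i (- 2 * spray F (lsubmx z) (rsubmx z) i)).

(** Geodesics with prescribed unit initial velocity.  They are integral curves of
    the geodesic field; F stays equal to 1 along them because its derivative
    along the field vanishes. *)
Lemma geodesic_exists x y : slit U (x, y) -> F x y = 1 ->
  exists (T : R) (c v : R -> E), [/\ 0 < T, c 0 = x /\ v 0 = y,
    finsler_geodesic U F [set t | `|t| < T] c,
    forall t : R, `|t| < T -> is_derive t 1 c (v t) &
    forall t : R, `|t| < T -> is_derive t 1 v (\row_i (- 2 * spray F (c t) (v t) i))].
Proof.
move=> Uz Fxy1.
pose W := unpair @^-1` slit U.
have oS := slit_open oU.
have oW : open W by apply: open_comp => // z _; exact: unpair_continuous.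
have pull (f : E * E -> R) : smooth_on (slit U) f -> smooth_on W (f \o unpair).
  move=> Hf; apply: (smooth_affine oW (U' := slit U) _ _ unpair_affine Hf) => // z.
  exact: unpair_continuous.
have sX k : smooth_on W (fun z => geodesic_field z 0 k).
  have [j|j] := fintype.splitP k => jk.
    have Hj := pull _ (coord_smooth j oS).
    apply: smooth_ext Hj => // z _.
    have -> : k = lshift 2 j by exact/val_inj.
    by rewrite /geodesic_field row_mxEl.
  have Hj := smoothMl (- 2) oW (pull _ (spray_smooth oU hF j)).
  apply: smooth_ext Hj => // z _.
  have -> : k = rshift 2 j by exact/val_inj.
  by rewrite /geodesic_field row_mxEr mxE.
have Wz : W (row_mx x y) by rewrite /W /= /unpair row_mxKl row_mxKr.
have [r [T [r0 T0 H]]] := @flow_exists R (2 + 2) W geodesic_field (row_mx x y) 1 oW Wz ltr01 sX.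
have [|g [g0 Hg]] := H (row_mx x y); first by rewrite subrr normr0 ltW.
pose c t := lsubmx (g t) : E; pose v t := rsubmx (g t) : E.
have dc (t : R) : `|t| < T -> is_derive t 1 c (v t).
  move=> tT; have [_ _ dg] := Hg t tT; apply: is_derive_rV => j.
  have := is_derive_coord (lshift 2 j) dg.
  rewrite /geodesic_field row_mxEl.
  by rewrite (_ : (fun s => g s 0 (lshift 2 j)) = (fun s => c s 0 j)) //; apply/funext => s;
      rewrite mxE.
have dv (t : R) : `|t| < T -> is_derive t 1 v (\row_i (- 2 * spray F (c t) (v t) i)).
  move=> tT; have [_ _ dg] := Hg t tT; apply: is_derive_rV => j.
  have := is_derive_coord (rshift 2 j) dg.
  rewrite /geodesic_field row_mxEr.
  by rewrite (_ : (fun s => g s 0 (rshift 2 j)) = (fun s => v s 0 j)) //; apply/funext => s;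
      rewrite mxE.
have c0 : c 0 = x by rewrite /c g0 row_mxKl.
have v0 : v 0 = y by rewrite /v g0 row_mxKr.
have Sc (t : R) : `|t| < T -> slit U (c t, v t) by move=> tT; have [] := Hg t tT.
have F1 (t : R) : `|t| < T -> F (c t) (v t) = 1.
  move=> tT; have [|th _] := @MVT_sym R (fun s => F (c s) (v s)) (fun=> 0) t.
    move=> s st; have sT := le_lt_trans st tT; have [Ws _ dg] := Hg s sT.
    have dif : differentiable (tot F \o unpair) (g s).
      exact (smooth_differentiable (@frame_rV R (2 + 2)) oW (pull _ (tot_smooth hF)) Ws).
    have D := is_derive_curve dif dg.
    suff E0 : 'D_(geodesic_field (g s)) (tot F \o unpair) (g s) = 0 by rewrite E0 in D; exact: D.
    rewrite (@derive_affine _ _ _ _ (tot F) unpair (g s) _ (unpair (geodesic_field (g s))));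
        last first.
      by move=> h; congr pair; rewrite /= linearP.
    rewrite /unpair (derive_tangent _ _ oU (tot_smooth hF) Ws).
    rewrite /geodesic_field row_mxKl row_mxKr.
    have [_ ] := spray_relations oU hF Ws.
    rewrite !mxE -/(c s) -/(v s) -/(Fx F 0) -/(Fx F 1) -/(Fy F 0) -/(Fy F 1).
    have key (a b x0 x1 f0 f1 G0 G1 : R) : a * x0 + b * x1 = 2 * (f0 * G0 + f1 * G1) ->
        a * x0 + b * x1 + (- 2 * G0 * f0 + - 2 * G1 * f1) = 0.
      by move=> ->; ring.
    exact: key.
  by rewrite mul0r c0 v0 Fxy1 => /eqP; rewrite subr_eq0 => /eqP.
have dc1 (t : R) : `|t| < T -> derive1 c t = v t.
  by move=> tT; rewrite derive1E; have [_ ->] := dc t tT.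
have near_cv (t : R) : `|t| < T -> \near t, v t = derive1 c t.
  move=> tT; apply/nbhs_normP; exists (T - `|t|); first by rewrite /= subr_gt0.
  move=> s /= ts; rewrite dc1 //.
  by rewrite -[s](subrK t) (le_lt_trans (ler_normD _ _)) // -ltrBrDr distrC.
exists T, c, v; split => // t tT.
have dd : is_derive t 1 (derive1 c) (\row_i (- 2 * spray F (c t) (v t) i)).
  exact: near_eq_is_derive (near_cv t tT) (dv t tT).
split.
- by have [] := Sc t tT.
- by have [] := dc t tT.
- by have [] := dd.
- by rewrite dc1 //; exact: F1.
- move=> i; rewrite [in X in X + _]derive1E; have [_ ->] := dd.
  by rewrite mxE dc1 //; ring.
Qed.

End Geodesics.

(** * Douglas metrics *)

Section Douglas.
Context {R : realType}.
Local Notation E := 'rV[R]_2.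
Local Notation e := (@basis_vec R 2).

Definition gquad (Gam : 'I_2 -> 'I_2 -> 'I_2 -> E -> R) (i : 'I_2) (x y : E) : R :=
  \sum_j \sum_k Gam i j k x * y 0 j * y 0 k.

(** The area form of the acceleration Gam(y, y) and the velocity y.  It depends only on the
    unparametrized geodesics of the connection. *)
Definition cubic (Gam : 'I_2 -> 'I_2 -> 'I_2 -> E -> R) (x y : E) : R :=
  gquad Gam 0 x y * y 0 1 - gquad Gam 1 x y * y 0 0.

Lemma cubicZ Gam x y r : cubic Gam x (r *: y) = r ^+ 3 * cubic Gam x y.
Proof. by rewrite /cubic /gquad !sum2 !mxE; ring. Qed.

Context (U : set E) (F : E -> E -> R) (oU : open U) (hF : slit_finsler U F).
Context (Gam : 'I_2 -> 'I_2 -> 'I_2 -> E -> R).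
Context (geoF : geodesics_reparam U F Gam).

(** A reparametrization changes the acceleration by a multiple of the velocity
    only, which the area form with the velocity does not see. *)
Lemma spray_cubic_unit x y : slit U (x, y) -> F x y = 1 ->
  2 * (spray F x y 0 * y 0 1 - spray F x y 1 * y 0 0) = cubic Gam x y.
Proof.
move=> Uz F1; have [T [c [v [T0 [c0 v0] gc dc dv]]]] := geodesic_exists oU hF Uz F1.
pose I := [set t : R | `|t| < T].
have oI : open_interval I.
  split; last by rewrite (_ : I = [set t | `|t - 0| < T]); [exact: open_normball|apply/seteqP;
      split => t; rewrite /I /= subr0].
  move=> a b Ia Ib z /andP[az zb]; move: Ia Ib; rewrite /I /= !ltr_norml.
  by move=> /andP[h1 h2] /andP[h3 h4]; apply/andP; split; lra.
have [J [r [[[iJ oJ] sr r0 rJ] ga]]] := geoF oI gc.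
have [s Js rs] : (r @` J) 0 by rewrite rJ /I /= normr0.
have rT t : J t -> `|r t| < T by move=> Jt; have : I (r t); [rewrite -rJ; exists t|].
have dr (t : R) : J t -> is_derive t 1 r ('D_1 r t) by move=> Jt; exact: smooth_is_derive sr Jt.
have dcr (t : R) j : J t -> is_derive t 1 (fun t => (c \o r) t 0 j) (v (r t) 0 j * 'D_1 r t).
  move=> Jt; have D := is_derive_coord j (dc _ (rT _ Jt)).
  exact: (is_derive_comp1 (g := fun s => c s 0 j) D (dr t Jt)).
have d1 (t : R) j : J t -> derive1 (c \o r) t 0 j = v (r t) 0 j * 'D_1 r t.
  move=> Jt; have [_ d _ _] := ga t Jt.
  by rewrite derive1E derive_mx // mxE; have [_ ->] := dcr t j Jt.
have d2 j : derive1 (derive1 (c \o r)) s 0 j =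
    v (r s) 0 j * 'D_1 ('D_1 r) s + 'D_1 r s * (- 2 * spray F (c (r s)) (v (r s)) j * 'D_1 r s).
  have [_ _ d _] := ga s Js.
  rewrite derive1E derive_mx // mxE.
  have D1 : is_derive s 1 (fun t => v (r t) 0 j) (- 2 * spray F (c (r s)) (v (r s)) j * 'D_1 r s).
    have D := is_derive_coord j (dv _ (rT _ Js)); rewrite mxE in D.
    exact: (is_derive_comp1 (g := fun s => v s 0 j) D (dr s Js)).
  have D2 := smooth_is_derive (1 : R) (smooth_derive sr (1 : R)) Js.
  have D3 := is_deriveM D1 D2.
  have Ed t : J t -> derive1 (c \o r) t 0 j = v (r t) 0 j * 'D_1 r t by move=> Jt; exact: d1.
  rewrite (derive_near (1 : R) oJ Js Ed); have [_ E3] := D3; exact: E3.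
have rs0 : 'D_1 r s != 0 by rewrite -derive1E; exact: r0.
have eqn i : v (r s) 0 i * 'D_1 ('D_1 r) s
    + 'D_1 r s ^+ 2 * (gquad Gam i x y - 2 * spray F x y i) = 0.
  have [_ _ _ /(_ i)] := ga s Js.
  rewrite d2 /gquad !sum2 !d1 //= rs c0 v0.
  move: ('D_1 ('D_1 r) s) ('D_1 r s) (spray F x y i) => a b sp.
  by move=> <-; ring.
move: (eqn 0) (eqn 1); rewrite rs v0 /cubic.
move: ('D_1 ('D_1 r) s) ('D_1 r s) rs0 (spray F x y 0) (spray F x y 1) (gquad Gam 0 x y) (gquad
    Gam 1 x y).
move: (y 0 0) (y 0 1) => a b q d d0 s0 s1 q0 q1 E0 E1.
apply/eqP; rewrite -subr_eq0; apply/eqP; apply: (mulfI (expf_neq0 2 d0)); rewrite mulr0.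
have -> : d ^+ 2 * (2 * (s0 * b - s1 * a) - (q0 * b - q1 * a)) =
  a * (b * q + d ^+ 2 * (q1 - 2 * s1)) - b * (a * q + d ^+ 2 * (q0 - 2 * s0)) by ring.
by rewrite E0 E1 !mulr0 subrr.
Qed.

(** Both sides have degree 0 in the fibre, so it suffices to know the relation on
    the indicatrix. *)
Lemma omega_cubic x y : slit U (x, y) ->
  omega F (x, y) = cubic Gam x y * hess F (x, y).
Proof.
move=> Uz; have F0 := tot_gt0 hF Uz.
pose l := (tot F (x, y))^-1; have l0 : 0 < l by rewrite invr_gt0.
have Uz' := slitZ l0 Uz.
have F1 : F x (l *: y) = 1.
  by have := tot_homog hF y Uz.1 l0; rewrite /tot /= => ->; rewrite /l /tot /= mulVf // gt_eqF.
have [E _] := spray_relations oU hF Uz'.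
have C := spray_cubic_unit Uz' F1.
rewrite C cubicZ in E.
have Om : omega F (x, l *: y) = omega F (x, y).
  by rewrite /omega (Fxy_homog oU hF 1 0 l0 Uz) (Fxy_homog oU hF 0 1 l0 Uz).
have He : l ^+ 3 * hess F (x, l *: y) = hess F (x, y).
  have h0 := Fyy_homog oU hF 0 0 l0 Uz; have h1 := Fyy_homog oU hF 1 1 l0 Uz.
  have N := sqnorm_gt0 Uz.2.
  rewrite /hess -h0 -h1 /= !mxE; move: (y 0 0) (y 0 1) N => a b N.
  move: (Fyy F 0 0 (x, l *: y)) (Fyy F 1 1 (x, l *: y)) => p q.
  have N0 : a ^+ 2 + b ^+ 2 != 0 by rewrite gt_eqF.
  have ln : l != 0 by rewrite gt_eqF.
  have key (p' q' a' b' l' : R) : l' != 0 -> a' ^+ 2 + b' ^+ 2 != 0 ->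
     l' ^+ 3 * ((p' + q') / ((l' * a') ^+ 2 + (l' * b') ^+ 2)) = (l' * p' + l' * q') / (a' ^+ 2
         + b' ^+ 2).
    move=> k1 k2; field; rewrite k2 /=.
    by rewrite !exprMn -mulrDr mulf_neq0 // expf_neq0.
  exact: key.
by rewrite -Om -E -He; ring.
Qed.

End Douglas.

(** * The equation p' = t q p'' on the line *)

Section Ends.
Context {R : realType}.

(** The behaviour of a function at an end of the line is read off a function of
    the inverse variable that is continuous at 0. *)
Definition end_value (sg : R) (f : R -> R) (l : R) : Prop :=
  exists A : R -> R, [/\ {for 0, continuous A}, A 0 = l &
    forall t, 0 < sg * t -> f t = A t^-1].

Lemma end_value_near sg f l (eps M : R) : sg ^+ 2 = 1 -> end_value sg f l -> 0 < eps ->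
  exists t, [/\ 0 < sg * t, M < sg * t & `|f t - l| <= eps].
Proof.
move=> s1 [A [cA <- HA]] e0; have [d d0 Hd] := (cont_epsdelta A 0).1 cA _ e0.
pose T := `|M| + 1 + d^-1.
have d1 : 0 < d^-1 by rewrite invr_gt0.
have T0 : 0 < T by rewrite /T; have := normr_ge0 M; lra.
exists (sg * T).
have -> : sg * (sg * T) = T by rewrite mulrA -expr2 s1 mul1r.
split => //.
  by rewrite /T; have := ler_norm M; lra.
have sg1 : `|sg| = 1.
  by apply/eqP; rewrite -(@eqrXn2 _ 2) // -normrX s1 normr1 expr1n.
rewrite HA; last by rewrite mulrA -expr2 s1 mul1r.
apply: Hd; rewrite subr0 normfV normrM sg1 mul1r gtr0_norm //.
by rewrite invf_plt ?posrE // /T; have := normr_ge0 M; lra.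
Qed.

Lemma end_value_unique sg f l (c : R) : sg ^+ 2 = 1 -> end_value sg f l ->
  (forall eps, 0 < eps -> exists M, forall t, M < sg * t -> `|f t - c| <= eps) -> l = c.
Proof.
move=> s1 H Hc; apply/eqP; rewrite -subr_eq0 -normr_le0; apply/ler_addgt0Pr => eps e0.
have e2 : 0 < eps / 2 by rewrite divr_gt0.
have [M HM] := Hc _ e2; have [t [_ Mt Ht]] := end_value_near M s1 H e2.
rewrite add0r -(subrKA (f t)) (le_trans (ler_normD _ _)) // [leRHS]splitr lerD ?HM //.
by rewrite distrC.
Qed.

Lemma nonincreasing_ends (f : R -> R) l l' : (forall s t, s <= t -> f t <= f s) ->
  end_value 1 f l -> end_value (-1) f l' -> forall t, l <= f t <= l'.
Proof.
move=> H H1 H2 t; apply/andP; split; apply/ler_addgt0Pr => eps e0.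
- have [s [_]] := end_value_near t (expr1n _ 2) H1 e0; rewrite mul1r => ts.
  by have := H t s (ltW ts); rewrite ler_norml => h /andP[h1 h2]; lra.
- have s1 : (-1 : R) ^+ 2 = 1 by rewrite sqrrN expr1n.
  have [s [_]] := end_value_near (- t) s1 H2 e0; rewrite mulN1r ltrN2 => ts.
  by have := H s t (ltW ts); rewrite ler_norml => h /andP[h1 h2]; lra.
Qed.

Lemma end_valueN sg f l : end_value sg f l -> end_value sg (fun t => - f t) (- l).
Proof.
move=> [A [cA A0 HA]]; exists (fun s => - A s); split; last by move=> t /HA ->.
  by apply: cvgN; exact: cA.
by rewrite A0.
Qed.

Lemma derive_le0_nonincreasing (f df : R -> R) : (forall t : R, is_derive t 1 f (df t)) ->
  (forall t, df t <= 0) -> forall s t, s <= t -> f t <= f s.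
Proof.
move=> D H s t st.
have [|c _ E] := @MVT_segment R f df s t st (fun x _ => D x).
  by apply: derivable_within_continuous => x _; case: (D x).
by rewrite -subr_le0 E mulr_le0_ge0 // subr_ge0.
Qed.

Lemma derive0_const (f : R -> R) : (forall t : R, is_derive t 1 f 0) -> forall s t, f s = f t.
Proof. by move=> D s t; exact: is_derive_0_is_cst. Qed.

End Ends.

Section Profile.
Context {R : realType}.

Definition quadr (e n t : R) : R := 1 + e * t + n * t ^+ 2.

(** The restriction of a norm to an affine line of the fibre, when p' = P p'' for a cubic
    polynomial P and the origin of the line is the zero of p': then P(0) = 0 and P'(0) = 1,
    so that P = t q with q = 1 + e t + n t^2. *)
Definition profile (e n : R) (p p1 p2 p3 : R -> R) : Prop :=
  [/\ [/\ forall t : R, is_derive t 1 p (p1 t), forall t : R, is_derive t 1 p1 (p2 t),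
         forall t : R, is_derive t 1 p2 (p3 t) & {for 0, continuous p3}],
      forall t, 0 < p2 t & forall t, p1 t = t * quadr e n t * p2 t].

Lemma is_derive_quadr (e n t : R) : is_derive t 1 (quadr e n) (e + 2 * n * t).
Proof.
have D1 : is_derive t 1 (fun t : R => e * t) e.
  have := is_deriveM (is_derive_cst e t (1 : R)) (is_derive_id t (1 : R)).
  by move=> D; apply: (is_derive_eq D); rewrite /GRing.scale /=; ring.
have D2 : is_derive t 1 (fun t : R => n * t ^+ 2) (2 * n * t).
  have := is_deriveM (is_derive_cst n t (1 : R)) (is_deriveM (is_derive_id t (1 : R))
      (is_derive_id t (1 : R))).
  rewrite (_ : cst n * (id * id) = (fun t : R => n * t ^+ 2)); last by apply/funext => s;
      rewrite expr2.
  by move=> D; apply: (is_derive_eq D); rewrite /GRing.scale /=; ring.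
have := is_deriveD (is_deriveD (is_derive_cst (1 : R) t (1 : R)) D1) D2.
by move=> D; apply: (is_derive_eq D); rewrite add0r.
Qed.

Context (e n : R) (p p1 p2 p3 : R -> R) (H : profile e n p p1 p2 p3).
Local Notation q := (quadr e n).
Local Notation N := (fun t => q t ^+ 3 * p2 t ^+ 2).

Lemma profile_D (t : R) : [/\ is_derive t 1 p (p1 t), is_derive t 1 p1 (p2 t) &
  is_derive t 1 p2 (p3 t)].
Proof. by case: H => -[]. Qed.

(** Differentiating p' = t q p'' gives this relation away from 0, and it extends
    to 0 by continuity. *)
Lemma profile_third t : q t * p3 t = - (2 * e + 3 * n * t) * p2 t.
Proof.
pose D s := q s * p3 s + (2 * e + 3 * n * s) * p2 s.
suff D0 : D t = 0 by apply/eqP; rewrite -subr_eq0 mulNr opprK -/(D t) D0.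
have Dn s : s != 0 -> D s = 0.
  move=> s0; have [_ d1 d2] := profile_D s.
  have D1 : is_derive s 1 p1 (q s * p2 s + s * ((e + 2 * n * s) * p2 s + q s * p3 s)).
    have := is_deriveM (is_deriveM (is_derive_id s (1 : R)) (is_derive_quadr e n s)) d2.
    rewrite (_ : id * q * p2 = p1); last by apply/funext => u; case: H => _ _ ->.
    move=> D'; apply: (is_derive_eq D'); rewrite /GRing.scale /= -[(id * q) s]/(s * q s).
    by ring.
  have E : p2 s = q s * p2 s + s * ((e + 2 * n * s) * p2 s + q s * p3 s).
    by have [_ e1] := d1; have [_ e2] := D1; exact: etrans (esym e1) e2.
  apply: (mulfI s0); rewrite mulr0.
  have -> : s * D s = (q s * p2 s + s * ((e + 2 * n * s) * p2 s + q s * p3 s)) - p2 s.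
    by rewrite /D /quadr; ring.
  by rewrite -E subrr.
have [->|] := eqVneq t 0; last exact: Dn.
have cD : {for 0, continuous D}.
  have cq (s : R) : {for s, continuous q}.
    by apply/differentiable_continuous/derivable1_diffP; case: (is_derive_quadr e n s).
  apply: cvgD; apply: cvgM.
  - exact: cq.
  - by case: H => -[].
  - by apply: cvgD; [exact: cvg_cst|apply: cvgM; [exact: cvg_cst|exact: cvg_id]].
  - by apply/differentiable_continuous/derivable1_diffP; have [_ _ []] := profile_D 0.
apply/eqP; rewrite -normr_le0; apply/ler_addgt0Pr => eps e0; rewrite add0r.
have [d d0 Hd] := (cont_epsdelta D 0).1 cD _ e0.
have d2 : 0 < d / 2 by rewrite divr_gt0.
have := Hd (d / 2); rewrite subr0 gtr0_norm // Dn ?gt_eqF // sub0r normrN; apply.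
by rewrite ltr_pdivrMr // ltr_pMr // ltr1n.
Qed.

(** N = q^3 p''^2 is the monotone quantity of the problem: by profile_third the sign of its
    derivative is that of - e. *)
Lemma profile_N (t : R) : is_derive t 1 N (- e * (q t * p2 t) ^+ 2).
Proof.
have [_ _ d2] := profile_D t; have dq := is_derive_quadr e n t.
have := is_deriveM (is_deriveX 3 dq) (is_deriveX 2 d2).
rewrite !exprfctE => D; apply: (is_derive_eq D).
rewrite /GRing.scale /=.
have E := profile_third t.
transitivity (q t ^+ 2 * p2 t * (2 * (q t * p3 t) + 3 * (e + 2 * n * t) * p2 t)); first by ring.
by rewrite E; ring.
Qed.

(** Since p' = t q p'', N is also p'^2 q / t^2, whose value at an end is n times the square of
    the end value of p'. *)
Lemma profile_N_end sg a : sg ^+ 2 = 1 -> end_value sg p1 a -> end_value sg N (a ^+ 2 * n).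
Proof.
move=> s1 [A [cA <- HA]].
exists (fun s => A s ^+ 2 * (s ^+ 2 + e * s + n)); split.
- rewrite /prop_for /continuous_at; apply: cvgM.
    by rewrite (_ : (fun s => _) = (fun s => A s * A s)); [apply: cvgM|apply/funext => s;
        rewrite expr2].
  apply: cvgD; last exact: cvg_cst.
  apply: cvgD; last by apply: cvgM; [exact: cvg_cst|exact: cvg_id].
  rewrite (_ : (fun s => _) = (fun s => s * s)) ?expr2; last by apply/funext => s; rewrite expr2.
  by apply: cvgM; exact: cvg_id.
- by rewrite mulr0 expr0n /= !add0r.
move=> t st; rewrite -HA //.
have t0 : t != 0 by apply: contraTneq st => ->; rewrite mulr0 ltxx.
have [_ _ ->] := H; rewrite /quadr; field; exact: t0.
Qed.

Lemma profile_N_bounds a b : end_value 1 p1 a -> end_value (-1) p1 (- b) ->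
  (0 <= e -> forall t, a ^+ 2 * n <= N t <= b ^+ 2 * n) /\
  (e <= 0 -> forall t, b ^+ 2 * n <= N t <= a ^+ 2 * n).
Proof.
move=> Ha Hb.
have s1 : (-1 : R) ^+ 2 = 1 by rewrite sqrrN expr1n.
have NA := profile_N_end (expr1n _ 2) Ha; have NB := profile_N_end s1 Hb.
rewrite sqrrN in NB; split => he.
- apply: nonincreasing_ends NA NB.
  apply: derive_le0_nonincreasing profile_N _ => t.
  by rewrite mulNr oppr_le0 mulr_ge0 // sqr_ge0.
- move=> t; have := @nonincreasing_ends R _ _ _ _ (end_valueN NA) (end_valueN NB) t.
  rewrite !lerN2 andbC; apply.
  apply: (@derive_le0_nonincreasing R _ (fun t => - (- e * (q t * p2 t) ^+ 2))).
    by move=> s; have := profile_N s; exact: is_deriveN.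
  by move=> s; rewrite mulNr opprK mulr_le0_ge0 // sqr_ge0.
Qed.

End Profile.

Section ProfilePair.
Context {R : realType}.

(** The two profiles share e and n, so their quantities N are monotone in the same
    direction; as their end values are exchanged, both are constant.  This excludes e <> 0. *)
Lemma profile_pair (e n a b : R) (p p1 p2 p3 r r1 r2 r3 : R -> R) :
  profile e n p p1 p2 p3 -> profile e n r r1 r2 r3 -> 0 < a -> 0 < b ->
  end_value 1 p1 a -> end_value (-1) p1 (- b) ->
  end_value 1 r1 b -> end_value (-1) r1 (- a) ->
  [/\ e = 0, 0 < n, a = b,
    forall t, quadr e n t ^+ 3 * p2 t ^+ 2 = a ^+ 2 * n &
    forall t, quadr e n t ^+ 3 * r2 t ^+ 2 = a ^+ 2 * n].
Proof.
move=> Hp Hr a0 b0 p_a p_b r_b r_a.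
have [P1 P2] := profile_N_bounds Hp p_a p_b; have [R1 R2] := profile_N_bounds Hr r_b r_a.
have [E [Np Nr]] : a ^+ 2 * n = b ^+ 2 * n /\
   ((forall t, quadr e n t ^+ 3 * p2 t ^+ 2 = a ^+ 2 * n) /\
    (forall t, quadr e n t ^+ 3 * r2 t ^+ 2 = a ^+ 2 * n)).
  have [he|he] := leP 0 e.
    have {}P1 := P1 he; have {}R1 := R1 he.
    have E : a ^+ 2 * n = b ^+ 2 * n.
      by have /andP[h1 h2] := P1 0; have /andP[h3 h4] := R1 0; apply/le_anti/andP; split; lra.
    by split=> //; split=> t; [move: (P1 t)|move: (R1 t)]; rewrite -E => h; exact/esym/le_anti.
  have {}P2 := P2 (ltW he); have {}R2 := R2 (ltW he).
  have E : a ^+ 2 * n = b ^+ 2 * n.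
    by have /andP[h1 h2] := P2 0; have /andP[h3 h4] := R2 0; apply/le_anti/andP; split; lra.
  by split=> //; split=> t; [move: (P2 t)|move: (R2 t)]; rewrite -E => h; exact/esym/le_anti.
have q0 : quadr e n 0 = 1 by rewrite /quadr; ring.
have p20 : 0 < p2 0 by case: Hp.
have n0 : 0 < n.
  have : 0 < a ^+ 2 * n by rewrite -(Np 0) q0 expr1n mul1r exprn_gt0.
  by rewrite pmulr_rgt0 // exprn_gt0.
split => //.
- have [_ D] := profile_N Hp 0.
  have D0 : 'D_1 (fun t => quadr e n t ^+ 3 * p2 t ^+ 2) 0 = 0.
    by rewrite (_ : (fun t => _) = cst (a ^+ 2 * n)) ?derive_cst //; apply/funext.
  move: D; rewrite D0 q0 mul1r mulNr => /esym/eqP; rewrite oppr_eq0 mulf_eq0.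
  by rewrite expf_eq0 /= (gt_eqF p20) orbF => /eqP.
- apply/eqP; rewrite -(@eqrXn2 _ 2) ?ltW //; apply/eqP.
  by apply: (mulIf _ E); rewrite gt_eqF.
Qed.

(** At the zero of p' the derivative of p' = P p'' reads p'' = P'(0) p''. *)
Lemma profile_normalize (c1 c2 c3 d : R) (p1 p2 : R -> R) :
  is_derive (0 : R) 1 p1 (p2 0) -> is_derive (0 : R) 1 p2 d -> p2 0 != 0 ->
  (forall t, p1 t = (c1 * t + c2 * t ^+ 2 + c3 * t ^+ 3) * p2 t) -> c1 = 1.
Proof.
move=> [_ E1] D2 p20 H.
have := is_deriveM (is_deriveM (is_derive_id (0 : R) (1 : R))
   (is_deriveD (is_derive_cst (c1 - 1) (0 : R) (1 : R)) (is_derive_quadr c2 c3 0))) D2.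
rewrite (_ : _ * _ * p2 = p1); last first.
  apply/funext => t; rewrite H -[LHS]/(t * ((c1 - 1) + quadr c2 c3 t) * p2 t) /quadr; ring.
move=> [_]; rewrite E1 /GRing.scale /=.
rewrite -[(cst _ + _) 0]/((c1 - 1) + quadr c2 c3 0) -[(id * _) 0]/(0 * ((c1 - 1) + quadr c2 c3 0)).
move=> E; apply: (mulIf p20); rewrite mul1r [RHS]E /quadr; ring.
Qed.

(** For e = 0 the function p - q^2 p'' / n is constant, and it has the same value at the
    ends as p - t p'.  Together with q^3 p''^2 = K this gives p. *)
Lemma profile_solve (n K sg c : R) (p p1 p2 p3 : R -> R) : sg ^+ 2 = 1 ->
  profile 0 n p p1 p2 p3 -> 0 < n -> (forall t, quadr 0 n t ^+ 3 * p2 t ^+ 2 = K) ->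
  end_value sg (fun t => p t - t * p1 t) c ->
  forall t, 0 < p t - c /\ (p t - c) ^+ 2 = K * (1 + n * t ^+ 2) / n ^+ 2.
Proof.
move=> s1 H n0 HK Hc; pose q := quadr 0 n.
have nn : n != 0 by rewrite gt_eqF.
have q0 t : 0 < q t by rewrite /q /quadr mul0r addr0 ltr_wpDr // mulr_ge0 ?sqr_ge0 // ltW.
have p20 t : 0 < p2 t by case: H.
have p1E t : p1 t = t * q t * p2 t by case: H => _ _; apply.
have K0 : 0 < K by rewrite -(HK 0) mulr_gt0 // exprn_gt0 //; exact: q0.
pose c0 := p 0 - q 0 ^+ 2 * p2 0 / n.
have pE t : p t = c0 + q t ^+ 2 * p2 t / n.
  pose rho t := p t - q t ^+ 2 * p2 t * n^-1.
  suff E : rho t = rho 0 by rewrite /c0 -/(rho 0) -E /rho subrK.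
  apply: derive0_const => s; have [d1 _ d3] := profile_D H s.
  have D := is_deriveB d1 (is_deriveM (is_deriveM (is_deriveX 2 (is_derive_quadr 0 n s)) d3)
      (is_derive_cst n^-1 s (1 : R))).
  rewrite !exprfctE in D; apply: (is_derive_eq D).
  rewrite /GRing.scale /= p1E -/(q s).
  have E := profile_third H s; rewrite -/(q s) in E.
  rewrite -[(_ * p2) s]/(q s ^+ 2 * p2 s).
  have -> : s * q s * p2 s - (q s ^+ 2 * p2 s * 0 + n^-1 *
    (q s ^+ 2 * p3 s + p2 s * (2 * q s ^+ 1 * (0 + 2 * n * s)))) =
    s * q s * p2 s - n^-1 * q s * (q s * p3 s + 4 * n * s * p2 s) by ring.
  by rewrite E; field.
have Ec : c = c0.
  apply: (end_value_unique s1 Hc) => eps e0.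
  exists (1 + K / (n ^+ 3 * eps ^+ 2)) => t Mt.
  have -> : p t - t * p1 t - c0 = q t * p2 t / n.
    by rewrite pE p1E /q /quadr; field.
  have M0 : 0 < K / (n ^+ 3 * eps ^+ 2) by rewrite divr_gt0 // mulr_gt0 // exprn_gt0.
  have t2 : K / (n ^+ 3 * eps ^+ 2) < t ^+ 2.
    rewrite -(mul1r (t ^+ 2)) -s1 -exprMn; apply: lt_trans (_ : sg * t < _).
      by lra.
    by rewrite expr2 ltr_pMr //; lra.
  have hp : 0 <= q t * p2 t / n by rewrite divr_ge0 ?mulr_ge0 // ltW.
  rewrite ger0_norm // -(@ler_pXn2r _ 2) ?nnegrE ?(ltW e0) //.
  have -> : (q t * p2 t / n) ^+ 2 = K / (q t * n ^+ 2).
    by rewrite -(HK t) -/(q t); field; rewrite nn gt_eqF.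
  rewrite ler_pdivrMr ?mulr_gt0 ?exprn_gt0 //.
  have : K < t ^+ 2 * (n ^+ 3 * eps ^+ 2) by rewrite -ltr_pdivrMr // mulr_gt0 // exprn_gt0.
  have : 0 < eps ^+ 2 * n ^+ 2 by rewrite mulr_gt0 // exprn_gt0.
  have -> : eps ^+ 2 * (q t * n ^+ 2) = eps ^+ 2 * n ^+ 2 + t ^+ 2 * (n ^+ 3 * eps ^+ 2).
    by rewrite /q /quadr; ring.
  by lra.
move=> t; rewrite Ec pE addrC addKr; split.
  by rewrite divr_gt0 // mulr_gt0 // exprn_gt0.
rewrite -(HK t) -/(q t) (_ : 1 + n * t ^+ 2 = q t); last by rewrite /q /quadr; ring.
by field.
Qed.

End ProfilePair.

(** * The restriction of the metric to a fibre *)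

Section Line.
Context {R : realType}.
Local Notation E := 'rV[R]_2.
Local Notation e := (@basis_vec R 2).
Context (U : set E) (F : E -> E -> R) (oU : open U) (hF : slit_finsler U F).
Context (x : E) (Ux : U x).

Lemma slitI (y : E) : y != 0 -> slit U (x, y).
Proof. by move=> y0; exact: conj Ux y0. Qed.

Definition det2 (v w : E) : R := v 0 0 * w 0 1 - v 0 1 * w 0 0.

Definition Dw (w : E) (G : E * E -> R) : E * E -> R := 'D_(0, w) G.

Lemma Dw_smooth w G : smooth_on (slit U) G -> smooth_on (slit U) (Dw w G).
Proof. by move=> HG; exact: smooth_derive HG (0, w). Qed.

Lemma is_derive_fibre (G : E * E -> R) (u w : E) (t : R) : smooth_on (slit U) G ->
  u + t *: w != 0 -> is_derive t 1 (fun t : R => G (x, u + t *: w)) (Dw w G (x, u + t *: w)).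
Proof.
move=> HG y0.
have L (s : R) : (x, u + s *: w) = (x, u) + s *: (0, w) :> E * E.
  by congr pair; rewrite /= scaler0 addr0.
have D : is_derive ((x, u) + t *: (0, w)) (0, w) G (Dw w G (x, u + t *: w)).
  by rewrite -L; exact: smooth_is_derive.
have := is_derive_line D.
by rewrite (_ : (fun h => _) = (fun t : R => G (x, u + t *: w))) //; apply/funext => s; rewrite L.
Qed.

Lemma DwE w G (y : E) : smooth_on (slit U) G -> y != 0 ->
  Dw w G (x, y) = w 0 0 * 'D_(diry 0) G (x, y) + w 0 1 * 'D_(diry 1) G (x, y).
Proof.
move=> HG y0; rewrite /Dw (derive_tangent _ _ oU HG (slitI y0)).
by rewrite !mxE !mul0r !add0r.
Qed.

Lemma DwF w (y : E) : y != 0 -> Dw w (tot F) (x, y) = w 0 0 * Fy F 0 (x, y) + w 0 1 * Fy F 1 (x, y).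
Proof. by move=> y0; rewrite DwE //; exact: tot_smooth. Qed.

(** The Hessian annihilates y, so only the component of w transverse to y counts. *)
Lemma DwDwF w (y : E) : y != 0 -> Dw w (Dw w (tot F)) (x, y) = hess F (x, y) * det2 w y ^+ 2.
Proof.
move=> y0; have Uz := slitI y0; have oS := slit_open oU.
have s1 := Fy_smooth hF.
have sc i := smooth_cst (slit U) (w 0 i).
have E z : slit U z -> Dw w (tot F) z = w 0 0 * Fy F 0 z + w 0 1 * Fy F 1 z.
  case: z => x' y' Uz'; rewrite /Dw (derive_tangent _ _ oU (tot_smooth hF) Uz').
  by rewrite !mxE !mul0r !add0r.
have D1 i : 'D_(0, w) (fun z => w 0 i * Fy F i z) (x, y) =
    w 0 i * (w 0 0 * Fyy F 0 i (x, y) + w 0 1 * Fyy F 1 i (x, y)).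
  rewrite (derive_scale _ _ (s1 i) Uz).
  exact: (f_equal (fun r => w 0 i * r) (DwE w (s1 i) y0)).
rewrite {1}/Dw (derive_near (0, w) oS Uz E).
have H0 := smooth_is_derive (0, w) (smoothM oS (sc 0) (s1 0)) Uz.
have H1 := smooth_is_derive (0, w) (smoothM oS (sc 1) (s1 1)) Uz.
have [_ H2] := is_deriveD H0 H1.
rewrite [LHS]H2 (D1 0) (D1 1).
have [-> -> -> ->] := hess_entries oU hF Uz.
have key (h a b c d : R) : a * (a * (h * d ^+ 2) + b * - (h * c * d)) + b * (a * - (h * c * d) +
    b * (h * c ^+ 2))
   = h * (a * d - b * c) ^+ 2 by ring.
exact: key.
Qed.

Lemma DwF_homog w (y : E) (r : R) : y != 0 -> 0 < r -> Dw w (tot F) (x, r *: y) = Dw w (tot F)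
    (x, y).
Proof.
move=> y0 r0; have Uz := slitI y0.
have [_ y0'] := slitZ r0 Uz.
by rewrite !DwF // !(Fy_homog oU hF _ r0 Uz).
Qed.

Lemma DwF_euler (y : E) : y != 0 -> Dw y (tot F) (x, y) = F x y.
Proof. by move=> y0; rewrite DwF //; exact: (euler_F oU hF (slitI y0)). Qed.

(** dF is homogeneous of degree 0 in y, and u + t w has the direction of sg w + u / |t|.
    Thus the ends of the line are seen at the vectors w and - w of the fibre. *)
Lemma DwF_end (u w v : E) (sg : R) : sg ^+ 2 = 1 -> w != 0 -> (forall t, u + t *: w != 0) ->
  end_value sg (fun t => Dw v (tot F) (x, u + t *: w)) (Dw v (tot F) (x, sg *: w)).
Proof.
move=> s1 w0 y0; exists (fun s => Dw v (tot F) (x, sg *: (w + s *: u))).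
have sg0 : sg != 0 by apply: contra_eq_neq s1 => ->; rewrite expr0n eq_sym oner_eq0.
split; last 2 first.
- by rewrite scale0r addr0.
- move=> t st; have t0 : t != 0 by apply: contraTneq st => ->; rewrite mulr0 ltxx.
  have E : u + t *: w = (sg * t) *: (sg *: (w + t^-1 *: u)).
    by rewrite scalerA mulrAC -expr2 s1 mul1r scalerDr scalerA divff // scale1r addrC.
  have h : sg *: (w + t^-1 *: u) != 0.
    by apply: contraNneq (y0 t) => h; rewrite E h scaler0.
  by rewrite E; exact: (DwF_homog v h st).
have sw0 : sg *: w != 0 by rewrite scaler_eq0 negb_or sg0.
have H : is_derive (0 : R) 1 (fun s => Dw v (tot F) (x, sg *: w + s *: (sg *: u)))
   (Dw (sg *: u) (Dw v (tot F)) (x, sg *: w + 0 *: (sg *: u))).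
  apply: is_derive_fibre; first exact: Dw_smooth (tot_smooth hF).
  by rewrite scale0r addr0.
have [d _] := H.
rewrite (_ : (fun s => _) = (fun s => Dw v (tot F) (x, sg *: w + s *: (sg *: u)))).
  by apply/differentiable_continuous/derivable1_diffP.
by apply/funext => s; rewrite scalerDr !scalerA mulrC.
Qed.

Lemma fibre_profile (en nn : R) (u w : E) : (forall t, u + t *: w != 0) -> det2 w u ^+ 2 = 1 ->
  (forall t, Dw w (tot F) (x, u + t *: w) = t * quadr en nn t * hess F (x, u + t *: w)) ->
  profile en nn (fun t => F x (u + t *: w)) (fun t => Dw w (tot F) (x, u + t *: w))
    (fun t => Dw w (Dw w (tot F)) (x, u + t *: w))
    (fun t => Dw w (Dw w (Dw w (tot F))) (x, u + t *: w)).
Proof.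
move=> y0 dt H.
have sF := tot_smooth hF.
have det_const t : det2 w (u + t *: w) = det2 w u by rewrite /det2 !mxE; ring.
have E2 t : Dw w (Dw w (tot F)) (x, u + t *: w) = hess F (x, u + t *: w).
  by rewrite DwDwF // det_const dt mulr1.
split; [split|..].
- by move=> t; apply: (@is_derive_fibre (tot F)).
- by move=> t; apply: is_derive_fibre => //; exact: Dw_smooth.
- by move=> t; apply: is_derive_fibre => //; do 2 apply: Dw_smooth.
- have D := @is_derive_fibre (Dw w (Dw w (Dw w (tot F)))) u w 0 _ (y0 0).
  have [|d _] := D; first by do 3 apply: Dw_smooth.
  by apply/differentiable_continuous/derivable1_diffP.
- by move=> t; rewrite E2; exact: (hess_gt0 oU hF (slitI (y0 t))).
- by move=> t; rewrite H E2.
Qed.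

(** The restriction of F to one fibre.  Along the two opposite affine lines
    u + t w and - (u + t w), with w spanning ker ds, both restrictions solve the
    same equation p' = P p'' with P a cubic polynomial; the values of the
    derivatives at the four ends are F(w) and - F(- w), crosswise.  This forces
    p'' to be the second derivative of a square root of a quadratic polynomial,
    and the same one on both lines. *)
Lemma fibre_randers (s : E) (K : E -> R) : s != 0 ->
  (forall y, y != 0 -> s 0 0 * Fy F 1 (x, y) - s 0 1 * Fy F 0 (x, y) = K y * hess F (x, y)) ->
  (forall y, K (- y) = - K y) ->
  (forall u w, exists c0 c1 c2 c3 : R, forall t,
     K (u + t *: w) = c0 + c1 * t + c2 * t ^+ 2 + c3 * t ^+ 3) ->
  exists (m a2 c : R) (u : E), [/\ 0 < m, 0 < a2, u != 0, hess F (x, u) = hess F (x, - u) &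
    forall y, F x y = Num.sqrt (m * lin_form s y ^+ 2 + a2 * det2 u y ^+ 2) + c * lin_form s y].
Proof.
move=> s0 HK Kodd Kpoly.
have sF := tot_smooth hF.
have n0 := sqnorm_gt0 s0.
pose w : E := - s 0 1 *: e 0 + s 0 0 *: e 1.
have w0E : w 0 0 = - s 0 1 by rewrite !mxE /= mulr1 mulr0 addr0.
have w1E : w 0 1 = s 0 0 by rewrite !mxE /= mulr1 mulr0 add0r.
have lfE y : lin_form s y = s 0 0 * y 0 0 + s 0 1 * y 0 1 by rewrite /lin_form sum2.
have lw : lin_form s w = 0 by rewrite lfE w0E w1E; ring.
have lD u v t : lin_form s (u + t *: v) = lin_form s u + t * lin_form s v.
  by rewrite !lfE !mxE; ring.
have detw u : det2 w u = - lin_form s u by rewrite /det2 w0E w1E lfE; ring.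
have w_neq0 : w != 0.
  apply: contra s0 => /eqP h; rewrite (vec2 s) -w1E -[s 0 1]opprK -w0E h !mxE.
  by rewrite oppr0 !scale0r addr0.
have nz u : lin_form s u = 1 -> forall t, u + t *: w != 0.
  move=> lu t; apply/eqP => h; have := lD u w t.
  rewrite h lu lw mulr0 addr0 lfE !mxE !mulr0 addr0 => /esym/eqP.
  by rewrite oner_eq0.
have D_eq y : y != 0 -> Dw w (tot F) (x, y) = K y * hess F (x, y).
  by move=> y0; rewrite DwF // w0E w1E -HK //; ring.
have nw0 : - w != 0 by rewrite oppr_eq0.
pose a := F x w; pose b := F x (- w).
have a0 : 0 < a by case: hF => h _ _ _; exact: h.
have b0 : 0 < b by case: hF => h _ _ _; exact: h.
have DwN v (y : E) : y != 0 -> Dw (- v) (tot F) (x, y) = - Dw v (tot F) (x, y).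
  by move=> y0; rewrite !DwF // !mxE; ring.
have Dw_opp : Dw w (tot F) (x, - w) = - b.
  by rewrite -[LHS]opprK -(DwN w (- w) nw0) (DwF_euler nw0).
have sg1 : (-1 : R) ^+ 2 = 1 by rewrite sqrrN expr1n.
(* the base point of the line is put at the minimum of F on it *)
have [u [lu Du]] : exists u, lin_form s u = 1 /\ Dw w (tot F) (x, u) = 0.
  pose u1 : E := (s 0 0 ^+ 2 + s 0 1 ^+ 2)^-1 *: s.
  have lu1 : lin_form s u1 = 1.
    by rewrite lfE !mxE; field; rewrite gt_eqF.
  pose p1 t := Dw w (tot F) (x, u1 + t *: w).
  have E1 : end_value 1 p1 a.
    have := DwF_end w (expr1n _ 2) w_neq0 (nz _ lu1).
    by rewrite scale1r (DwF_euler w_neq0).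
  have E2 : end_value (-1) p1 (- b).
    have := DwF_end w sg1 w_neq0 (nz _ lu1).
    by rewrite scaleN1r Dw_opp.
  have a2 : 0 < a / 2 by rewrite divr_gt0.
  have b2 : 0 < b / 2 by rewrite divr_gt0.
  have [t1 []] := end_value_near 0 (expr1n _ 2) E1 a2; rewrite mul1r => t10 _ h1.
  have [t2 []] := end_value_near 0 sg1 E2 b2; rewrite mulN1r => t20 _ h2.
  have t21 : t2 <= t1 by lra.
  have cp : {within `[t2, t1], continuous p1}.
    apply: derivable_within_continuous => t _.
    by have [] := @is_derive_fibre _ u1 w t (Dw_smooth w sF) (nz _ lu1 t).
  have [|t _ pt] := @IVT R p1 t2 t1 0 t21 cp.
    move: h1 h2; rewrite !ler_norml => /andP[h1 h1'] /andP[h2 h2'].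
    by rewrite ge_min le_max; apply/andP; split; apply/orP; [left|right]; lra.
  by exists (u1 + t *: w); split => //; rewrite lD lu1 lw mulr0 addr0.
have y0 := nz _ lu.
have u0 : u != 0 by have := y0 0; rewrite scale0r addr0.
have [c0 [c1 [c2 [c3 HP]]]] := Kpoly u w.
have opp t : - (u + t *: w) = - u + t *: (- w) by rewrite opprD scalerN.
have y0' t : - u + t *: (- w) != 0 by rewrite -opp oppr_eq0.
have Kp t : Dw w (tot F) (x, u + t *: w) = K (u + t *: w) * hess F (x, u + t *: w).
  exact: D_eq.
have Km t : Dw (- w) (tot F) (x, - u + t *: - w) = K (u + t *: w) * hess F (x, - u + t *: - w).
  by rewrite DwN // D_eq // -opp Kodd; ring.
have hu : hess F (x, u) != 0 by rewrite gt_eqF // (hess_gt0 oU hF (slitI u0)).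
have c00 : c0 = 0.
  have := Kp 0; rewrite HP scale0r addr0 Du.
  rewrite (_ : _ + _ + _ + _ = c0); last by ring.
  by move=> /esym/eqP; rewrite mulf_eq0 (negPf hu) orbF => /eqP.
have det_sq : det2 w u ^+ 2 = 1 by rewrite detw lu sqrrN expr1n.
have det_sq' : det2 (- w) (- u) ^+ 2 = 1.
  by rewrite (_ : det2 (- w) (- u) = det2 w u) // /det2 !mxE; ring.
have det_const v (z : E) t : det2 v (z + t *: v) = det2 v z by rewrite /det2 !mxE; ring.
have E2 t : Dw w (Dw w (tot F)) (x, u + t *: w) = hess F (x, u + t *: w).
  by rewrite (DwDwF w (y0 t)) det_const det_sq mulr1.
have c11 : c1 = 1.
  have D1 := @is_derive_fibre _ u w 0 (Dw_smooth w sF) (y0 0).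
  have D2 := @is_derive_fibre _ u w 0 (Dw_smooth w (Dw_smooth w sF)) (y0 0).
  apply: (profile_normalize D1 D2).
    by rewrite E2 gt_eqF //; exact: (hess_gt0 oU hF (slitI (y0 0))).
  by move=> t; rewrite (Kp t) E2 HP c00 add0r.
have HPt t : K (u + t *: w) = t * quadr c2 c3 t by rewrite HP c00 c11 /quadr; ring.
have Kp' t : Dw w (tot F) (x, u + t *: w) = t * quadr c2 c3 t * hess F (x, u + t *: w).
  by rewrite Kp HPt.
have Km' t : Dw (- w) (tot F) (x, - u + t *: - w) = t * quadr c2 c3 t * hess F (x, - u + t *: - w).
  by rewrite Km HPt.
have Pp := fibre_profile y0 det_sq Kp'.
have Pm := fibre_profile y0' det_sq' Km'.
have p_a : end_value 1 (fun t => Dw w (tot F) (x, u + t *: w)) a.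
  by have := DwF_end w (expr1n _ 2) w_neq0 y0; rewrite scale1r (DwF_euler w_neq0).
have p_b : end_value (-1) (fun t => Dw w (tot F) (x, u + t *: w)) (- b).
  by have := DwF_end w sg1 w_neq0 y0; rewrite scaleN1r Dw_opp.
have r_b : end_value 1 (fun t => Dw (- w) (tot F) (x, - u + t *: - w)) b.
  by have := DwF_end (- w) (expr1n _ 2) nw0 y0'; rewrite scale1r (DwF_euler nw0).
have r_a : end_value (-1) (fun t => Dw (- w) (tot F) (x, - u + t *: - w)) (- a).
  have := DwF_end (- w) sg1 nw0 y0'.
  by rewrite scaleN1r opprK (DwN w w w_neq0) (DwF_euler w_neq0).
have [c20 c30 ab Np Nr] := profile_pair Pp Pm a0 b0 p_a p_b r_b r_a.
rewrite c20 in Pp Pm Np Nr.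
have support v z t : v + t *: z != 0 ->
    F x (v + t *: z) - t * Dw z (tot F) (x, v + t *: z) = Dw v (tot F) (x, v + t *: z).
  move=> h; rewrite -(DwF_euler h) !(DwF _ h) !mxE.
  have key (v0 v1 z0 z1 f0 f1 : R) : (v0 + t * z0) * f0 + (v1 + t * z1) * f1 - t * (z0 * f0 + z1
      * f1)
    = v0 * f0 + v1 * f1 by ring.
  exact: key.
pose c := Dw u (tot F) (x, w); pose c' := Dw u (tot F) (x, - w).
have Sp : forall t, 0 < F x (u + t *: w) - c /\
    (F x (u + t *: w) - c) ^+ 2 = a ^+ 2 * c3 * (1 + c3 * t ^+ 2) / c3 ^+ 2.
  apply: (profile_solve (expr1n _ 2) Pp c30 Np).
  have := DwF_end u (expr1n _ 2) w_neq0 y0; rewrite scale1r.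
  by rewrite (_ : (fun t => _) = (fun t => F x (u + t *: w) - t * Dw w (tot F) (x, u + t *: w)))
      //; apply/funext => t; rewrite (support _ _ _ (y0 t)).
have Sp' : forall t, 0 < F x (u + t *: w) - c' /\
    (F x (u + t *: w) - c') ^+ 2 = a ^+ 2 * c3 * (1 + c3 * t ^+ 2) / c3 ^+ 2.
  apply: (profile_solve sg1 Pp c30 Np).
  have := DwF_end u sg1 w_neq0 y0; rewrite scaleN1r.
  by rewrite (_ : (fun t => _) = (fun t => F x (u + t *: w) - t * Dw w (tot F) (x, u + t *: w)))
      //; apply/funext => t; rewrite (support _ _ _ (y0 t)).
have Sm : forall t, 0 < F x (- u + t *: - w) + c' /\
    (F x (- u + t *: - w) + c') ^+ 2 = a ^+ 2 * c3 * (1 + c3 * t ^+ 2) / c3 ^+ 2.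
  rewrite -[c']opprK; apply: (profile_solve (expr1n _ 2) Pm c30 Nr).
  have := DwF_end (- u) (expr1n _ 2) nw0 y0'; rewrite scale1r (DwN u (- w) nw0).
  by rewrite (_ : (fun t => _) = (fun t => F x (- u + t *: - w) - t * Dw (- w) (tot F) (x, - u +
      t *: - w))) //; apply/funext => t; rewrite (support _ _ _ (y0' t)).
have cc : c' = c.
  have [h1 E1] := Sp 0; have [h2 E3] := Sp' 0.
  have : F x (u + 0 *: w) - c' = F x (u + 0 *: w) - c.
    by apply/eqP; rewrite -(@eqrXn2 _ 2) ?ltW //; apply/eqP; rewrite E1 E3.
  by move=> /addrI/oppr_inj.
pose m := a ^+ 2 / c3.
have c3n : c3 != 0 by rewrite gt_eqF.
have m0 : 0 < m by rewrite divr_gt0 // exprn_gt0.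
have mE t : a ^+ 2 * c3 * (1 + c3 * t ^+ 2) / c3 ^+ 2 = m + a ^+ 2 * t ^+ 2.
  by rewrite /m; field.
have Fp t : F x (u + t *: w) = Num.sqrt (m + a ^+ 2 * t ^+ 2) + c.
  by have [h1 E1] := Sp t; rewrite -mE -E1 sqrtr_sqr ger0_norm ?subrK // ltW.
have Fm t : F x (- (u + t *: w)) = Num.sqrt (m + a ^+ 2 * t ^+ 2) - c.
  have [h1 E1] := Sm t; rewrite cc in h1 E1.
  by rewrite opp -mE -E1 sqrtr_sqr ger0_norm ?addrK // ltW.
have homF l y : 0 < l -> F x (l *: y) = l * F x y by case: hF => _ _ h _; exact: h.
exists m, (a ^+ 2), c, u; split => //; first by rewrite exprn_gt0.
  have hp : 0 < hess F (x, u) by exact: (hess_gt0 oU hF (slitI u0)).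
  have nu0 : - u != 0 by rewrite oppr_eq0.
  have hm : 0 < hess F (x, - u) by exact: (hess_gt0 oU hF (slitI nu0)).
  have E2' : Dw (- w) (Dw (- w) (tot F)) (x, - u + 0 *: - w) = hess F (x, - u).
    by rewrite (DwDwF (- w) (y0' 0)) det_const det_sq' mulr1 scale0r addr0.
  have := Np 0; rewrite E2 scale0r addr0; have := Nr 0; rewrite E2'.
  rewrite (_ : quadr 0 c3 0 = 1); last by rewrite /quadr; ring.
  rewrite expr1n !mul1r => hr hn; apply/eqP.
  by rewrite -(@eqrXn2 _ 2) ?ltW // hn hr.
move=> y; set l := lin_form s y; set r := det2 u y.
have yE : y = l *: u + r *: w.
  have ul : s 0 0 * u 0 0 + s 0 1 * u 0 1 = 1 by rewrite -lfE.
  rewrite [LHS]vec2 [RHS]vec2 ![(_ + _ : E) 0 _]mxE ![(_ *: _ : E) 0 _]mxE w0E w1E /r /l /det2 lfE.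
  congr (_ *: _ + _ *: _).
    by rewrite -[LHS]mul1r -ul; ring.
  by rewrite -[LHS]mul1r -ul; ring.
have [l0|l0|l0] := ltgtP l 0.
- have -> : y = - l *: - (u + (r / l) *: w).
    by rewrite scaleNr scalerN opprK scalerDr scalerA mulrC divfK ?lt_eqF.
  rewrite homF ?oppr_gt0 // Fm.
  have -> : m * l ^+ 2 + a ^+ 2 * r ^+ 2 = (- l) ^+ 2 * (m + a ^+ 2 * (r / l) ^+ 2).
    by field; rewrite lt_eqF.
  by rewrite sqrtrM ?sqr_ge0 // sqrtr_sqr ger0_norm ?oppr_ge0 ?ltW //; ring.
- have -> : y = l *: (u + (r / l) *: w).
    by rewrite scalerDr scalerA mulrC divfK ?gt_eqF.
  rewrite homF // Fp.
  have -> : m * l ^+ 2 + a ^+ 2 * r ^+ 2 = l ^+ 2 * (m + a ^+ 2 * (r / l) ^+ 2).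
    by field; rewrite gt_eqF.
  by rewrite sqrtrM ?sqr_ge0 // sqrtr_sqr ger0_norm ?ltW //; ring.
- rewrite {1}yE l0 scale0r add0r expr0n /= !mulr0 add0r addr0 -exprMn sqrtr_sqr normrM
    (gtr0_norm a0).
  have [r0|r0|r0] := ltgtP r 0.
  + rewrite (_ : r *: w = - r *: - w); last by rewrite scaleNr scalerN opprK.
    by rewrite homF ?oppr_gt0 // -/b -ab ltr0_norm // mulrC.
  + by rewrite homF // -/a gtr0_norm // mulrC.
  + rewrite r0 normr0 mulr0 scale0r.
    have := homF 2 0 (ltr0Sn _ 1); rewrite scaler0 => h.
    by lra.
Qed.

End Line.

(** * Conformal change *)

Lemma quad_form_scale (R : realType) n (A B : 'M[R]_n) (c : R) v :
  (forall i j, A i j = c * B i j) -> quad_form A v = c * quad_form B v.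
Proof.
move=> H; rewrite /quad_form mulr_sumr; apply: eq_bigr => i _.
by rewrite mulr_sumr; apply: eq_bigr => j _; rewrite H !mulrA.
Qed.

Section Conformal.
Context {R : realType}.
Local Notation E := 'rV[R]_2.
Local Notation e := (@basis_vec R 2).
Context (U : set E) (F : E -> E -> R) (s : E -> R).
Context (oU : open U) (hF : slit_finsler U F) (hs : smooth_on U s).

Definition scaled (x y : E) : R := expR (s x) * F x y.
Local Notation cf := (fun z : E * E => expR (s z.1)).

Lemma exp_smooth : smooth_on U (expR \o s).
Proof.
apply: (smooth_comp1 oU (I := setT)) => //.
by apply: smooth_expR; exact: openT.
Qed.

Lemma cf_smooth : smooth_on (slit U) cf.
Proof.
apply: (smooth_affine (slit_open oU) (io := fst) (U' := U) _ _ _ exp_smooth).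
- by move=> z; exact: cvg_fst.
- by move=> z [].
- by move=> v; exists v.1.
Qed.

Lemma cf_diry l z : 'D_(diry l) cf z = 0.
Proof.
rewrite (@derive_affine _ _ _ _ (expR \o s) fst z (diry l) 0) ?derive0 //.
Qed.

Lemma cf_dirx k z : U z.1 -> 'D_(dirx k) cf z = expR (s z.1) * 'D_(e k) s z.1.
Proof.
move=> Uz; rewrite (@derive_affine _ _ _ _ (expR \o s) fst z (dirx k) (e k)) //.
have D := is_derive_comp1 (is_derive_expR (s z.1)) (smooth_is_derive (e k) hs Uz).
by have [_ ->] := D.
Qed.

Lemma scaled_smooth : smooth_on (slit U) (tot scaled).
Proof. by apply: smoothM; [exact: slit_open|exact: cf_smooth|exact: tot_smooth]. Qed.

Lemma scaled_Fy l z : slit U z -> Fy scaled l z = expR (s z.1) * Fy F l z.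
Proof.
move=> Uz; have H := derive_mul (diry l) cf_smooth (tot_smooth hF) Uz.
rewrite (cf_diry l z) mulr0 addr0 in H; exact: H.
Qed.

Lemma scaled_Fyy i l z : slit U z -> Fyy scaled i l z = expR (s z.1) * Fyy F i l z.
Proof.
move=> Uz; rewrite /Fyy (derive_near (diry i) (slit_open oU) Uz (@scaled_Fy l)).
have H := derive_mul (diry i) cf_smooth (Fy_smooth hF l) Uz.
rewrite (cf_diry i z) mulr0 addr0 in H; exact: H.
Qed.

Lemma scaled_Fxy k l z : slit U z ->
  Fxy scaled k l z = expR (s z.1) * (Fxy F k l z + 'D_(e k) s z.1 * Fy F l z).
Proof.
move=> Uz; rewrite /Fxy (derive_near (dirx k) (slit_open oU) Uz (@scaled_Fy l)).
have H := derive_mul (dirx k) cf_smooth (Fy_smooth hF l) Uz.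
rewrite (cf_dirx k Uz.1) in H; rewrite H.
have key (c fxy fy d : R) : c * fxy + fy * (c * d) = c * (fxy + d * fy) by ring.
exact: key.
Qed.

Lemma scaled_finsler : slit_finsler U scaled.
Proof.
case: (hF) => h1 h2 h3 h4; split.
- by move=> x y Ux y0; rewrite mulr_gt0 ?expR_gt0 // h1.
- exact: scaled_smooth.
- by move=> x y l Ux l0; rewrite /scaled h3 //; ring.
- move=> x y Ux y0 v v0; have Uz : slit U (x, y) by [].
  have c0 : 0 < expR (s x) := expR_gt0 _.
  have Q : quad_form (fund_tensor scaled x y) v = expR (s x) ^+ 2 * quad_form (fund_tensor F x y) v.
    have fE i j : fund_tensor scaled x y i j = expR (s x) ^+ 2 * fund_tensor F x y i j.
      have e0 := fund_tensor_smooth i j oU scaled_smooth Uz.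
      have e1 := scaled_Fy i Uz; have e2 := scaled_Fy j Uz; have e3 := scaled_Fyy i j Uz.
      have e4 : tot scaled (x, y) = expR (s x) * tot F (x, y) by [].
      rewrite e1 e2 e3 e4 in e0; rewrite e0 (fund_tensorE oU hF i j Uz).
      have key (c a b f fy : R) : c * a * (c * b) + c * f * (c * fy) = c ^+ 2 * (a * b + f * fy)
          by ring.
      exact: key.
    exact: quad_form_scale.
  by rewrite Q mulr_gt0 ?exprn_gt0 //; exact: h4.
Qed.

Lemma scaled_hess z : slit U z -> hess scaled z = expR (s z.1) * hess F z.
Proof.
by move=> Uz; rewrite /hess (scaled_Fyy 0 0 Uz) (scaled_Fyy 1 1 Uz) -mulrDr mulrA.
Qed.

Lemma scaled_omega z : slit U z -> omega scaled z =
  expR (s z.1) * (omega F z + 'D_(e 1) s z.1 * Fy F 0 z - 'D_(e 0) s z.1 * Fy F 1 z).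
Proof.
move=> Uz; rewrite /omega (scaled_Fxy 1 0 Uz) (scaled_Fxy 0 1 Uz).
have key (c a b d d' f f' : R) : c * (a + d * f) - c * (b + d' * f') = c * (a - b + d * f - d' *
    f') by ring.
exact: key.
Qed.

Context (Gam Gam' : 'I_2 -> 'I_2 -> 'I_2 -> E -> R).
Context (geoF : geodesics_reparam U F Gam) (geoS : geodesics_reparam U scaled Gam').

(** The Douglas relations of F and of e^s F have the same Hessian factor up to e^s, and
    their obstructions omega differ by the term in ds; eliminate omega F. *)
Lemma conformal_relation x y : slit U (x, y) ->
  'D_(e 0) s x * Fy F 1 (x, y) - 'D_(e 1) s x * Fy F 0 (x, y)
   = (cubic Gam x y - cubic Gam' x y) * hess F (x, y).
Proof.
move=> Uz; have E1 := omega_cubic oU hF geoF Uz.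
have E2 := omega_cubic oU scaled_finsler geoS Uz.
rewrite (scaled_omega Uz) (scaled_hess Uz) E1 in E2.
have key (c C C' h a b : R) : c != 0 -> c * (C * h + a - b) = C' * (c * h) -> b - a = (C - C') * h.
  move=> c0 H; apply: (mulfI c0).
  have -> : c * ((C - C') * h) = c * (C * h) - C' * (c * h) by ring.
  by rewrite -H; ring.
by apply: key E2; rewrite gt_eqF // expR_gt0.
Qed.

End Conformal.

(** * Randers metrics with closed 1-form *)

Section LocalRanders.
Context {R : realType}.
Local Notation E := 'rV[R]_2.
Local Notation e := (@basis_vec R 2).

Lemma eE (i j : 'I_2) : e i 0 j = (j == i)%:R.
Proof. by rewrite mxE. Qed.

Lemma e_neq0 (i : 'I_2) : e i != 0.
Proof. by apply/eqP => /rowP /(_ i) /eqP; rewrite !mxE !eqxx /= oner_eq0. Qed.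

Lemma lin_formE (b y : E) : lin_form b y = b 0 0 * y 0 0 + b 0 1 * y 0 1.
Proof. by rewrite /lin_form sum2. Qed.

Definition cubic_diff (Gam Gam' : 'I_2 -> 'I_2 -> 'I_2 -> E -> R) (x y : E) : R :=
  cubic Gam x y - cubic Gam' x y.

Lemma cubicN Gam (x y : E) : cubic Gam x (- y) = - cubic Gam x y.
Proof. by rewrite -scaleN1r cubicZ; ring. Qed.

Lemma cubic_line Gam (x u w : E) : exists c0 c1 c2 c3 : R, forall t,
  cubic Gam x (u + t *: w) = c0 + c1 * t + c2 * t ^+ 2 + c3 * t ^+ 3.
Proof.
pose q0 i := gquad Gam i x u; pose q2 i := gquad Gam i x w.
pose q1 i := gquad Gam i x (u + w) - q0 i - q2 i.
have qE i t : gquad Gam i x (u + t *: w) = q0 i + q1 i * t + q2 i * t ^+ 2.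
  rewrite /q1 /q0 /q2 /gquad !sum2 !mxE.
  by move: (u 0 0) (u 0 1) (w 0 0) (w 0 1) => *; ring.
exists (q0 0 * u 0 1 - q0 1 * u 0 0),
  (q1 0 * u 0 1 + q0 0 * w 0 1 - q1 1 * u 0 0 - q0 1 * w 0 0),
  (q2 0 * u 0 1 + q1 0 * w 0 1 - q2 1 * u 0 0 - q1 1 * w 0 0),
  (q2 0 * w 0 1 - q2 1 * w 0 0) => t.
by rewrite /cubic !qE !mxE; ring.
Qed.

Lemma cubic_diff_line Gam Gam' (x u w : E) : exists c0 c1 c2 c3 : R, forall t,
  cubic_diff Gam Gam' x (u + t *: w) = c0 + c1 * t + c2 * t ^+ 2 + c3 * t ^+ 3.
Proof.
have [a0 [a1 [a2 [a3 Ha]]]] := cubic_line Gam x u w.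
have [b0 [b1 [b2 [b3 Hb]]]] := cubic_line Gam' x u w.
exists (a0 - b0), (a1 - b1), (a2 - b2), (a3 - b3) => t.
by rewrite /cubic_diff Ha Hb; ring.
Qed.

(** The even part of a Randers norm is its Riemannian part, so both the metric
    and the 1-form are recovered by polarization from the values of F at finitely many
    constant vectors; in particular they are smooth. *)
Definition even_part (F : E -> E -> R) (x y : E) : R := 2^-1 * (F x y + F x (- y)).

Definition randers_metric (F : E -> E -> R) (x : E) : 'M[R]_2 :=
  \matrix_(i, j) (2^-1 * (even_part F x (e i + e j) ^+ 2
     - even_part F x (e i) ^+ 2 - even_part F x (e j) ^+ 2)).

Definition randers_form (F : E -> E -> R) (x : E) : E :=
  \row_i (2^-1 * (F x (e i) - F x (- e i))).

Lemma randers_polar (F : E -> E -> R) (x s u : E) (m a2 c : R) : 0 <= m -> 0 <= a2 ->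
  (forall y, F x y = Num.sqrt (m * lin_form s y ^+ 2 + a2 * det2 u y ^+ 2) + c * lin_form s y) ->
  [/\ forall y, F x y = Num.sqrt (quad_form (randers_metric F x) y) + c * lin_form s y,
      forall y, quad_form (randers_metric F x) y = even_part F x y ^+ 2 &
      randers_form F x = c *: s].
Proof.
move=> m0 a0 H; pose Q y := m * lin_form s y ^+ 2 + a2 * det2 u y ^+ 2.
have lN y : lin_form s (- y) = - lin_form s y by rewrite !lin_formE !mxE; ring.
have QN y : Q (- y) = Q y by rewrite /Q lN /det2 !mxE; ring.
have Q0 y : 0 <= Q y by rewrite addr_ge0 // mulr_ge0 // sqr_ge0.
have evE y : even_part F x y = Num.sqrt (Q y).
  by rewrite /even_part !H -/(Q y) -/(Q (- y)) QN lN; field.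
have ev2 y : even_part F x y ^+ 2 = Q y by rewrite evE sqr_sqrtr.
have quadE y : quad_form (randers_metric F x) y = Q y.
  have gE i j : randers_metric F x i j = 2^-1 * (Q (e i + e j) - Q (e i) - Q (e j)).
    by rewrite mxE !ev2.
  rewrite /quad_form !sum2 !gE /Q !lin_formE /det2.
  rewrite ![(e _ + e _) 0 _]mxE !eE /=.
  move: (s 0 0) (s 0 1) (u 0 0) (u 0 1) (y 0 0) (y 0 1) => *; by field.
split.
- by move=> y; rewrite quadE H.
- by move=> y; rewrite quadE ev2.
- apply/rowP => i; rewrite !mxE !H -/(Q (e i)) -/(Q (- e i)) QN lN.
  have -> : lin_form s (e i) = s 0 i.
    by rewrite lin_formE !eE; case: (ord2P i) => -> /=; ring.
  by field.
Qed.

Context (U : set E) (F : E -> E -> R) (s : E -> R).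
Context (oU : open U) (hF : slit_finsler U F) (hs : smooth_on U s).
Context (Gam Gam' : 'I_2 -> 'I_2 -> 'I_2 -> E -> R).
Context (geoF : geodesics_reparam U F Gam) (geoS : geodesics_reparam U (scaled F s) Gam').

Definition dvec (x : E) : E := \row_k 'D_(e k) s x.

Lemma pointwise_randers x : U x -> dvec x != 0 ->
  exists (c : R) (u : E),
  [/\ u != 0, hess F (x, u) = hess F (x, - u),
   forall y, F x y = Num.sqrt (quad_form (randers_metric F x) y) + c * lin_form (dvec x) y,
   forall y, quad_form (randers_metric F x) y = even_part F x y ^+ 2 &
   randers_form F x = c *: dvec x].
Proof.
move=> Ux d0.
have HK (y : E) : y != 0 -> dvec x 0 0 * Fy F 1 (x, y) - dvec x 0 1 * Fy F 0 (x, y)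
    = cubic_diff Gam Gam' x y * hess F (x, y).
  move=> y0; have Uz : slit U (x, y) by [].
  by have := conformal_relation oU hF hs geoF geoS Uz; rewrite !mxE.
have Kodd y : cubic_diff Gam Gam' x (- y) = - cubic_diff Gam Gam' x y.
  by rewrite /cubic_diff !cubicN; ring.
have [m [a2 [c [u [m0 a20 u0 hu H]]]]] :=
  fibre_randers oU hF Ux d0 HK Kodd (cubic_diff_line Gam Gam' x).
have [h1 h2 h3] := randers_polar (ltW m0) (ltW a20) H.
by exists c, u.
Qed.

Lemma fixed_vector_smooth (y : E) : y != 0 -> smooth_on U (fun x => F x y).
Proof.
move=> y0; apply: (smooth_affine oU (io := fun x : E => (x, y)) (U' := slit U) _ _ _ (tot_smooth
    hF)).
- move=> x; apply/cont_epsdelta => eps eps0; exists eps => // x' xx'.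
  rewrite prod_normE /= subrr normr0; apply: le_trans (ltW xx').
  by rewrite ge_max lexx normr_ge0.
- by move=> x Ux.
- by move=> v; exists (v, 0) => x h; congr pair; rewrite /= scaler0 add0r.
Qed.

Lemma randers_form_smooth i : smooth_on U (fun x => randers_form F x 0 i).
Proof.
have n0 : - e i != 0 by rewrite oppr_eq0 e_neq0.
have H := smoothMl 2^-1 oU (smoothB oU (fixed_vector_smooth (e_neq0 i)) (fixed_vector_smooth n0)).
by apply: smooth_ext H => // x _; rewrite mxE.
Qed.

Lemma even_part_smooth (y : E) : y != 0 -> smooth_on U (fun x => even_part F x y).
Proof.
move=> y0; have n0 : - y != 0 by rewrite oppr_eq0.
exact (smoothMl 2^-1 oU (smoothD oU (fixed_vector_smooth y0) (fixed_vector_smooth n0))).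
Qed.

Lemma randers_metric_smooth i j : smooth_on U (fun x => randers_metric F x i j).
Proof.
have n0 : e i + e j != 0.
  apply/eqP => /rowP /(_ i) /eqP; rewrite !mxE !eqxx /=; apply/negP.
  by case: (i == j); rewrite /= ?addr0 ?oner_eq0 // -[1 + 1]/(2%:R) pnatr_eq0.
have S (y : E) (y0 : y != 0) := smoothX 2 oU (even_part_smooth y0).
have H := smoothMl 2^-1 oU (smoothB oU (smoothB oU (S _ n0) (S _ (e_neq0 i))) (S _ (e_neq0 j))).
by apply: smooth_ext H => // x _; rewrite mxE.
Qed.

(** The odd part of F is linear in y, so its fibre derivatives do not depend on y. *)
Lemma odd_part_derive x (y : E) l : U x -> dvec x != 0 -> y != 0 ->
  Fy F l (x, y) + Fy F l (x, - y) = 2 * randers_form F x 0 l.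
Proof.
move=> Ux d0 y0; have [c [u [_ _ H _ Hb]]] := pointwise_randers Ux d0.
have y00 : y + (0 : R) *: e l != 0 by rewrite scale0r addr0.
have y01 : - y + (0 : R) *: - e l != 0 by rewrite scale0r addr0 oppr_eq0.
have D1 := @is_derive_fibre _ _ _ Ux (tot F) y (e l) 0 (tot_smooth hF) y00.
have D2 := @is_derive_fibre _ _ _ Ux (tot F) (- y) (- e l) 0 (tot_smooth hF) y01.
have [_ D] := is_deriveB D1 D2.
have qN z : quad_form (randers_metric F x) (- z) = quad_form (randers_metric F x) z.
  by rewrite /quad_form !sum2 ![(- z) 0 _]mxE; ring.
have E1 : (fun t : R => tot F (x, y + t *: e l)) - (fun t : R => tot F (x, - y + t *: - e l))
   = (fun t => 2 * lin_form (randers_form F x) y + (2 * randers_form F x 0 l) * t).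
  apply/funext => t; rewrite -[LHS]/(F x (y + t *: e l) - F x (- y + t *: - e l)).
  have -> : - y + t *: - e l = - (y + t *: e l) by rewrite opprD scalerN.
  rewrite !H qN Hb !lin_formE ![(- _ : E) 0 _]mxE ![(_ + _ : E) 0 _]mxE ![(_ *: _ : E) 0 _]mxE !eE.
  by case: (ord2P l) => -> /=; ring.
rewrite E1 in D.
have D3 : 'D_1 (fun t => 2 * lin_form (randers_form F x) y + (2 * randers_form F x 0 l) * t) (0 : R)
   = 2 * randers_form F x 0 l.
  have [_ ->] := is_deriveD (is_derive_cst (2 * lin_form (randers_form F x) y) (0 : R) (1 : R))
     (is_deriveM (is_derive_cst (2 * randers_form F x 0 l) (0 : R) (1 : R))
        (is_derive_id (0 : R) (1 : R))).
  by rewrite /GRing.scale /=; ring.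
rewrite D3 in D; rewrite D !scale0r !addr0.
have ny0 : - y != 0 by rewrite oppr_eq0.
rewrite (DwF oU hF Ux (e l) y0) (DwF oU hF Ux (- e l) ny0) ![(- _ : E) 0 _]mxE !eE.
by case: (ord2P l) => -> /=; move: (Fy F 0) (Fy F 1) => f0 f1; ring.
Qed.

End LocalRanders.

Section Potential.
Context {R : realType}.
Local Notation E := 'rV[R]_2.
Local Notation e := (@basis_vec R 2).

Lemma lin_formZ (c : R) (b y : E) : lin_form (c *: b) y = c * lin_form b y.
Proof. by rewrite !lin_formE ![(_ *: _ : E) 0 _]mxE; ring. Qed.

Lemma cancel_swap (a b c d p : R) : p + a * b = p + c * d -> b * a = d * c.
Proof. by move=> /addrI; rewrite mulrC => ->; rewrite mulrC. Qed.

Lemma ltr_half (a : R) : 0 < a / 2 -> a / 2 < a.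
Proof. lra. Qed.

Lemma sum_diff_eq (a b a' b' p q : R) : a - b + (a' - b') = 0 ->
  a + a' = 2 * p -> b + b' = 2 * q -> p = q.
Proof. lra. Qed.

Context (U : set E) (F : E -> E -> R) (s : E -> R).
Context (oU : open U) (hF : slit_finsler U F) (hs : smooth_on U s).
Context (Gam Gam' : 'I_2 -> 'I_2 -> 'I_2 -> E -> R).
Context (geoF : geodesics_reparam U F Gam) (geoS : geodesics_reparam U (scaled F s) Gam').
Local Notation beta k := (fun x => randers_form F x 0 k).

(** The relation of odd_part_derive holds on a whole neighbourhood of x, so it can be
    differentiated in the base point. *)
Lemma mixed_odd_part (W : set E) x (y : E) k l : open W -> W x -> W `<=` U ->
  (forall x, W x -> dvec s x != 0) -> y != 0 ->
  Fxy F k l (x, y) + Fxy F k l (x, - y) = 2 * 'D_(e k) (beta l) x.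
Proof.
move=> oW Wx WU dW y0; have ny0 : - y != 0 by rewrite oppr_eq0.
have sb := smooth_sub WU (randers_form_smooth oU hF l).
rewrite -(derive_scale 2 (e k) sb Wx).
have E1 x' : W x' -> (fun x' => 2 * randers_form F x' 0 l) x' =
    (fun x' => Fy F l (x', y) + Fy F l (x', - y)) x'.
  by move=> Wx'; rewrite (odd_part_derive oU hF hs geoF geoS l (WU _ Wx') (dW _ Wx') y0).
rewrite (derive_near (e k) oW Wx E1).
have part (z : E) : z != 0 -> is_derive x (e k) (fun x' => Fy F l (x', z)) (Fxy F k l (x, z)).
  move=> z0; apply: (@is_derive_affine _ _ _ _ (Fy F l) (fun x' => (x', z)) x (e k) (dirx k)).
    by move=> h; congr pair; rewrite /= scaler0 add0r.
  by apply: (smooth_is_derive _ (Fy_smooth hF l)); split => //; exact: WU.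
by have [_ ->] := is_deriveD (part y y0) (part _ ny0).
Qed.

(** By the Douglas relation omega F is a cubic form times the Hessian factor, which takes
    equal values at u and - u; hence omega F is odd there.  The sum of its values at u and
    - u is twice the exterior derivative of beta. *)
Lemma randers_form_closed (W : set E) x i j : open W -> W x -> W `<=` U ->
  (forall x, W x -> dvec s x != 0) -> 'D_(e i) (beta j) x = 'D_(e j) (beta i) x.
Proof.
move=> oW Wx WU dW.
suff H : 'D_(e 1) (beta 0) x = 'D_(e 0) (beta 1) x.
  by case: (ord2P i) => ->; case: (ord2P j) => ->.
have [c [u [u0 hu _ _ _]]] := pointwise_randers oU hF hs geoF geoS (WU _ Wx) (dW _ Wx).
have nu0 : - u != 0 by rewrite oppr_eq0.
have Uz : slit U (x, u) by split=> //; exact: WU.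
have Uz' : slit U (x, - u) by split=> //; exact: WU.
have E1 := omega_cubic oU hF geoF Uz; have E2 := omega_cubic oU hF geoF Uz'.
rewrite cubicN -hu in E2.
have S : omega F (x, u) + omega F (x, - u) = 0 by rewrite E1 E2 mulNr subrr.
have M1 := mixed_odd_part 1 0 oW Wx WU dW u0; have M0 := mixed_odd_part 0 1 oW Wx WU dW u0.
exact: sum_diff_eq S M1 M0.
Qed.

(** At each point beta = mu ds.  As beta is closed, dmu is proportional to ds, so mu is a
    function m of s near x0, and a primitive Phi of m gives the potential Phi o s of beta.
    If beta does not vanish at x0, neither does Phi' = m, and Phi can be inverted. *)
Lemma local_randers (x0 v : E) : U x0 -> 'D_v s x0 != 0 ->
  exists (W : set E) (Phi : R -> R) (I : set R),
  [/\ [/\ open W, W x0 & W `<=` U],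
      [/\ riemannian_on W (randers_metric F), smooth_on W (randers_form F) &
        forall x y, W x -> F x y = Num.sqrt (quad_form (randers_metric F x) y)
          + lin_form (randers_form F x) y],
      smooth_on W (Phi \o s) /\
        (forall x y, W x -> lin_form (randers_form F x) y = 'D_y (Phi \o s) x),
      [/\ open_interval I, smooth_on I Phi & forall x, W x -> I (s x)] &
      randers_form F x0 != 0 -> exists (J : set R) (gamma : R -> R),
        [/\ open_interval J, smooth_on J gamma, forall x, W x -> J (Phi (s x)) &
          forall x, W x -> s x = gamma (Phi (s x))]].
Proof.
move=> Ux0 dv0.
have fr := @frame_rV R 2.
have dif x : U x -> differentiable s x.
  by move=> Ux; exact (smooth_differentiable fr oU hs Ux).
have dE x y : U x -> 'D_y s x = lin_form (dvec s x) y.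
  move=> Ux; rewrite lin_formE !mxE {1}(vec2 y) derive_comb; last exact: dif.
  by rewrite (deriveZ_dir _ _ (dif _ Ux)); ring.
have [j dj] : exists j, 'D_(e j) s x0 != 0.
  have [h0|h0] := eqVneq ('D_(e 0) s x0) 0; last by exists 0.
  exists 1; apply: contra_neq dv0 => h1.
  by rewrite dE // lin_formE !mxE h0 h1 !mul0r addr0.
have [i [ij ijP]] := two_indices j.
have sj := smooth_derive hs (e j).
pose W0 := U `&` [set x | 'D_(e j) s x != 0].
have oW0 : open W0.
  apply/open_ballP => x [Ux hx].
  have h2 : 0 < `|'D_(e j) s x| / 2 by rewrite divr_gt0 // normr_gt0.
  have cj := smooth_cont sj Ux.
  have [|d d0 Hd] := @cont_ball R E R unit U (fun=> 'D_(e j) s) x _ oU Ux _ h2;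
      first by move=> _; exact: cj.
  exists d => // y /Hd[Uy /(_ tt) H]; split => //=.
  by apply/eqP => h; move: H; rewrite h sub0r normrN; apply/negP; rewrite -ltNge; exact: ltr_half.
have W0x0 : W0 x0 by split.
have W0U : W0 `<=` U by move=> x [].
have dW x : W0 x -> dvec s x != 0.
  by move=> [_ h]; apply: contra h => /eqP/rowP/(_ j); rewrite !mxE => ->.
have bs i' := smooth_sub W0U (randers_form_smooth oU hF i').
pose mu x := randers_form F x 0 j / 'D_(e j) s x.
have smu : smooth_on W0 mu.
  apply: smoothM => //; apply: smoothV => //; first exact: smooth_sub W0U sj.
  by move=> x [].
have pw x : W0 x -> randers_form F x = mu x *: dvec s x /\
    forall y, F x y = Num.sqrt (quad_form (randers_metric F x) y) + lin_form (randers_form F x) y.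
  move=> Wx; have [c [u [_ _ H _ Hb]]] := pointwise_randers oU hF hs geoF geoS (W0U _ Wx) (dW _ Wx).
  have -> : mu x = c by rewrite /mu Hb !mxE mulfK //; case: Wx.
  by split=> [|y]; [exact: Hb|rewrite H Hb lin_formZ].
have bk x k : W0 x -> randers_form F x 0 k = mu x * 'D_(e k) s x.
  by move=> /pw[-> _]; rewrite !mxE.
have wedge x : W0 x -> 'D_(e i) mu x * 'D_(e j) s x = 'D_(e j) mu x * 'D_(e i) s x.
  move=> Wx; have closed := randers_form_closed i j oW0 Wx W0U dW.
  have E1 k l : 'D_(e k) (beta l) x = mu x * 'D_(e k) ('D_(e l) s) x + 'D_(e l) s x * 'D_(e k) mu x.
    rewrite (derive_near (e k) oW0 Wx (fun x' => @bk x' l)).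
    exact: (derive_mul (e k) smu (smooth_sub W0U (smooth_derive hs (e l))) Wx).
  rewrite (E1 i j) (E1 j i) (derive_comm (e i) (e j) oU hs (W0U _ Wx)) in closed.
  exact: cancel_swap closed.
have hs0 := smooth_sub W0U hs.
have [d [I0 [m [d0 [iI0 oI0] sm Hm]]]] :=
  function_of_level oW0 W0x0 hs0 smu ij ijP dj wedge.
have I00 : I0 (s x0) by have [] := Hm x0; rewrite ?subrr ?normr0.
have [eta eta0 Heta] : exists2 eta : R, 0 < eta & forall t, `|t - s x0| <= eta -> I0 t.
  have [r r0 Hr] := (open_ballP _).1 oI0 _ I00.
  exists (r / 2); first by rewrite divr_gt0.
  by move=> t ht; apply: Hr; rewrite (le_lt_trans ht) // ltr_pdivrMr // ltr_pMr // ltr1n.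
have [|t ht|Phi dPhi] := @primitive R m (s x0 - eta) (s x0 + eta).
- by lra.
- have It : I0 t by apply: Heta; rewrite ler_norml; apply/andP; move/andP: ht => [? ?]; split; lra.
  by have H := smooth_cont sm It; exact: H.
pose I1 := [set t : R | `|t - s x0| < eta].
have oI1 : open I1 := @open_normball R R (s x0) eta.
have I1x0 : I1 (s x0) by rewrite /I1 /= subrr normr0.
have interval_ball (a r : R) : is_interval [set t : R | `|t - a| < r].
  move=> t1 t2 /= h1 h2 z /andP[z1 z2]; move: h1 h2; rewrite !ltr_norml.
  by move=> /andP[? ?] /andP[? ?]; apply/andP; split; lra.
have dPhi1 (t : R) : I1 t -> is_derive t 1 Phi (m t).
  by rewrite /I1 /= ltr_norml => /andP[h1 h2]; apply: dPhi; apply/andP; split; lra.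
have sPhi : smooth_on I1 Phi.
  apply: (smooth_primitive oI1 dPhi1); apply: smooth_sub sm => t It.
  by apply: Heta; exact: ltW.
have [eta1 [eta10 eta1e Hgam]] : exists eta1 : R, [/\ 0 < eta1, eta1 <= eta &
   m (s x0) != 0 -> exists (J : set R) (gamma : R -> R), [/\ open_interval J, smooth_on J gamma &
     forall t, `|t - s x0| < eta1 -> J (Phi t) /\ t = gamma (Phi t)]].
  have [m0|m0] := eqVneq (m (s x0)) 0; first by exists eta; split.
  have P0 : 'D_1 Phi (s x0) != 0 by have [_ ->] := dPhi1 _ I1x0.
  have [r [g [J [r0 iJ sg gl _]]]] := inverse_function oI1 I1x0 sPhi P0.
  exists (Num.min eta r); split; first by rewrite lt_min eta0.
    by rewrite ge_min lexx.
  move=> _; exists J, g; split => // t; rewrite lt_min => /andP[_ tr].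
  by have [_ h1 h2] := gl t tr.
have cs : {for x0, continuous s} by have H := smooth_cont hs Ux0; exact: H.
pose W := [set x : E | `|x - x0| < d] `&` (U `&` s @^-1` [set t : R | `|t - s x0| < eta1]).
have oW : open W.
  apply: openI; first exact: open_normball.
  apply/open_ballP => x [Ux sx].
  have gap : 0 < (eta1 - `|s x - s x0|) / 2 by rewrite divr_gt0 // subr_gt0.
  have csx := smooth_cont hs Ux.
  have [|d1 d10 Hd1] := @cont_ball R E R unit U (fun=> s) x _ oU Ux _ gap; first by move=> _;
      exact: csx.
  exists d1 => // y /Hd1[Uy /(_ tt) H]; split=> //=.
  rewrite -(subrKA (s x)); apply: le_lt_trans (ler_normD _ _) _.
  by move: H gap; lra.
have WI x : W x -> `|s x - s x0| < eta1 by move=> [_ [_ h]].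
have WW0 : W `<=` W0 by move=> x [/Hm[]].
have WU : W `<=` U by move=> x /WW0/W0U.
have WI1 x : W x -> I1 (s x) by move=> /WI h; exact: lt_le_trans h eta1e.
have Wx0 : W x0 by split=> /=; [rewrite subrr normr0|split => //=; rewrite subrr normr0].
have mum x : W x -> mu x = m (s x) by move=> [/Hm[]].
exists W, Phi, I1; split.
- by split.
- split; [split|..].
  + by move=> k l; apply: smooth_sub WU (randers_metric_smooth oU hF k l).
  + by move=> x Wx; apply/matrixP => k l; rewrite !mxE (addrC (e l)); ring.
  + move=> x Wx y y0.
    have [c [u [_ _ _ H _]]] := pointwise_randers oU hF hs geoF geoS (WU _ Wx) (dW _ (WW0 _ Wx)).
    rewrite H exprn_gt0 // /even_part mulr_gt0 // addr_gt0 //.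
      by case: (hF) => h _ _ _; apply: h => //; exact: WU.
    by case: (hF) => h _ _ _; apply: h; [exact: WU|rewrite oppr_eq0].
  + have H k := smooth_sub WU (randers_form_smooth oU hF k).
    move=> k; apply: (Ck_ext oW _ (CkD oW (CkZ (e 0) oW (H 0 k)) (CkZ (e 1) oW (H 1 k)))) => x _.
    by rewrite -vec2.
  + by move=> x y Wx; have [_ ->] := pw x (WW0 _ Wx).
- split.
    exact: (smooth_comp1 oW WI1 sPhi (smooth_sub WU hs)).
  move=> x y Wx; have Ux := WU _ Wx.
  have [_ ->] := is_derive_comp1 (dPhi1 _ (WI1 _ Wx)) (smooth_is_derive y hs Ux).
  have [-> _] := pw x (WW0 _ Wx); by rewrite lin_formZ (dE _ _ Ux) (mum _ Wx).
- by split; [split; [exact: interval_ball|exact: oI1]|exact: sPhi|exact: WI1].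
- move=> b0; have m0 : m (s x0) != 0.
    apply: contra b0 => /eqP h; have [-> _] := pw x0 (WW0 _ Wx0).
    by rewrite mum // h scale0r.
  have [J [g [iJ sg Hg]]] := Hgam m0; exists J, g; split => // x /WI /Hg; by case.
Qed.

End Potential.

(** * The theorem *)

Theorem theorem1p2 (R : realType) (M : topologicalType)
    (A : set (chart R 2 M)) (F : chart R 2 M -> 'rV[R]_2 -> 'rV[R]_2 -> R)
    (sigma : M -> R) (p : M) (c : chart R 2 M)
    (hM : smooth_manifold A)
    (hF : finsler_metric A F) (hFD : douglas A F)
    (hsigma : smooth_function A sigma)
    (hsFD : douglas A (conformal sigma F))
    (hc : A c) (hp : chart_dom c p)
    (hdsigma : exists v : 'rV[R]_2,
       'D_v (sigma \o chart_inv c) (chart_map c p) != 0) :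
  exists (V : set M) (g : 'rV[R]_2 -> 'M[R]_2) (b : 'rV[R]_2 -> 'rV[R]_2)
         (f : M -> R),
  let U := chart_map c @` V in
  [/\ [/\ open V, V p & V `<=` chart_dom c],
      [/\ riemannian_on U g, smooth_on U b
        & forall x y, U x ->
            F c x y = Num.sqrt (quad_form (g x) y) + lin_form (b x) y],
      smooth_on U (f \o chart_inv c) /\
        (forall x y, U x -> lin_form (b x) y = 'D_y (f \o chart_inv c) x),
      exists (I : set R) (phi : R -> R),
        [/\ open_interval I, smooth_on I phi, sigma @` V `<=` I
          & forall q, V q -> f q = phi (sigma q)]
    & b (chart_map c p) != 0 ->
      exists (J : set R) (gamma : R -> R),
        [/\ open_interval J, smooth_on J gamma, f @` V `<=` J,
            forall q, V q -> sigma q = gamma (f q)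
          & forall x y, U x ->
              conformal sigma F c x y =
                expR (gamma (f (chart_inv c x))) * Num.sqrt (quad_form (g x) y)
                + expR (gamma (f (chart_inv c x))) * lin_form (b x) y]].
Proof.
have [hF1 _] := hF; have [h1 _ h3 h4 h5] := hF1 c hc.
have sF : slit_finsler (chart_im c) (F c).
  by split => // x y Ux; case: (h1 x y Ux).
have [Gam _ geoF] := hFD; have [Gam' _ geoS] := hsFD.
have [v dv] := hdsigma.
have imp : chart_im c (chart_map c p) by exists p.
have [W [Phi [I [[oW Wp WU] [rg sb FE] [sf df] [iI sPhi WI] gam]]]] :=
  @local_randers R _ _ _ (@chart_im_open _ _ _ c) sF (hsigma c hc) (Gam c) (Gam' c) (geoF c hc)
      (geoS c hc)
    (chart_map c p) v imp dv.
pose V := chart_dom c `&` chart_map c @^-1` W.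
have VE : chart_map c @` V = W.
  apply/seteqP; split => [_ [q [_ Wq] <-] //|x Wx].
  have [q dq qx] := WU _ Wx; exists q => //; split => //=.
  by rewrite /preimage /= qx.
have inW q : V q -> W (chart_map c q) by case.
have invK q : V q -> chart_inv c (chart_map c q) = q by move=> [dq _]; exact: chart_mapK.
exists V, (randers_metric (F c)), (randers_form (F c)), (Phi \o sigma).
move=> U; have -> : U = W := VE; split.
- split => //; last by move=> q [].
  rewrite openE => q [dq Wq]; apply: filterI.
    by apply: open_nbhs_nbhs; split => //; exact: chart_dom_open.
  by apply: (chart_map_continuous dq); apply: open_nbhs_nbhs.
- by split; [exact: rg|exact: sb|exact: FE].
- by split; [exact: sf|exact: df].
- exists I, Phi; split => // _ [q Vq <-].
  by rewrite -(invK q Vq); apply: WI; exact: inW.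
- move=> b0; have [J [g [iJ sg HJ Hg]]] := gam b0.
  exists J, g; split => //.
  + by move=> _ [q Vq <-] /=; rewrite -(invK q Vq); apply: HJ; exact: inW.
  + by move=> q Vq; rewrite -{1 2}(invK q Vq); apply: (Hg _ (inW _ Vq)).
  + move=> x y Wx; rewrite /conformal (FE _ y Wx) mulrDr.
    by have /= <- := Hg x Wx.
Qed.
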